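(* Let $\alpha>0$ and let $f_0$ be a probability density on $[0,1)$ with $f_0\in\Sigma(\alpha,[0,1))$ and $f_0\ge\rho$ for some $\rho>0$. For each $n$, let $L_n$ be the integer closest to the solution $x$ of $2^x=\left(\frac{n}{\log n}\right)^{\frac1{2\alpha+1}}$. Let $(U_n)$ be an arbitrary sequence with $U_n\to\infty$, and suppose that for some $\beta>0$, $R\ge 1$, $\delta>0$ the hyperparameters satisfy $a_l\in[\delta n^{-\beta};R]$ for all $0<l\le L_n$. Endow $f$ with the prior $\Pi=DPA\big(\lfloor\alpha\rfloor,L_n,n,(a_l)_{0<l\le L_n},U_n\big)$. Let $d(f,g)=\|f-g\|_1$ or $d(f,g)=h(f,g)$. Then there is $M>0$, depending on $\rho,\alpha,\|f_0\|_{\Sigma(\alpha)},\beta$ and $R$, such that, as $n\to\infty$, $$\mathbb{E}_{f_0}\,\Pi\left[d(f_0,f)>M\left(\frac{\log n}{n}\right)^{\frac{\alpha}{2\alpha+1}}\;\Big|\;X\right]\longrightarrow 0 .$$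
   Context: Statistical framework: $X=(X_1,\dots,X_n)$. In the Bayesian model $f\sim\Pi$ (a prior on probability densities on $[0,1)$ w.r.t. Lebesgue measure) and $X\mid f\sim P_f^{\otimes n}$, where $P_f$ has density $f$; $\Pi[\cdot\mid X]$ is the resulting posterior. $\mathbb{E}_{f_0}$ is expectation under $X\sim P_{f_0}^{\otimes n}$. $\|\cdot\|_1$ is the $L^1([0,1))$ norm and $h(f,g)=\big(\int_0^1(\sqrt f-\sqrt g)^2\big)^{1/2}$ is the Hellinger distance. $a\vee b=\max(a,b)$, $a\wedge b=\min(a,b)$. $\lfloor a\rfloor$ denotes the greatest integer STRICTLY smaller than $a$. $\Sigma(\alpha,[0,1))$ is the set of $f:[0,1)\to\mathbb{R}$ ($\lfloor\alpha\rfloor$ times differentiable) with $\|f\|_{\Sigma(\alpha)}:=\sup_{x\ne y}\frac{|f^{(\lfloor\alpha\rfloor)}(x)-f^{(\lfloor\alpha\rfloor)}(y)|}{|x-y|^{\alpha-\lfloor\alpha\rfloor}}<\infty$. For $L\ge 1$ and $i\in\mathbb{Z}$ put $H_{L,i}=2^L\mathbf 1_{[i2^{-L},(i+1)2^{-L})}$. Truncated Pólya tree $TPT_L(\mathcal A)$, $\mathcal A=(a_l)_{0<l\le L}$ positive reals: for $0\le i<2^L$ let $\kappa(L,i)\in\{0,1\}^L$ be the sequence $\kappa_1\dots\kappa_L$ with $i2^{-L}=\sum_{j=1}^L\kappa_j2^{-j}$, and for a sequence $\kappa$ let $\kappa^{[j]}$ be its first $j$ entries and $|\kappa|$ its length.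 Let $Y_{\kappa0}\sim\mathrm{Beta}(a_{|\kappa|+1},a_{|\kappa|+1})$, $0\le|\kappa|\le L-1$, be mutually independent and $Y_{\kappa1}=1-Y_{\kappa0}$. Then $g=\sum_{i=0}^{2^L-1}\Theta_iH_{L,i}$ with $\Theta_i=\prod_{j=1}^LY_{\kappa(L,i)^{[j]}}$ has distribution $TPT_L(\mathcal A)$. Aggregation: for $f:\mathbb{R}\to\mathbb{R}$, $q\in\mathbb{N}^*$, $s>0$, let $f^0_{q,s}=f$, $f^1_{q,s}(x)=\frac1q\sum_{i=0}^{q-1}f(x-\frac{is}{q})$ and $f^{k+1}_{q,s}=(f^k_{q,s})^1_{q,s}$. Let $\chi=\mathbf 1_{[0;1]}$, $\chi^{*k}$ the $k$-fold convolution of $\chi$ with itself ($\chi^{*1}=\chi$), and $\omega_{m,i}=\int_0^i\chi^{*(m+1)}(t)\,dt$ for $0<i\le m+1$. Prior $DPA(m,L,q,\mathcal A,U)$ ($m\in\mathbb{N}$, $L\in\mathbb{N}^*$ with $2^{L-1}>m$, $q\in\mathbb{N}^*$, $U>0$): (1a) draw $g=\sum_{i=0}^{2^L-1}\Theta_iH_{L,i}\sim TPT_L(\mathcal A)$. (1b) Given the $\Theta_i$, set $\theta_i=\Theta_i$ for $0\le i\le 2^L-m-1$; for $2^L-m\le i\le 2^L-1$ let $\theta_i=v_i$ with $v_i$ independent and uniform on $\left[0\vee\frac{\Theta_i-(1-\omega_{m,2^L-i})U}{\omega_{m,2^L-i}}\,;\,U\wedge\frac{\Theta_i}{\omega_{m,2^L-i}}\right]$;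 for $2^L\le i\le 2^L+m-1$ let $\theta_i=\frac{\Theta_{i-m}-\omega_{m,2^L+m-i}v_{i-m}}{1-\omega_{m,2^L+m-i}}$. (1c) Let $(u_i)_{i\in\mathbb{Z}}$ be the $(2^L+m)$-periodic sequence with $u_i=\theta_i$ for $0\le i\le 2^L+m-1$. (2) Set $f=\sum_{i\in\mathbb{Z}}u_iH_{L,i}$ and output the restriction to $[0,1)$ of $f^m_{q,2^{-L}}\big/\int_{[0,1)}f^m_{q,2^{-L}}(v)\,dv$. The hyperparameters $a_l$ may depend on $n$. The prior is considered for $n$ large enough that it is well defined. *)

(* Defs.v *)
From HB Require Import structures.
From mathcomp Require Import all_boot all_order all_algebra.
From mathcomp Require Import all_classical all_reals all_analysis.
From mathcomp Require Import measurable_realfun.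

Set Implicit Arguments.
Unset Strict Implicit.
Unset Printing Implicit Defensive.

Import Order.TTheory GRing.Theory Num.Theory.
Import numFieldNormedType.Exports.

Local Open Scope classical_set_scope.
Local Open Scope ring_scope.

Definition I01 {R : realType} : set R := `[0, 1[%classic.

Section with_density.
Context (R : realType) (D : set R) (w : R -> R).

Definition with_density (mD : measurable D) (mw : measurable_fun D w)
    (w0 : forall x, D x -> 0 <= w x) : set (measurableTypeR R) -> \bar R :=
  fun A => (\int[lebesgue_measure]_(x in A `&` D) (w x)%:E)%E.

Hypotheses (mD : measurable D) (mw : measurable_fun D w)
  (w0 : forall x, D x -> 0 <= w x).

Let with_density0 : with_density mD mw w0 set0 = 0%E.
Proof. by rewrite /with_density set0I integral_set0. Qed.

Let with_density_ge0 A : (0 <= with_density mD mw w0 A)%E.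
Proof. by apply: integral_ge0 => x [_ Dx]; rewrite lee_fin w0. Qed.

Let with_density_sigma_additive : semi_sigma_additive (with_density mD mw w0).
Proof.
move=> F mF tF mUF; rewrite /with_density; apply: cvg_toP.
  apply: ereal_nondecreasing_is_cvgn => m n mn.
  apply: lee_sum_nneg_natr => // k _ _.
  by apply: integral_ge0 => x [_ Dx]; rewrite lee_fin w0.
rewrite setI_bigcupl ge0_integral_bigcup//=.
- by move=> k; apply: measurableI.
- apply/measurable_EFinP; apply: measurable_funS mw => //.
  by move=> x [k _ []].
- by move=> x [k _ [_ Dx]]; rewrite lee_fin w0.
- apply/trivIsetP => i j _ _ ij.
  rewrite setIACA setIid; move/trivIsetP: tF => /(_ i j Logic.I Logic.I ij) ->.
  by rewrite set0I.
Qed.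

HB.instance Definition _ := isMeasure.Build _ _ _ (with_density mD mw w0)
  with_density0 with_density_ge0 with_density_sigma_additive.

End with_density.

Section densities.
Context (R : realType).
Local Notation mu := (@lebesgue_measure R).

(* Probability densities on [0, 1); values outside [0, 1) are irrelevant. *)
Record density := Density {
  density_fun :> R -> R;
  measurable_density : measurable_fun I01 density_fun;
  density_ge0 : forall x, I01 x -> 0 <= density_fun x;
  density_int1 : (\int[mu]_(x in I01) (density_fun x)%:E = 1)%E }.

Definition density_prob (f : density) : set (measurableTypeR R) -> \bar R :=
  with_density (measurable_itv `[0, 1[) (@measurable_density f)
    (@density_ge0 f).

HB.instance Definition _ f := Measure.on (density_prob f).

Let density_prob_setT f : density_prob f [set: _] = 1%E.
Proof. by rewrite /density_prob /with_density setTI density_int1. Qed.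

HB.instance Definition _ f := Measure_isProbability.Build _ _ R
  (density_prob f) (density_prob_setT f).

Definition L1_dist (f g : R -> R) : \bar R :=
  (\int[mu]_(x in I01) `|f x - g x|%:E)%E.

Definition hellinger_dist (f g : R -> R) : \bar R :=
  ((\int[mu]_(x in I01) ((Num.sqrt (f x) - Num.sqrt (g x)) ^+ 2)%:E)
    `^ (2%:R^-1))%E.

End densities.

Section holder.
Context (R : realType).

(* For a > 0, the greatest integer strictly smaller than a: see sfloorP. *)
Definition sfloor (a : R) : nat := `|Num.ceil a - 1|%N.

Lemma sfloorP (a : R) : 0 < a -> (sfloor a)%:R < a <= (sfloor a).+1%:R.
Proof.
move=> a0; have c1 : 0 <= Num.ceil a - 1.
  by rewrite subr_ge0 -gtz0_ge1 ceil_gt0.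
have e : (sfloor a)%:R = (Num.ceil a - 1)%:~R :> R.
  by rewrite /sfloor pmulrn gez0_abs.
by rewrite -natr1 e -[1 in X in _ <= X]/(1%:~R) -intrD subrK ceil_itv.
Qed.

(* Derivatives relative to D, hence one-sided at a boundary point of D. *)
Definition diff_quot (f : R -> R) (x y : R) : R := (f y - f x) / (y - x).

Definition derivable_in (D : set R) (f : R -> R) (x : R) : Prop :=
  cvg (diff_quot f x y @[y --> within D x^']).

Definition derive_in (D : set R) (f : R -> R) (x : R) : R :=
  lim (diff_quot f x y @[y --> within D x^']).

Definition derive_in_n (D : set R) (k : nat) (f : R -> R) : R -> R :=
  iter k (derive_in D) f.

Definition derivable_in_n (D : set R) (k : nat) (f : R -> R) : Prop :=
  forall j, (j < k)%N -> forall x, D x -> derivable_in D (derive_in_n D j f) x.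

Definition holder_norm (alpha : R) (f : R -> R) : \bar R :=
  let g := derive_in_n I01 (sfloor alpha) f in
  ereal_sup [set e | exists x y, [/\ I01 x, I01 y, x != y &
    e = (`|g x - g y| / (`|x - y| `^ (alpha - (sfloor alpha)%:R)))%:E]].

Definition holder_class (alpha : R) : set (R -> R) :=
  [set f | derivable_in_n I01 (sfloor alpha) f /\
           (holder_norm alpha f < +oo)%E].

End holder.

Section product_law.
Context (R : realType).
Local Notation RM := (measurableTypeR R).

Definition tuple_cons n (p : RM * n.-tuple RM) : n.+1.-tuple RM :=
  [tuple of p.1 :: p.2].

Lemma measurable_tuple_cons n : measurable_fun [set: _] (@tuple_cons n).
Proof. exact: measurable_cons. Qed.

Definition cons_prob n (P : probability RM R)
    (Q : probability (n.-tuple RM) R) : set (n.+1.-tuple RM) -> \bar R :=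
  pushforward (P \x Q)%E (@tuple_cons n).

Section cons_prob_instances.
Variables (n : nat) (P : probability RM R) (Q : probability (n.-tuple RM) R).

Let cons_prob0 : cons_prob P Q set0 = 0%E.
Proof. by rewrite /cons_prob /pushforward preimage_set0 measure0. Qed.

Let cons_prob_ge0 A : (0 <= cons_prob P Q A)%E.
Proof. exact: (measure_ge0 (P \x Q)%E). Qed.

Let cons_prob_sigma_additive : semi_sigma_additive (cons_prob P Q).
Proof.
move=> F mF tF mUF; rewrite /cons_prob /pushforward preimage_bigcup.
apply: measure_semi_sigma_additive.
- by move=> k; rewrite -[X in measurable X]setTI; exact: measurable_tuple_cons.
- apply/trivIsetP => i j _ _ ij; rewrite -preimage_setI.
  by move/trivIsetP : tF => /(_ i j Logic.I Logic.I ij) ->; rewrite preimage_set0.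
- rewrite -preimage_bigcup -[X in measurable X]setTI.
  exact: measurable_tuple_cons.
Qed.

HB.instance Definition _ := isMeasure.Build _ _ _ (cons_prob P Q)
  cons_prob0 cons_prob_ge0 cons_prob_sigma_additive.

Let cons_prob_setT : cons_prob P Q [set: _] = 1%E.
Proof. by rewrite /cons_prob /pushforward preimage_setT probability_setT. Qed.

HB.instance Definition _ := Measure_isProbability.Build _ _ R
  (cons_prob P Q) cons_prob_setT.

End cons_prob_instances.

(* The law of n independent real random variables, the i-th one with law P i. *)
Fixpoint prod_prob (n : nat) :
    ('I_n -> probability RM R) -> probability (n.-tuple RM) R :=
  match n with
  | 0 => fun=> \d_([tuple] : 0.-tuple RM)
  | n'.+1 => fun P => cons_prob (P ord0) (prod_prob (fun i => P (lift ord0 i)))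
  end.

End product_law.

Section beta_uniform.
Context (R : realType).
Local Notation RM := (measurableTypeR R).

Definition beta_weight (a b : R) (t : R) : R := t `^ (a - 1) * (1 - t) `^ (b - 1).

Lemma measurable_beta_weight (a b : R) :
  measurable_fun (`]0, 1[%classic : set R) (beta_weight a b).
Proof.
apply: measurable_funTS; apply: measurable_funM => /=.
  exact: measurable_powR.
apply: (measurableT_comp (measurable_powR (b - 1))).
exact: measurable_funB.
Qed.

Lemma beta_weight_ge0 (a b t : R) : (`]0, 1[%classic : set R) t -> 0 <= beta_weight a b t.
Proof. by move=> _; rewrite mulr_ge0 ?powR_ge0. Qed.

(* The library's beta_prob is restricted to natural parameters. For a, b > 0
   the mass of the weight is finite and positive, and mnormalize divides by
   it; the Dirac measure is a dummy used only for other parameters. *)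
Definition beta_law (a b : R) : probability RM R :=
  mnormalize (with_density (measurable_itv `]0, 1[)
    (measurable_beta_weight a b) (@beta_weight_ge0 a b)) \d_(0 : RM).

(* The uniform law on [a, b], which is the Dirac measure at a when a = b. *)
Definition uniform_law (a b : R) : probability RM R :=
  match pselect (a < b) with
  | left ab => uniform_prob ab
  | right _ => \d_(a : RM)
  end.

End beta_uniform.

Section polya_tree.
Context (R : realType).
Local Notation RM := (measurableTypeR R).

Definition histo (L : nat) (i : int) (x : R) : R :=
  2 ^+ L * \1_(`[i%:~R * 2 ^- L, (i + 1)%:~R * 2 ^- L[%classic) x.

(* Binary digits of i < 2 ^ L, most significant first. *)
Definition kappa (L i : nat) : seq bool :=
  [seq odd (i %/ 2 ^ (L - j)) | j <- iota 1 L].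

(* The internal nodes of the tree: the bit sequences of length < L. *)
Definition nodes (L : nat) : seq (seq bool) :=
  flatten [seq [seq tval t | t <- enum {: k.-tuple bool}] | k <- iota 0 L].

(* The joint law of the variables Y_(kappa 0), kappa in nodes L. *)
Definition splits_law (L : nat) (a : nat -> R) :
    probability ((size (nodes L)).-tuple RM) R :=
  prod_prob (fun i : 'I_(size (nodes L)) =>
    let l := (size (nth [::] (nodes L) i)).+1 in beta_law (a l) (a l)).

(* Y kap, for kap <> [::], from the values y of the variables Y_(kappa 0). *)
Definition split_var (L : nat) (y : (size (nodes L)).-tuple RM)
    (kap : seq bool) : R :=
  let y0 := nth 0 y (index (take (size kap).-1 kap) (nodes L)) in
  if last false kap then 1 - y0 else y0.

Definition Theta (L : nat) (y : (size (nodes L)).-tuple RM) (i : nat) : R :=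
  \prod_(1 <= j < L.+1) split_var y (take j (kappa L i)).

End polya_tree.

Section DPA.
Context (R : realType).
Local Notation RM := (measurableTypeR R).
Local Notation mu := (@lebesgue_measure R).

Definition aggregate1 (q : nat) (s : R) (f : R -> R) (x : R) : R :=
  q%:R^-1 * \sum_(i < q) f (x - i%:R * s / q%:R).

Definition aggregate (k q : nat) (s : R) (f : R -> R) : R -> R :=
  iter k (aggregate1 q s) f.

Definition chi : R -> R := \1_(`[0, 1]%classic).

Definition convolution (f g : R -> R) (x : R) : R :=
  \int[mu]_t (f (x - t) * g t).

(* [conv_chi k] is the k.+1-fold convolution of chi with itself. *)
Definition conv_chi (k : nat) : R -> R := iter k (convolution chi) chi.

Definition omega (m i : nat) : R :=
  \int[mu]_(t in `[0, i%:R]%classic) conv_chi m t.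

Section given_hyperparameters.
Variables (m L q : nat) (a : nat -> R) (U : R).
Local Notation splits := ((size (nodes L)).-tuple RM).

(* The law of (v_i), 2 ^ L - m <= i < 2 ^ L, given the tree; v_i is stored at
   position i - (2 ^ L - m) of the tuple. *)
Definition boundary_law (y : splits) : probability (m.-tuple RM) R :=
  prod_prob (fun j : 'I_m =>
    let i := (2 ^ L - m + j)%N in
    let w := omega m (2 ^ L - i) in
    uniform_law (Num.max 0 ((Theta y i - (1 - w) * U) / w))
                (Num.min U (Theta y i / w))).

Definition theta (y : splits) (v : m.-tuple RM) (i : nat) : R :=
  let V i := nth 0 v (i - (2 ^ L - m)) in
  if (i < 2 ^ L - m)%N then Theta y i
  else if (i < 2 ^ L)%N then V i
  else (Theta y (i - m) - omega m (2 ^ L + m - i) * V (i - m)%N)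
       / (1 - omega m (2 ^ L + m - i)).

Definition periodized (y : splits) (v : m.-tuple RM) (i : int) : R :=
  theta y v `|(i %% (2 ^ L + m)%N)%Z|%N.

Definition histogram (y : splits) (v : m.-tuple RM) (x : R) : R :=
  \sum_(i \in [set: int]) periodized y v i * histo L i x.

Definition DPA_density (y : splits) (v : m.-tuple RM) : R -> R :=
  let g := aggregate m q (2 ^- L) (histogram y v) in
  fun x => g x / \int[mu]_(t in I01) g t.

(* The expectation of Phi f when f is drawn from the prior: first the tree,
   then the boundary coefficients given the tree. *)
Definition DPA_expectation (Phi : (R -> R) -> \bar R) : \bar R :=
  (\int[splits_law L a]_y \int[boundary_law y]_v Phi (DPA_density y v))%E.

End given_hyperparameters.

Definition likelihood n (x : n.-tuple RM) (f : R -> R) : R :=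
  \prod_(i < n) f (tnth x i).

(* Bayes' formula: the posterior probability of B, given the sample x, for the
   prior whose expectation operator is E. *)
Definition posterior (E : ((R -> R) -> \bar R) -> \bar R) n
    (x : n.-tuple RM) (B : set (R -> R)) : \bar R :=
  (E (fun f => (\1_B f * likelihood x f)%:E) /
   E (fun f => (likelihood x f)%:E))%E.

(* [k] is an integer closest to the solution x of
   2 ^ x = (n / log n) ^ (1 / (2 alpha + 1)); in case of a tie both of the
   closest integers are allowed. *)
Definition closest_resolution (alpha : R) (n k : nat) : Prop :=
  exists2 x : R, 2 `^ x = (n%:R / ln n%:R) `^ (2 * alpha + 1)^-1 &
    forall j : int, `|x - k%:R| <= `|x - j%:~R|.

End DPA.

(* Main.v *)
(* On each grid cell the aggregated histogram is a discrete spline of its coefficients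
   u, so no test, sieve or measurability argument on the prior is needed. Upper bound:
   rounding the coefficients up to a finite grid gives exp (C n eps^2) densities g such that
   every f in the support is at most (1 + 1/n) g for one of them; if f is far from f0, then so
   is g, and the Hellinger affinity of f0 and g is at most exp (- c n eps^2). Lower bound: a
   quasi-interpolant gives spline coefficients t whose density g0 satisfies
   int f0^2 / g0 <= 1 + C eps^2, and every coefficient within a relative 1/n of t yields f with
   g0 <= (1 + 1/n) f. As each of the O(2^L) coordinates of the prior charges such an interval
   with mass at least a power of 1/n, these f have prior mass at least exp (- C n eps^2). *)

(* The exponents match because [2^L * log n] and [n * eps^2] are of the same order at the prescribed
   resolution: [O(2^L)] coefficients, each costing a power of [n] in the cover and a power of [1/n]
   in prior mass, cost [exp (C * n * eps^2)] on both sides. The relative precision [1/n] is what a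
   likelihood tolerates, since [(1 + 1/n)^n <= e]. Two obstacles shape the rest. Aggregation
   averages to the left, so an approximating spline needs [m] coefficients left of 0. The prior
   stores them at the end by periodicity and ties them to the last [m] tree weights by [Theta_i =
   omega * theta_i + (1 - omega) * theta_(i+m)]; the target must be positive and fit this
   constraint. Moreover [M] may depend on [f0] only through [rho] and the Hoelder norm: the upper
   bound of [f0], its modulus of continuity and its local polynomial at 0, like [delta] and [U], may
   only affect how large [n] has to be. *)
Require Import Defs.
From mathcomp Require Import all_boot all_order all_algebra.
From mathcomp Require Import all_classical all_reals all_analysis.
From mathcomp Require Import measurable_realfun.
From mathcomp Require Import ring lra zify.

Import Order.TTheory GRing.Theory Num.Theory.
Import numFieldNormedType.Exports.

Set Implicit Arguments.
Unset Strict Implicit.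
Unset Printing Implicit Defensive.

Local Open Scope classical_set_scope.
Local Open Scope ring_scope.

(** * Integrals over the prior and the sample *)

(* Likelihoods are not shown to be measurable in the variables of the prior:
   the integral of nonnegative functions is monotone without measurability. *)
Section nonmeasurable_integral.
Local Open Scope ereal_scope.
Context d (T : measurableType d) (R : realType) (mu : {measure set T -> \bar R}).

Lemma ge0_le_integral_nomeas (f g : T -> \bar R) :
  (forall x, 0 <= f x) -> (forall x, f x <= g x) ->
  \int[mu]_x f x <= \int[mu]_x g x.
Proof.
move=> f0 fg; have g0 x : 0 <= g x by exact: le_trans (f0 x) (fg x).
rewrite !ge0_integralTE//; apply: le_ereal_sup => _ [h hf <-].
by exists h => // x; exact: le_trans (hf x) (fg x).
Qed.

Lemma ge0_le_integral_ae (A : set T) (f g : T -> \bar R) :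
  measurable A -> mu (~` A) = 0 -> (forall x, 0 <= f x) ->
  (forall x, 0 <= g x) -> measurable_fun setT g ->
  (forall x, A x -> f x <= g x) ->
  \int[mu]_x f x <= \int[mu]_x g x.
Proof.
move=> mA A0 f0 g0 mg fg.
(* The value [+oo] off [A] dominates [f] there and contributes [+oo * 0 = 0] to the integral. *)
pose h x := g x + +oo * (\1_(~` A) x)%:E.
have mAC : measurable (~` A) by exact: measurableC.
have h0 x : 0 <= +oo * (\1_(~` A) x)%:E by rewrite mule_ge0// lee_fin.
have mh : measurable_fun setT (fun x => (\1_(~` A) x)%:E : \bar R).
  exact/measurable_EFinP/measurable_indic.
have mh' : measurable_fun setT (fun x => +oo * (\1_(~` A) x)%:E : \bar R).
  by apply: emeasurable_funM => //; exact: measurable_cst.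
apply: (@le_trans _ _ (\int[mu]_x h x)).
  apply: ge0_le_integral_nomeas => // x; rewrite /h.
  have [xA|xA] := pselect (A x).
    by rewrite (le_trans (fg x xA))// leeDl.
  by rewrite indicE mem_set//= mule1 addey ?leey// gt_eqF// (lt_le_trans _ (g0 x)).
rewrite /h ge0_integralD// ge0_integralZl//.
by rewrite integral_indic// setIT [X in _ * X](A0) mule0 adde0.
Qed.

Lemma ge0_le_integral_indic (A : set T) (c : R) (f : T -> \bar R) :
  measurable A -> (0 <= c)%R -> (forall x, 0 <= f x) ->
  (forall x, A x -> c%:E <= f x) ->
  c%:E * mu A <= \int[mu]_x f x.
Proof.
move=> mA c0 f0 cf.
apply: (@le_trans _ _ (\int[mu]_x (c%:E * (\1_A x)%:E))).
  rewrite ge0_integralZl//; last by apply/measurable_EFinP; exact: measurable_indic.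
  by rewrite integral_indic// setIT.
apply: ge0_le_integral_nomeas => x; first by rewrite mule_ge0// lee_fin.
have [xA|xA] := pselect (A x).
  by rewrite indicE mem_set// mule1 cf.
by rewrite indicE memNset// mule0.
Qed.

Import HBNNSimple.

(** The integral is a supremum over simple functions below [f]. These are measurable even if [f] is
    not, so cutting them down to [A] preserves their integral. *)
Let ge0_integral_restrict_ae (A : set T) (f : T -> \bar R) :
  measurable A -> mu (~` A) = 0 -> (forall x, 0 <= f x) ->
  \int[mu]_x f x = \int[mu]_(x in A) f x.
Proof.
move=> mA A0 f0; rewrite [RHS]integral_mkcond; apply/eqP; rewrite eq_le; apply/andP; split.
  rewrite ge0_integralTE//; apply: ge_ereal_sup => _ [h hf <-].
  rewrite -integralT_nnsfun.
  have mh : measurable_fun setT (EFin \o h).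
    exact/measurable_EFinP.
  apply: (@le_trans _ _ (\int[mu]_x ((EFin \o h) \_ A) x)).
    apply: (@ge0_le_integral_ae A) => //.
    - by move=> x; rewrite lee_fin.
    - by move=> x; apply: erestrict_ge0 => y _; rewrite lee_fin.
    - by apply/(measurable_restrictT _ _).1 => //; exact: measurable_funTS.
    - by move=> x Ax; rewrite patchE mem_set.
  apply: ge0_le_integral_nomeas => x.
    by apply: erestrict_ge0 => y _; rewrite lee_fin.
  by apply: lee_restrict => y _; exact: hf.
apply: ge0_le_integral_nomeas => x; first exact: erestrict_ge0.
by rewrite patchE; case: ifP.
Qed.

Lemma integral_restrict_ae (A : set T) (f : T -> \bar R) :
  measurable A -> mu (~` A) = 0 ->
  \int[mu]_x f x = \int[mu]_(x in A) f x.
Proof.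
move=> mA A0; rewrite integralE [RHS]integralE.
by congr (_ - _); exact: ge0_integral_restrict_ae.
Qed.

End nonmeasurable_integral.

Section with_density_integral.
Local Open Scope ereal_scope.
Context (R : realType) (D : set R) (w : R -> R).
Variables (mD : measurable D) (mw : measurable_fun D w)
  (w0 : forall x, D x -> (0 <= w x)%R).
Local Notation mu := (@lebesgue_measure R).
Local Notation nu := (with_density mD mw w0).
Local Notation RM := (measurableTypeR R).

Import HBNNSimple.

Let mwE : measurable_fun D (fun x => (w x)%:E).
Proof. exact/measurable_EFinP. Qed.

Let integral_with_density_indic (E : set RM) : measurable E ->
  \int[nu]_x (\1_E x)%:E = \int[mu]_(x in D) ((\1_E x)%:E * (w x)%:E).
Proof.
move=> mE; rewrite integral_indic// setIT /= /with_density.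
rewrite integral_mkcondl; apply: eq_integral => x _.
by rewrite patchE indicE; case: ifPn => _; rewrite ?mul1e ?mul0e.
Qed.

Let integral_with_density_nnsfun (f : {nnsfun RM >-> R}) :
  \int[nu]_x (f x)%:E = \int[mu]_(x in D) ((f x)%:E * (w x)%:E).
Proof.
under eq_integral do rewrite fimfunE -fsumEFin//.
rewrite [LHS]ge0_integral_fsum//; last 2 first.
  - by move=> r; exact/measurable_EFinP/measurableT_comp.
  - by move=> n x _; rewrite EFinM nnfun_muleindic_ge0.
under [RHS]eq_integral.
  move=> x xD; rewrite fimfunE -fsumEFin// ge0_mule_fsuml; last first.
    by move=> r; rewrite EFinM nnfun_muleindic_ge0.
  over.
rewrite [RHS]ge0_integral_fsum//; last 2 first.
  - move=> r; apply: emeasurable_funM => //.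
    by apply/measurable_funTS/measurable_EFinP; exact/measurableT_comp.
  - move=> n x Dx; rewrite mule_ge0 ?lee_fin ?w0//.
    by rewrite -lee_fin EFinM nnfun_muleindic_ge0.
apply: eq_fsbigr => r _.
under [in RHS]eq_integral do rewrite EFinM -muleA.
have [r0|r0] := leP 0%R r; last first.
  rewrite preimage_nnfun0// !integral0_eq// => x _;
    by rewrite indic0 ?mulr0 ?mul0e ?mule0.
rewrite [RHS]ge0_integralZl//; last 2 first.
- apply: emeasurable_funM => //.
  by apply/measurable_funTS/measurable_EFinP; exact/measurable_indic.
- by move=> x Dx; rewrite mule_ge0 ?lee_fin ?w0.
by rewrite integralZl_indic_nnsfun// integral_with_density_indic.
Qed.

Lemma ge0_integral_with_density (f : R -> \bar R) :
  measurable_fun [set: R] f -> (forall x, 0 <= f x) ->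
  \int[nu]_x f x = \int[mu]_(x in D) (f x * (w x)%:E).
Proof.
move=> mf f0; pose f_ := nnsfun_approx (measurableT : measurable [set: RM]) mf.
transitivity (lim (\int[nu]_x (f_ n x)%:E @[n --> \oo])).
  rewrite -monotone_convergence//=.
  - apply: eq_integral => ? /[!inE] xD; apply/esym/cvg_lim => //=.
    exact: cvg_nnsfun_approx.
  - by move=> n; exact/measurable_EFinP/measurable_funTS.
  - by move=> n ? _; rewrite lee_fin.
  - by move=> ? _ ? ? mn; rewrite lee_fin; exact/lefP/nd_nnsfun_approx.
rewrite [RHS](_ : _ = lim (\int[mu]_(x in D) ((f_ n x)%:E * (w x)%:E) @[n --> \oo])).
  by apply: congr_lim; apply/funext => n /=; exact: integral_with_density_nnsfun.
rewrite -monotone_convergence//=.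
- apply: eq_integral => x /[!inE] xD; apply/esym/cvg_lim => //.
  by apply: cvgeZr => //; exact: cvg_nnsfun_approx.
- move=> n; apply: emeasurable_funM => //; apply/measurable_funTS.
  exact/measurable_EFinP.
- by move=> n ? ?; rewrite mule_ge0// lee_fin// w0.
- move=> ? ? ? ? ?; rewrite lee_wpmul2r ?lee_fin ?w0//.
  exact/lefP/nd_nnsfun_approx.
Qed.

End with_density_integral.

Section prod_prob_integral.
Local Open Scope ereal_scope.
Context (R : realType).
Local Notation RM := (measurableTypeR R).

Lemma measurable_prod_tnth n (k : 'I_n -> RM -> R) :
  (forall i, measurable_fun setT (k i)) ->
  measurable_fun setT (fun x : n.-tuple RM => (\prod_(i < n) k i (tnth x i))%R).
Proof.
move=> mk; apply: measurable_prod => i _.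
by apply: measurableT_comp => //; exact: measurable_tnth.
Qed.

(** Tonelli along [tuple_cons]. Independence is used only through this formula: it turns sample
    expectations into [n]-th powers and masses of boxes into products. *)
Lemma ge0_integral_prod_prob n (P : 'I_n -> probability RM R)
    (k : 'I_n -> RM -> R) :
  (forall i, measurable_fun setT (k i)) -> (forall i x, (0 <= k i x)%R) ->
  \int[prod_prob P]_x (\prod_(i < n) k i (tnth x i))%:E =
  \prod_(i < n) \int[P i]_x (k i x)%:E.
Proof.
elim: n P k => [|n IH] P k mk k0 /=.
  rewrite integral_dirac// ?big_ord0 ?diracT ?mul1e//.
  by under eq_fun do rewrite big_ord0; exact: measurable_cst.
have mpk := measurable_prod_tnth mk.
rewrite ge0_integral_pushforward//=; last 3 first.
- exact: measurable_tuple_cons.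
- exact/measurable_EFinP.
- by move=> x _; rewrite lee_fin prodr_ge0.
rewrite preimage_setT big_ord_recl.
under eq_integral => x _ do rewrite big_ord_recl/= tnth0.
have mk' (i : 'I_n) : measurable_fun setT (k (lift ord0 i)) by [].
have mlift := measurable_prod_tnth mk'.
have e1 (z : RM * n.-tuple RM) :
    (k ord0 z.1 * \prod_(i < n) k (lift ord0 i) (tnth (tuple_cons z) (lift ord0 i)))%R
    = (k ord0 z.1 * \prod_(i < n) k (lift ord0 i) (tnth z.2 i))%R.
  congr (_ * _)%R; apply: eq_bigr => i _; congr (k _ _).
  by rewrite !(tnth_nth (GRing.zero : R)).
under eq_integral => x _ do rewrite e1.
rewrite fubini_tonelli1//=; last 2 first.
- apply/measurable_EFinP; apply: measurable_funM.
    by apply: measurableT_comp => //; exact: measurable_fst.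
  by apply: (measurableT_comp mlift); exact: measurable_snd.
- by move=> x; rewrite lee_fin mulr_ge0// prodr_ge0.
rewrite /fubini_F/=.
under eq_integral => x _.
  under eq_integral do rewrite EFinM.
  rewrite ge0_integralZl//=; last 3 first.
  - exact/measurable_EFinP.
  - by move=> y _; rewrite lee_fin prodr_ge0.
  - by rewrite lee_fin.
  rewrite (IH (fun i => P (lift ord0 i)) (fun i => k (lift ord0 i)))//.
  over.
under eq_integral do rewrite muleC.
rewrite /= ge0_integralZl//.
- by rewrite muleC.
- exact/measurable_EFinP.
- by move=> x _; rewrite lee_fin.
- by apply: prode_ge0 => i _; apply: integral_ge0 => x _; rewrite lee_fin.
Qed.

Definition box n (A : 'I_n -> set RM) : set (n.-tuple RM) :=
  [set x | forall i, A i (tnth x i)].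

Lemma indic_box n (A : 'I_n -> set RM) x :
  (\1_(box A) x = \prod_(i < n) \1_(A i) (tnth x i) :> R)%R.
Proof.
have [xA|xA] := pselect (box A x).
  by rewrite indicE mem_set// big1// => i _; rewrite indicE mem_set//; exact: xA.
have /existsNP[i Ai] := xA.
rewrite indicE memNset//; apply/esym/eqP; rewrite prodf_seq_eq0/=.
by apply/hasP; exists i; rewrite ?mem_index_enum// indicE memNset.
Qed.

Lemma measurable_box n (A : 'I_n -> set RM) :
  (forall i, measurable (A i)) -> measurable (box A).
Proof.
move=> mA; rewrite (_ : box A = \bigcap_(i in setT) ((fun x => tnth x i) @^-1` A i)).
  apply: fin_bigcap_measurable => // i _; rewrite -[X in measurable X]setTI.
  exact: (@measurable_tnth _ _ _ _ measurableT).
by apply/seteqP; split => [x xA i _|x xA i] /=; [exact: xA|exact: (xA i)].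
Qed.

Lemma prod_prob_box n (P : 'I_n -> probability RM R) (A : 'I_n -> set RM) :
  (forall i, measurable (A i)) ->
  prod_prob P (box A) = \prod_(i < n) P i (A i).
Proof.
move=> mA.
rewrite -[LHS](_ : \int[prod_prob P]_x (\1_(box A) x)%:E = _); last first.
  by rewrite integral_indic// ?setIT//; exact: measurable_box.
under eq_integral do rewrite indic_box.
rewrite (@ge0_integral_prod_prob _ _ (fun i => \1_(A i)))//.
by apply: eq_bigr => i _; rewrite integral_indic ?setIT.
Qed.

Lemma prod_prob_boxC n (P : 'I_n -> probability RM R) (A : 'I_n -> set RM) :
  (forall i, measurable (A i)) -> (forall i, P i (A i) = 1) ->
  prod_prob P (~` box A) = 0.
Proof.
move=> mA PA; rewrite probability_setC; last exact: measurable_box.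
by rewrite prod_prob_box// big1// subee.
Qed.

End prod_prob_integral.

(** * A bound on the posterior at fixed sample size *)

Section posterior_bound.
Context (R : realType).
Local Notation RM := (measurableTypeR R).
Local Notation mu := (@lebesgue_measure R).

Lemma likelihood_gt0 n (x : n.-tuple RM) (f : R -> R) :
  (forall t, I01 t -> 0 < f t) -> box (fun _ : 'I_n => I01) x ->
  0 < likelihood x f.
Proof. by move=> f0 xI; apply: prodr_gt0 => i _; apply: f0; exact: xI. Qed.

Lemma likelihood_ge0 n (x : n.-tuple RM) (f : R -> R) :
  (forall t, I01 t -> 0 <= f t) -> box (fun _ : 'I_n => I01) x ->
  0 <= likelihood x f.
Proof. by move=> f0 xI; apply: prodr_ge0 => i _; apply: f0; exact: xI. Qed.

Lemma expr_1Vn_le n : (1 + n%:R^-1) ^+ n <= expR 1 :> R.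
Proof.
case: n => [|n]; first by rewrite expr0 -expR0 ler_expR.
have -> : expR 1 = expR n.+1%:R^-1 ^+ n.+1 :> R.
  by rewrite -expRM_natl -(mulr_natl _ n.+1) mulfV// pnatr_eq0.
by rewrite lerXn2r ?nnegrE ?addr_ge0 ?expR_ge0 ?expR_ge1Dx.
Qed.

(** A factor [1 + 1/n] per observation amounts to at most [e] over the whole sample. *)
Lemma likelihood_le_expR1 n (x : n.-tuple RM) (f g : R -> R) :
  (forall t, I01 t -> 0 <= f t <= (1 + n%:R^-1) * g t) ->
  (forall t, I01 t -> 0 <= g t) ->
  box (fun _ : 'I_n => I01) x ->
  likelihood x f <= expR 1 * likelihood x g.
Proof.
move=> fg g0 xI.
apply: (@le_trans _ _ (\prod_(i < n) ((1 + n%:R^-1) * g (tnth x i)))).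
  by apply: ler_prod => i _; apply: fg; exact: xI.
rewrite big_split/= prodr_const card_ord ler_wpM2r ?expr_1Vn_le//.
exact: likelihood_ge0.
Qed.

Lemma expectation_prod_density (f0 : density R) n (k : R -> R) (c : R) :
  measurable_fun I01 k -> (forall x, I01 x -> 0 <= k x) ->
  (\int[mu]_(x in I01) (k x * f0 x)%:E <= c%:E)%E ->
  (\int[prod_prob (fun _ : 'I_n => density_prob f0)]_x
     (\prod_(i < n) (k \_ I01) (tnth x i))%:E <= (c ^+ n)%:E)%E.
Proof.
move=> mk k0 kc.
have mI : measurable (I01 : set RM) by exact: measurable_itv.
have mk' : measurable_fun setT (k \_ I01).
  by apply/(measurable_restrictT _ _).1.
have k'0 x : 0 <= (k \_ I01) x.
  by rewrite patchE; case: ifPn => //; rewrite inE; exact: k0.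
rewrite (@ge0_integral_prod_prob _ _ _ (fun=> k \_ I01))//.
rewrite big_const card_ord.
set J := (\int[_]_x _)%E.
have J0 : (0 <= J)%E by apply: integral_ge0 => x _; rewrite lee_fin.
have Jc : (J <= c%:E)%E.
  rewrite /J ge0_integral_with_density//; last exact/measurable_EFinP.
  apply: le_trans kc; rewrite le_eqVlt; apply/orP; left; apply/eqP.
  by apply: eq_integral => x xI; rewrite patchE xI EFinM.
have c0 : 0 <= c by rewrite -lee_fin (le_trans J0).
elim: (n) => [|p IH]/=; first by rewrite expr0.
by rewrite exprS EFinM lee_pmul//; elim: (p) => //= q qH; rewrite mule_ge0.
Qed.

Lemma sqrtr_prod n (F : 'I_n -> R) : (forall i, 0 <= F i) ->
  Num.sqrt (\prod_(i < n) F i) = \prod_(i < n) Num.sqrt (F i).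
Proof.
elim: n F => [|n IH] F F0; first by rewrite !big_ord0 sqrtr1.
by rewrite !big_ord_recl sqrtrM// IH.
Qed.

(** Applied to a sum of likelihood ratios, it leaves terms whose expectations are [n]-th powers of
    affinities. *)
Lemma sqrtr_sum_le (T : eqType) (s : seq T) (F : T -> R) :
  (forall i, i \in s -> 0 <= F i) ->
  Num.sqrt (\sum_(i <- s) F i) <= \sum_(i <- s) Num.sqrt (F i).
Proof.
elim: s => [|t s IH] F0; first by rewrite !big_nil sqrtr0.
have F0s i : i \in s -> 0 <= F i by move=> si; rewrite F0// inE si orbT.
have Ft : 0 <= F t by rewrite F0// inE eqxx.
rewrite !big_cons (le_trans _ (lerD (lexx _) (IH F0s)))//.
have S0 : 0 <= \sum_(i <- s) F i by rewrite big_seq sumr_ge0.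
rewrite -(@ler_pXn2r _ 2)// ?nnegrE ?addr_ge0 ?sqrtr_ge0//.
rewrite sqrrD !sqr_sqrtr ?addr_ge0//.
have := sqrtr_ge0 (F t); have := sqrtr_ge0 (\sum_(i <- s) F i).
by move=> a b; have := mulr_ge0 b a; lra.
Qed.

Lemma measurable_sqrt : measurable_fun setT (@Num.sqrt R).
Proof. by apply: continuous_measurable_fun; exact: sqrt_continuous. Qed.

(* The posterior mass p of B satisfies p <= min(1, X * Y) <= sqrt (K * X) + Y / K, where
   X is the sum over g in S of the likelihood ratios g / f0 (up to a constant factor) and
   Y = f0 / g0; sqrt X is integrated through affinities and Y through a chi-square. *)
Section nonasymptotic.
Variables (E : ((R -> R) -> \bar R) -> \bar R) (supp nb B : set (R -> R)) (pm : R).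
Variables (f0 : density R) (n : nat) (g0 : R -> R) (S : seq (R -> R)) (a b K : R).
(** The prior is seen only through three monotonicity properties, which survive when integrands are
    not known to be measurable. *)
Hypothesis E_le : forall Phi Psi, (forall f, supp f -> 0 <= Phi f <= Psi f)%E ->
  (0 <= E Phi <= E Psi)%E.
Hypothesis E_le_supp : forall Phi c, 0 <= c ->
  (forall f, supp f -> 0 <= Phi f <= c%:E)%E -> (E Phi <= c%:E)%E.
Hypothesis E_ge_nb : forall Phi c, (forall f, supp f -> 0 <= Phi f)%E -> 0 <= c ->
  (forall f, nb f -> c%:E <= Phi f)%E -> ((pm * c)%:E <= E Phi)%E.
Hypothesis pm_gt0 : 0 < pm.
Hypothesis f0_gt0 : forall t, I01 t -> 0 < f0 t.
Hypothesis g0_gt0 : forall t, I01 t -> 0 < g0 t.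
Hypothesis mg0 : measurable_fun I01 g0.
Hypothesis nb_ge : forall f, nb f -> forall t, I01 t ->
  g0 t <= (1 + n%:R^-1) * f t.
Hypothesis supp_ge0 : forall f, supp f -> forall t, I01 t -> 0 <= f t.
Hypothesis nb_supp : forall f, nb f -> supp f.
Hypothesis supp_le : forall f, supp f -> B f ->
  exists2 g, g \in S & forall t, I01 t -> f t <= (1 + n%:R^-1) * g t.
Hypothesis mS : forall g, g \in S -> measurable_fun I01 g.
Hypothesis S_ge0 : forall g, g \in S -> forall t, I01 t -> 0 <= g t.
Hypothesis S_far : forall g, g \in S ->
  (\int[mu]_(x in I01) (Num.sqrt (f0 x * g x))%:E <= a%:E)%E.
Hypothesis g0_close :
  (\int[mu]_(x in I01) (f0 x ^+ 2 / g0 x)%:E <= b%:E)%E.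
Hypothesis K_gt0 : 0 < K.

Let cst_pm := expR 1 / Num.sqrt pm.

Let numE (x : n.-tuple RM) := E (fun f => (\1_B f * likelihood x f)%:E : \bar R).
Let denE (x : n.-tuple RM) := E (fun f => (likelihood x f)%:E : \bar R).

Let lik_supp (x : n.-tuple RM) f : supp f -> box (fun _ : 'I_n => I01) x ->
  0 <= likelihood x f.
Proof. by move=> sf; apply: likelihood_ge0 => t It; exact: supp_ge0. Qed.

Let num_le (x : n.-tuple RM) : box (fun _ : 'I_n => I01) x ->
  (E (fun f => (\1_B f * likelihood x f)%:E) <=
   (expR 1 * \sum_(g <- S) likelihood x g)%:E)%E.
Proof.
move=> xI; have likS g : g \in S -> 0 <= likelihood x g.
  by move=> gS; apply: likelihood_ge0 => // t; exact: S_ge0.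
have S0 : 0 <= \sum_(g <- S) likelihood x g.
  by rewrite big_seq sumr_ge0.
apply: E_le_supp; first by rewrite mulr_ge0// expR_ge0.
move=> f sf; rewrite !lee_fin; apply/andP; split.
  by rewrite mulr_ge0// lik_supp.
have [Bf|Bf] := pselect (B f); last first.
  by rewrite indicE memNset// mul0r mulr_ge0// expR_ge0.
rewrite indicE mem_set// mul1r.
have [g gS fg] := supp_le sf Bf.
apply: (@le_trans _ _ (expR 1 * likelihood x g)).
  apply: likelihood_le_expR1 => //; last exact: S_ge0.
  by move=> t It; rewrite supp_ge0//= fg.
rewrite ler_wpM2l ?expR_ge0// (big_rem g)//= lerDl big_seq sumr_ge0// => h hS.
by apply: likS; exact: mem_rem hS.
Qed.

Let den_ge (x : n.-tuple RM) : box (fun _ : 'I_n => I01) x ->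
  ((pm * ((expR 1)^-1 * likelihood x g0))%:E <=
   E (fun f => (likelihood x f)%:E))%E.
Proof.
move=> xI; apply: E_ge_nb.
- by move=> f sf; rewrite lee_fin lik_supp.
- rewrite mulr_ge0 ?invr_ge0 ?expR_ge0//.
  by apply: likelihood_ge0 => // t It; rewrite ltW// g0_gt0.
move=> f nf; rewrite lee_fin ler_pdivrMl ?expR_gt0//.
apply: likelihood_le_expR1 => //.
  by move=> t It; rewrite ltW ?g0_gt0//= nb_ge.
by move=> t It; apply: supp_ge0 => //; exact: nb_supp.
Qed.

Let numE_ge0 (x : n.-tuple RM) : box (fun _ : 'I_n => I01) x -> (0 <= numE x)%E.
Proof.
move=> xI; rewrite /numE; set Phi := fun f => _.
have /andP[]// : (0 <= E Phi <= E Phi)%E.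
by apply: E_le => f sf; rewrite lexx andbT lee_fin mulr_ge0// lik_supp.
Qed.

Lemma posterior_ge0_le1 (x : n.-tuple RM) : box (fun _ : 'I_n => I01) x ->
  (0 <= posterior E x B <= 1)%E.
Proof.
move=> xI; have /andP[num0 numden] : (0 <= numE x <= denE x)%E.
  apply: E_le => f sf; rewrite !lee_fin mulr_ge0 ?lik_supp//=.
  by rewrite ler_piMl ?lik_supp// indicE lern1 leq_b1.
have den0 := le_trans num0 numden.
rewrite /posterior -/(numE x) -/(denE x).
apply/andP; split; first by rewrite mule_ge0// inve_ge0.
(* An infinite denominator has inverse 0; a zero denominator forces a zero numerator, so the
   quotient is 0 there as well. *)
move: num0 numden den0; case: (denE x) => [d| |]//; last by rewrite invey mule0 lee01.
have [->|d0] := eqVneq d 0.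
  by move=> num0 numle _; rewrite (_ : numE x = 0%E) ?mul0e ?lee01//; apply/eqP; rewrite eq_le numle.
case: (numE x) => // r r0 rd dge0.
rewrite inver (negbTE d0) -EFinM lee_fin ler_pdivrMr ?mul1r -?lee_fin//.
by rewrite lt_neqAle eq_sym d0/= -lee_fin.
Qed.

Let K_pm (x : n.-tuple RM) := Num.sqrt K * cst_pm *
    \sum_(g <- S) \prod_(i < n) Num.sqrt (g (tnth x i) / f0 (tnth x i)) +
    K^-1 * \prod_(i < n) (f0 (tnth x i) / g0 (tnth x i)).

Lemma posterior_le_ratio (x : n.-tuple RM) : box (fun _ : 'I_n => I01) x ->
  (posterior E x B <= (K_pm x)%:E)%E.
Proof.
move=> xI.
have likS g : g \in S -> 0 <= likelihood x g.
  by move=> gS; apply: likelihood_ge0 => // t; exact: S_ge0.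
have S0 : 0 <= \sum_(g <- S) likelihood x g.
  by rewrite big_seq sumr_ge0.
have lf0 : 0 < likelihood x f0 by exact: likelihood_gt0.
have lg0 : 0 < likelihood x g0 by exact: likelihood_gt0.
have sqrtE g : g \in S -> \prod_(i < n) Num.sqrt (g (tnth x i) / f0 (tnth x i)) =
    Num.sqrt (likelihood x g / likelihood x f0).
  move=> gS; rewrite /likelihood -prodf_div sqrtr_prod// => i.
  have Ii : I01 (tnth x i) by exact: xI.
  by rewrite divr_ge0//; [exact: S_ge0|exact: density_ge0].
rewrite /K_pm prodf_div -/(likelihood x f0) -/(likelihood x g0).
rewrite (eq_big_seq (fun g => Num.sqrt (likelihood x g / likelihood x f0)))//.
set A := \sum_(g <- S) _.
have A0 : 0 <= A by apply: sumr_ge0 => g _; exact: sqrtr_ge0.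
have /andP[p0 p1] := posterior_ge0_le1 xI.
have c0 : 0 <= Num.sqrt K * cst_pm.
  by rewrite mulr_ge0 ?sqrtr_ge0// divr_ge0 ?expR_ge0 ?sqrtr_ge0.
(* If [Y > K], then [Y / K] alone exceeds the bound 1 on the posterior. If [Y <= K], then [p <= 1]
   gives [p <= sqrt p <= sqrt (K * X)]. *)
have [BK|BK] := leP (likelihood x f0 / likelihood x g0) K; last first.
  apply: (le_trans p1); rewrite lee_fin ler_wpDl ?mulr_ge0//.
  by rewrite ler_pdivlMl// mulr1 ltW.
have e1 := expR_gt0 (1 : R).
have den0 := den_ge xI; have num0 := num_le xI.
have pfin : posterior E x B \is a fin_num.
  by rewrite ge0_fin_numE// (le_lt_trans p1) ?ltry.
rewrite -(fineK pfin) lee_fin.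
set p := fine (posterior E x B).
have {}p0 : 0 <= p by rewrite -lee_fin fineK.
have {}p1 : p <= 1 by rewrite -lee_fin fineK.
suff : p <= Num.sqrt K * cst_pm * A.
  by move=> /le_trans; apply; rewrite lerDl mulr_ge0 ?invr_ge0 ?ltW// divr_gt0.
apply: (@le_trans _ _ (Num.sqrt p)).
  rewrite -[leLHS](@ger0_norm _ p)// -sqrtr_sqr ler_wsqrtr//.
  by rewrite expr2 ler_piMl.
have pE : p <= K * (expR 1 ^+ 2 / pm * \sum_(g <- S) (likelihood x g / likelihood x f0)).
  have dpos : 0 < pm * ((expR 1)^-1 * likelihood x g0).
    by rewrite !mulr_gt0// invr_gt0.
  have : p <= (expR 1 * \sum_(g <- S) likelihood x g) / (pm * ((expR 1)^-1 * likelihood x g0)).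
    rewrite -lee_fin fineK// /posterior -/(numE x).
    rewrite -/(numE x) in num0; move: den0; set D := E _; move=> den0.
    have num00 := numE_ge0 xI.
    move: den0; case: D => [d| |]//; last first.
      by move=> _; rewrite invey mule0 lee_fin; exact: divr_ge0 (mulr_ge0 (ltW e1) S0) (ltW dpos).
    rewrite lee_fin => dd; have d0 := lt_le_trans dpos dd.
    rewrite inver gt_eqF// EFinM lee_pmul// ?lee_fin ?invr_ge0 ?(ltW d0)//.
    by rewrite lef_pV2.
  move=> /le_trans; apply.
  rewrite -mulr_suml !invfM invrK.
  set s := \sum_(g <- S) likelihood x g.
  have -> : expR 1 * s * (pm^-1 * (expR 1 * (likelihood x g0)^-1)) =
    (expR 1 ^+ 2 / pm * s / likelihood x f0) * (likelihood x f0 / likelihood x g0).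
    by field; rewrite !gt_eqF.
  have -> : K * (expR 1 ^+ 2 / pm * (s / likelihood x f0)) =
    expR 1 ^+ 2 / pm * s / likelihood x f0 * K by ring.
  rewrite ler_wpM2l// divr_ge0 ?(ltW lf0)// mulr_ge0// divr_ge0 ?(ltW pm_gt0)//.
apply: (le_trans (ler_wsqrtr pE)).
rewrite sqrtrM ?(ltW K_gt0)// -[leRHS]mulrA ler_wpM2l ?sqrtr_ge0//.
rewrite sqrtrM; last by rewrite divr_ge0 ?(ltW pm_gt0) ?exprn_ge0 ?(ltW e1).
rewrite sqrtrM ?exprn_ge0 ?(ltW e1)// sqrtr_sqr ger0_norm ?(ltW e1)// sqrtrV ?(ltW pm_gt0)//.
rewrite -/cst_pm ler_wpM2l ?divr_ge0 ?sqrtr_ge0 ?(ltW e1)// /A.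
by apply: sqrtr_sum_le => g gS; exact: divr_ge0 (likS _ gS) (ltW lf0).
Qed.

Lemma integral_posterior_ge0 :
  (0 <= \int[prod_prob (fun _ : 'I_n => density_prob f0)]_x posterior E x B)%E.
Proof.
have mI : measurable (I01 : set RM) by exact: measurable_itv.
rewrite (@integral_restrict_ae _ _ _ _ (box (fun _ : 'I_n => (I01 : set RM))))//.
- by apply: integral_ge0 => x xI; have /andP[] := posterior_ge0_le1 xI.
- exact: measurable_box.
- apply: prod_prob_boxC => // i.
  by rewrite -[RHS](density_int1 f0) /= /density_prob /with_density setIid.
Qed.

Lemma integral_posterior_le :
  (\int[prod_prob (fun _ : 'I_n => density_prob f0)]_x posterior E x B <=
   (Num.sqrt K * cst_pm * ((size S)%:R * a ^+ n) + K^-1 * b ^+ n)%:E)%E.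
Proof.
have mI : measurable (I01 : set RM) by exact: measurable_itv.
have mf0 := @measurable_density _ f0.
pose A := box (fun _ : 'I_n => (I01 : set RM)).
have mA : measurable A by exact: measurable_box.
pose kS (g : R -> R) := (fun t => Num.sqrt (g t / f0 t)) \_ I01.
pose k0 := (fun t => f0 t / g0 t) \_ I01.
have mV (h : R -> R) : (forall t, I01 t -> 0 < h t) -> measurable_fun I01 h ->
    measurable_fun I01 (fun t => (h t)^-1).
  move=> h0 mh.
  (* On positive values the inverse is the power [-1], which is measurable. *)
  apply: (eq_measurable_fun (fun t => h t `^ (-1))).
    by move=> t; rewrite inE => It; rewrite powR_inv1// ltW// h0.
  by apply: (measurableT_comp (measurable_powR _)).
have mkS' g : g \in S -> measurable_fun I01 (fun t => Num.sqrt (g t / f0 t)).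
  move=> gS; apply: (measurableT_comp measurable_sqrt).
  by apply: measurable_funM; [exact: mS|exact: mV].
have mk0' : measurable_fun I01 (fun t => f0 t / g0 t).
  by apply: measurable_funM => //; exact: mV.
have mkS g : g \in S -> measurable_fun setT (kS g).
  by move=> gS; apply/(measurable_restrictT _ _).1 => //; exact: mkS'.
have mk0 : measurable_fun setT k0 by apply/(measurable_restrictT _ _).1.
have kS0 g t : 0 <= kS g t.
  by rewrite /kS patchE; case: ifPn => // _; exact: sqrtr_ge0.
have k00 t : 0 <= k0 t.
  rewrite /k0 patchE; case: ifPn => //; rewrite inE => It.
  by rewrite divr_ge0// ltW// ?f0_gt0// g0_gt0.
have c0 : 0 <= Num.sqrt K * cst_pm.
  by rewrite mulr_ge0 ?sqrtr_ge0// divr_ge0 ?expR_ge0 ?sqrtr_ge0.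
pose P := prod_prob (fun _ : 'I_n => density_prob f0).
rewrite (@integral_restrict_ae _ _ _ P A)//; last first.
  apply: prod_prob_boxC => // i.
  by rewrite -[RHS](density_int1 f0) /= /density_prob /with_density setIid.
rewrite integral_mkcond.
pose Sum (s : seq (R -> R)) (x : n.-tuple RM) : \bar R :=
  (\sum_(g <- s) (\prod_(i < n) kS g (tnth x i))%:E)%E.
(* [G] is a measurable majorant of the posterior, so the expectation can be computed term by term on
   [G]. *)
pose G (x : n.-tuple RM) := ((Num.sqrt K * cst_pm)%:E * Sum S x +
   (K^-1)%:E * (\prod_(i < n) k0 (tnth x i))%:E)%E.
have mGS g : g \in S -> measurable_fun setT (fun x : n.-tuple RM => (\prod_(i < n) kS g (tnth x i))%:E).
  by move=> gS; apply/measurable_EFinP; apply: (@measurable_prod_tnth _ _ (fun=> kS g)) => _; exact: mkS.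
have mG0 : measurable_fun setT (fun x : n.-tuple RM => (\prod_(i < n) k0 (tnth x i))%:E).
  by apply/measurable_EFinP; apply: (@measurable_prod_tnth _ _ (fun=> k0)).
apply: (@le_trans _ _ (\int[P]_x G x)%E).
  apply: ge0_le_integral_nomeas => x.
    by apply: erestrict_ge0 => y yA; have /andP[] := posterior_ge0_le1 yA.
  rewrite patchE; case: ifPn => [|_]; last first.
    rewrite /G adde_ge0//.
      rewrite mule_ge0 ?lee_fin// sume_ge0// => g _.
      by rewrite lee_fin prodr_ge0.
    by rewrite mule_ge0// lee_fin ?prodr_ge0// invr_ge0 ltW.
  rewrite inE => xA; apply: (le_trans (posterior_le_ratio xA)).
  rewrite /K_pm /G /Sum EFinD !EFinM sumEFin -!EFinM -!EFinD lee_fin.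
  rewrite le_eqVlt; apply/orP; left; apply/eqP; congr (_ + _); congr (_ * _).
    apply: eq_bigr => g _; apply: eq_bigr => i _.
    by rewrite /kS patchE mem_set//; exact: xA.
  by apply: eq_bigr => i _; rewrite /k0 patchE mem_set//; exact: xA.
have Sum0 s x : (0 <= Sum s x)%E.
  by apply: sume_ge0 => g _; rewrite lee_fin prodr_ge0.
have mSum s : {subset s <= S} -> measurable_fun setT (Sum s) /\
    (\int[P]_x Sum s x <= ((size s)%:R * a ^+ n)%:E)%E.
  elim: s => [_|g s IH gsS].
    have SE x : Sum [::] x = cst 0%E x by rewrite /Sum big_nil.
    by rewrite mul0r (funext SE); split; [exact: measurable_cst|rewrite integral0].
  have gS : g \in S by apply: gsS; rewrite inE eqxx.
  have [h hs|ms ls] := IH; first by apply: gsS; rewrite inE hs orbT.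
  have SE x : Sum (g :: s) x = ((\prod_(i < n) kS g (tnth x i))%:E + Sum s x)%E.
    by rewrite /Sum big_cons.
  split.
    by rewrite (funext SE); apply: emeasurable_funD => //; exact: mGS.
  rewrite (eq_integral _ _ (fun x _ => SE x)).
  rewrite ge0_integralD//; last 2 first.
  - by move=> x _; rewrite lee_fin prodr_ge0.
  - exact: mGS.
  rewrite /= -natr1 mulrDl mul1r addrC EFinD leeD//.
  (* Under [f0] the variable [sqrt (g / f0)] has expectation [int sqrt (f0 * g)], the affinity. *)
  apply: expectation_prod_density => //; first exact: mkS'.
  apply: le_trans (S_far gS); rewrite le_eqVlt; apply/orP; left; apply/eqP.
  apply: eq_integral => t; rewrite inE => It; congr (_%:E).
  have f0t := f0_gt0 It; have g0t := S_ge0 gS It.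
  rewrite sqrtrM// sqrtrV ?ltW// sqrtrM ?ltW// mulrC.
  rewrite -[X in X * _ = _](sqr_sqrtr (ltW f0t)) expr2.
  have : Num.sqrt (f0 t) != 0 by rewrite sqrtr_eq0 -ltNge.
  by move=> ?; field.
have [mSS leS] := mSum S (fun _ h => h).
rewrite /G ge0_integralD//; last 4 first.
- by move=> x _; rewrite mule_ge0 ?lee_fin// Sum0.
- by apply: measurable_funeM.
- by move=> x _; rewrite mule_ge0// lee_fin ?prodr_ge0// invr_ge0 ltW.
- by apply: measurable_funeM.
rewrite (@ge0_integralZl _ _ _ P setT measurableT (Sum S))//.
rewrite ge0_integralZl//; last 2 first.
- by move=> x _; rewrite lee_fin prodr_ge0.
- by rewrite lee_fin invr_ge0 ltW.
rewrite EFinD leeD//; first by rewrite [leRHS]EFinM lee_wpmul2l.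
rewrite [leRHS]EFinM lee_wpmul2l ?lee_fin ?invr_ge0 ?(ltW K_gt0)//.
apply: expectation_prod_density => //.
  by move=> t It; rewrite divr_ge0// ltW ?f0_gt0 ?g0_gt0.
apply: le_trans g0_close; rewrite le_eqVlt; apply/orP; left; apply/eqP.
by apply: eq_integral => t _; congr (_%:E); rewrite expr2 mulrAC.
Qed.

End nonasymptotic.

End posterior_bound.

(** * Discrete splines *)

Section discrete_spline.
Context (R : realType) (q : nat).
Hypothesis q_gt0 : (0 < q)%N.
Implicit Types (F G c : int -> R) (i j : int) (m d : nat).

(** The form taken by [aggregate1] on functions constant on cells of length [s / q], where a shift
    by [i * s / q] moves by exactly [i] cells. It averages to the left, hence the backward
    difference [nabla]. *)
Definition avg F : int -> R := fun j => q%:R^-1 * \sum_(i < q) F (j - i%:Z).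
Definition stretch c : int -> R := fun j => c (j %/ q%:Z)%Z.
Definition sample F : int -> R := fun i => F (i * q%:Z).
Definition nabla F : int -> R := fun j => F j - F (j - 1).
(** Discrete analogue of a B-spline series: [stretch] gives a step function and each average raises
    the degree by one. *)
Definition spline m c : int -> R := iter m avg (stretch c).

Let q0 : q%:R != 0 :> R. Proof. by rewrite pnatr_eq0 -lt0n. Qed.
Let qz0 : q%:Z != 0. Proof. by rewrite eqz_nat -lt0n. Qed.

Lemma avg_cst (a : R) : avg (fun=> a) = (fun=> a).
Proof.
apply/funext => j; rewrite /avg sumr_const card_ord -[a *+ q]mulr_natl mulrA.
by rewrite mulVf// mul1r.
Qed.

Lemma avgD F G : avg (fun j => F j + G j) = (fun j => avg F j + avg G j).
Proof. by apply/funext => j; rewrite /avg big_split/= mulrDr. Qed.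

Lemma avgZ (a : R) F : avg (fun j => a * F j) = (fun j => a * avg F j).
Proof. by apply/funext => j; rewrite /avg -mulr_sumr mulrCA. Qed.

Lemma nablaZ (a : R) F : nabla (fun j => a * F j) = (fun j => a * nabla F j).
Proof. by apply/funext => j; rewrite /nabla -mulrBr. Qed.

Let telescope_nabla F j n :
  \sum_(i < n) nabla F (j - i%:Z) = F j - F (j - n%:Z).
Proof.
elim: n => [|n IH]; first by rewrite big_ord0 subr0 subrr.
rewrite big_ord_recr/= IH /nabla addrA subrK.
by congr (_ - F _); rewrite -addn1 PoszD opprD addrA.
Qed.

Lemma avg_nabla F : avg (nabla F) = (fun j => q%:R^-1 * (F j - F (j - q%:Z))).
Proof. by apply/funext => j; rewrite /avg telescope_nabla. Qed.

Lemma nabla_avg F : nabla (avg F) = avg (nabla F).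
Proof.
apply/funext => j; rewrite /nabla /avg -mulrBr -sumrB; congr (_ * _).
by apply: eq_bigr => i _; congr (_ - F _); rewrite addrAC.
Qed.

(** Discrete form of the rule that differentiating a B-spline series lowers its degree and
    differences its coefficients: the average telescopes to two values [q] cells apart, that is, to
    consecutive coefficients. *)
Lemma nabla_avg_stretch c :
  nabla (avg (stretch c)) = (fun j => q%:R^-1 * stretch (nabla c) j).
Proof.
rewrite nabla_avg avg_nabla; apply/funext => j; congr (_ * (_ - _)).
rewrite /stretch; congr c; rewrite -[X in j - X]mul1r -mulNr.
by rewrite divzDr ?dvdz_mull// mulzK.
Qed.

Lemma nabla_sample F :
  nabla (sample F) = sample (fun j => q%:R * avg (nabla F) j).
Proof.
rewrite avg_nabla; apply/funext => i; rewrite /sample /nabla mulVKf//.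
by congr (_ - F _); rewrite mulrBl mul1r.
Qed.

Lemma iter_nabla_avg d m F : iter d nabla (iter m avg F) = iter m avg (iter d nabla F).
Proof.
have cm G : forall n, nabla (iter n avg G) = iter n avg (nabla G).
  by elim=> //= n IH; rewrite nabla_avg IH.
by elim: d => //= d ->; rewrite cm.
Qed.

Lemma iter_avgZ m (a : R) F :
  iter m avg (fun j => a * F j) = (fun j => a * iter m avg F j).
Proof. by elim: m => //= m ->; rewrite avgZ. Qed.

Lemma iter_avgD m F G :
  iter m avg (fun j => F j + G j) = (fun j => iter m avg F j + iter m avg G j).
Proof. by elim: m => //= m ->; rewrite avgD. Qed.

Lemma iter_avg_cst m (a : R) : iter m avg (fun=> a) = (fun=> a).
Proof. by elim: m => //= m ->; rewrite avg_cst. Qed.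

Lemma iter_nablaZ m (a : R) F :
  iter m nabla (fun j => a * F j) = (fun j => a * iter m nabla F j).
Proof. by elim: m => //= m ->; rewrite nablaZ. Qed.

Lemma iter_nabla_spline d m c : (d <= m)%N ->
  iter d nabla (spline m c) =
  (fun j => q%:R^-1 ^+ d * spline (m - d) (iter d nabla c) j).
Proof.
elim: d m c => [|d IH] m c dm.
  by apply/funext => j; rewrite expr0 mul1r subn0.
rewrite iterSr; case: m dm => // m dm.
rewrite /spline iterSr -[nabla _]/(iter 1 nabla _) iter_nabla_avg/=.
rewrite nabla_avg_stretch iter_avgZ iter_nablaZ -/(spline m _) IH//.
by apply/funext => j; rewrite exprS mulrA subSS -iterSr.
Qed.

(** A coarse difference is the sum of [q] fine ones, so [q] times their average. The resulting [q^d]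
    cancels the [q^-d] of [iter_nabla_spline]. *)
Lemma iter_nabla_sample d F :
  iter d nabla (sample F) = sample (fun j => q%:R ^+ d * iter d avg (iter d nabla F) j).
Proof.
elim: d => [|d IH]/=.
  by apply/funext => i; rewrite /sample expr0 mul1r.
rewrite IH nabla_sample nablaZ avgZ; congr sample; apply/funext => j.
by rewrite mulrA -exprS -[nabla (iter d avg _)]/(iter 1 nabla _) iter_nabla_avg.
Qed.

Lemma nabla_eq0_cst F : (forall j, nabla F j = 0) -> forall j, F j = F 0.
Proof.
move=> F0; have FE j : F j = F (j - 1) by apply/eqP; rewrite -subr_eq0; apply/eqP/F0.
elim/int_rect => // n IH.
  by rewrite FE -addn1 PoszD addrK.
by rewrite -IH [RHS]FE -addn1 PoszD opprD.
Qed.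

Definition residual m F : int -> R := fun j => F j - spline m (sample F) j.

(** The [d]-th difference of [F] is constant, and that of [spline m (sample F)] is the same constant
    because the powers of [q] cancel. Leading terms thus agree, and [residual m] lowers the degree
    of a polynomial. *)
Lemma nabla_residual d m F : (d <= m)%N ->
  (forall j, iter d.+1 nabla F j = 0) ->
  forall j, iter d nabla (residual m F) j = 0.
Proof.
move=> dm F0 j; have Fc := nabla_eq0_cst F0.
have -> : residual m F = (fun j => F j + -1 * spline m (sample F) j).
  by apply/funext => i; rewrite mulN1r.
have nablaD G H : iter d nabla (fun j => G j + H j) =
    (fun j => iter d nabla G j + iter d nabla H j).
  elim: d {dm F0 Fc} => //= d ->.
  by apply/funext => i; rewrite /nabla opprD addrACA.
rewrite nablaD iter_nablaZ iter_nabla_spline// iter_nabla_sample.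
have -> : iter d nabla F = (fun=> iter d nabla F 0) by apply/funext => i; exact: Fc.
rewrite iter_avg_cst /sample /spline /stretch iter_avg_cst.
by rewrite mulN1r mulrA -exprMn mulVf// expr1n mul1r subrr.
Qed.

Lemma iter_residual0 m F : (forall j, iter m.+1 nabla F j = 0) ->
  forall j, iter m.+1 (residual m) F j = 0.
Proof.
move=> F0; suff H k : (k <= m.+1)%N ->
    forall j, iter (m.+1 - k) nabla (iter k (residual m) F) j = 0.
  by move=> j; have := H m.+1 (leqnn _) j; rewrite subnn.
elim: k => [_|k IH km]; first by rewrite subn0.
rewrite [iter k.+1 _ _]iterS; apply: nabla_residual; first by rewrite subSS leq_subr.
by rewrite subSS -subSn//; exact: IH (ltnW km).
Qed.

(* Since 1 - (1 - Q)^(m+1) = Q * sum_(k <= m) (1 - Q)^k for the operator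
   Q = spline m \o sample, this right inverse of Q on functions killed by
   nabla^(m+1) yields a quasi-interpolant. *)
Definition quasi_coef m F : int -> R :=
  fun i => \sum_(k < m.+1) sample (iter k (residual m) F) i.

Lemma splineD m c c' : spline m (fun i => c i + c' i) =
  (fun j => spline m c j + spline m c' j).
Proof. by rewrite /spline -iter_avgD. Qed.

(** The [k]-th summand contributes [iter k (residual m) F - iter k.+1 (residual m) F], so the sum
    telescopes for arbitrary [F]. *)
Lemma spline_quasi_coef m F j :
  spline m (quasi_coef m F) j = F j - iter m.+1 (residual m) F j.
Proof.
rewrite /quasi_coef; elim: m.+1 => [|n IH].
  rewrite [iter 0 _ _]/= subrr.
  rewrite (_ : (fun i => _) = fun=> 0); last by apply/funext => i; rewrite big_ord0.
  by rewrite /spline /stretch iter_avg_cst.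
rewrite (_ : (fun i => _) = fun i => \sum_(k < n) sample (iter k (residual m) F) i
   + sample (iter n (residual m) F) i); last by apply/funext => i; rewrite big_ord_recr.
rewrite splineD IH.
have -> : iter n.+1 (residual m) F j = iter n (residual m) F j -
  spline m (sample (iter n (residual m) F)) j by [].
by rewrite opprB addrA [RHS]addrAC.
Qed.

Lemma quasi_coefD m F G : quasi_coef m (fun j => F j + G j) =
  (fun i => quasi_coef m F i + quasi_coef m G i).
Proof.
apply/funext => i; rewrite /quasi_coef -big_split/=; apply: eq_bigr => k _.
suff -> : iter k (residual m) (fun j => F j + G j) =
  (fun j => iter k (residual m) F j + iter k (residual m) G j) by [].
elim: (nat_of_ord k) => //= {}k ->; apply/funext => j; rewrite /residual.
rewrite (_ : sample _ = fun i => sample (iter k (residual m) F) i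
  + sample (iter k (residual m) G) i)//.
by rewrite splineD opprD addrACA.
Qed.

Lemma le_avg F G j (p : nat) :
  (forall i, j - p%:Z - q%:Z < i <= j -> F i <= G i) ->
  forall i, j - p%:Z <= i <= j -> avg F i <= avg G i.
Proof.
move=> FG i /andP[ji ij]; rewrite /avg ler_pM2l ?invr_gt0 ?ltr0n//.
by apply: ler_sum => k _; apply: FG; have := ltn_ord k; lia.
Qed.

(** The slack [p] carries the induction: the outer average looks back [q - 1] cells, so the inner
    ones are compared on a window widened by [q.-1]. *)
Lemma le_iter_avg m F G j (p : nat) :
  (forall i, j - p%:Z - (m * q)%N%:Z < i <= j -> F i <= G i) -> (0 < m)%N ->
  forall i, j - p%:Z <= i <= j -> iter m avg F i <= iter m avg G i.
Proof.
elim: m p => // m IH p FG _ i ij; rewrite !iterS; apply: le_avg ij => k kj.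
have [m0|m0] := posnP m; first by rewrite m0/= FG// m0 mul1n.
have kj' : j - (p + q.-1)%N%:Z <= k <= j.
  by move: kj; have := q_gt0; lia.
apply: IH kj' => // l lj; apply: FG; move: lj; rewrite mulSn; have := q_gt0; lia.
Qed.

(** Positivity and locality: [m] averages look back at most [m * (q - 1)] fine cells, hence at most
    [m] coarse ones. Comparison with constant coefficients, which splines reproduce, then yields
    norm bounds. *)
Lemma le_spline m c c' j :
  (forall i, (j %/ q%:Z)%Z - m%:Z <= i <= (j %/ q%:Z)%Z -> c i <= c' i) ->
  spline m c j <= spline m c' j.
Proof.
move=> cc; rewrite /spline; have [m0|m0] := posnP m.
  by rewrite m0; apply: cc; rewrite lexx andbT gerBl.
apply: (@le_iter_avg m _ _ j 0) => //; last by lia.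
move=> i /andP[ji ij]; rewrite /stretch; apply: cc.
have := divz_eq j q; have := modz_ge0 j qz0; have := ltz_pmod j (_ : 0 < q%:Z).
have := divz_eq i q; have := modz_ge0 i qz0; have := ltz_pmod i (_ : 0 < q%:Z).
have qz : 0 < q%:Z by rewrite ltz_nat.
move=> /(_ qz); set a := (i %/ _)%Z; set b := (i %% _)%Z; set a' := (j %/ _)%Z; set b' := (j %% _)%Z.
move=> b1 b2 e1 /(_ qz) b3 b4 e2.
(* An inequality between the integer quotients is read off the sign of its product with [q]. *)
have h1 : (a - a' - 1) * q%:Z < 0 by rewrite !mulrBl mul1r; lia.
have h2 : (a' - a - m%:Z - 1) * q%:Z < 0 by rewrite !mulrBl mul1r -PoszM; lia.
by move: h1 h2; rewrite !pmulr_llt0//; lia.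
Qed.

Lemma spline_cst m (a : R) : spline m (fun=> a) = (fun=> a).
Proof. exact: iter_avg_cst. Qed.

Lemma splineZ m (a : R) c : spline m (fun i => a * c i) = (fun j => a * spline m c j).
Proof. by rewrite /spline -iter_avgZ. Qed.

Lemma spline_norm_le m c j (e : R) :
  (forall i, (j %/ q%:Z)%Z - m%:Z <= i <= (j %/ q%:Z)%Z -> `|c i| <= e) ->
  `|spline m c j| <= e.
Proof.
move=> ce; rewrite ler_norml; apply/andP; split.
  rewrite -[leLHS](_ : spline m (fun=> - e) j = _); last by rewrite spline_cst.
  by apply: le_spline => i /ce; rewrite ler_norml => /andP[].
rewrite -[leRHS](_ : spline m (fun=> e) j = _); last by rewrite spline_cst.
by apply: le_spline => i /ce; rewrite ler_norml => /andP[].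
Qed.

(** Subtracting a spline at most doubles the sup norm and consumes [m] further coarse points on the
    left. *)
Lemma residual_norm_le m F i0 i1 (e : R) :
  (forall i, i0 <= i <= i1 -> `|sample F i| <= e) ->
  forall k i, i0 + (k * m)%N%:Z <= i <= i1 ->
    `|sample (iter k (residual m) F) i| <= 2 ^+ k * e.
Proof.
move=> Fe; elim=> [|k IH] i ii; first by rewrite expr0 mul1r Fe//; lia.
rewrite iterS [sample _]/sample /residual exprS -mulrA mulr_natl mulr2n.
rewrite (le_trans (ler_normB _ _))// lerD//.
  by apply: IH; lia.
apply: spline_norm_le => l; rewrite mulzK// => li; apply: IH; lia.
Qed.

Lemma sum_pow2_le n : \sum_(k < n) 2 ^+ k <= 2 ^+ n :> R.
Proof.
elim: n => [|n IH]; first by rewrite big_ord0.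
by rewrite big_ord_recr/= [leRHS]exprS mulr_natl mulr2n lerD.
Qed.

Lemma quasi_coef_norm_le m F i0 i1 (e : R) :
  (forall i, i0 <= i <= i1 -> `|sample F i| <= e) ->
  forall i, i0 + (m * m)%N%:Z <= i <= i1 -> `|quasi_coef m F i| <= 2 ^+ m.+1 * e.
Proof.
move=> Fe i ii; rewrite /quasi_coef (le_trans (ler_norm_sum _ _ _))//.
have e0 : 0 <= e by apply: le_trans (Fe i1 _) => //; lia.
apply: (@le_trans _ _ (\sum_(k < m.+1) 2 ^+ k * e)).
  apply: ler_sum => k _; apply: (residual_norm_le Fe); have := ltn_ord k.
  have km : (k * m <= m * m)%N by rewrite leq_mul2r -ltnS ltn_ord orbT.
  by lia.
by rewrite -mulr_suml ler_wpM2r// sum_pow2_le.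
Qed.

(** The term [k = 0] is the sample itself, and every other term contains a residual, which measures
    local oscillation. This will make the coefficients of the target positive. *)
Lemma quasi_coef_sub_sample m F i0 i1 (e : R) : 0 <= e ->
  (forall i, i0 <= i <= i1 -> `|sample (residual m F) i| <= e) ->
  forall i, i0 + (m * m)%N%:Z <= i <= i1 ->
  `|quasi_coef m F i - sample F i| <= 2 ^+ m * e.
Proof.
move=> e0 Fe i ii; rewrite /quasi_coef big_ord_recl/= addrC addKr.
rewrite (le_trans (ler_norm_sum _ _ _))//.
apply: (@le_trans _ _ (\sum_(k < m) 2 ^+ k * e)).
  apply: ler_sum => k _; rewrite -iterS iterSr.
  apply: (residual_norm_le Fe); have := ltn_ord k.
  have km : (k * m <= m * m)%N by rewrite leq_mul2r ltnW ?ltn_ord ?orbT.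
  by lia.
by rewrite -mulr_suml ler_wpM2r// sum_pow2_le.
Qed.

(** [P] is reproduced exactly, since [m + 1] residuals annihilate it, and the quasi-interpolant is
    linear, local and bounded, so only [F - P] on the window matters. *)
Lemma spline_quasi_coef_near m (F P : int -> R) j (e : R) :
  (forall i, iter m.+1 nabla P i = 0) ->
  (forall i, (j %/ q%:Z)%Z - (m + m * m)%N%:Z <= i <= (j %/ q%:Z)%Z ->
     `|F (i * q%:Z) - P (i * q%:Z)| <= e) ->
  `|spline m (quasi_coef m F) j - P j| <= 2 ^+ m.+1 * e.
Proof.
move=> P0 FP.
have -> : F = (fun j => P j + (F j - P j)) by apply/funext => i; rewrite addrC subrK.
rewrite quasi_coefD splineD spline_quasi_coef iter_residual0// subr0 addrC addKr.
apply: spline_norm_le => i ii.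
apply: (quasi_coef_norm_le (i0 := (j %/ q%:Z)%Z - (m + m * m)%N%:Z) (i1 := (j %/ q%:Z)%Z)).
  by move=> k kk; exact: FP.
by move: ii; rewrite -/q; lia.
Qed.

(** In the binomial expansion of [nabla^d] the term at [i - d] is singled out; the other binomial
    coefficients add up to [2^d - 1]. *)
Lemma iter_nabla_head d c i (e : R) :
  (forall k, i - d%:Z < k <= i -> `|c k| <= e) ->
  `|iter d nabla c i - (-1) ^+ d * c (i - d%:Z)| <= (2 ^+ d - 1) * e.
Proof.
elim: d i => [|d IH] i ce; first by rewrite subr0 expr0 mul1r subrr normr0 subrr mul0r.
rewrite iterS {1}/nabla.
have h1 := IH i; have h2 := IH (i - 1).
have {}h1 : `|iter d nabla c i| <= 2 ^+ d * e.
  have [|d0] := posnP d; first by move=> ->/=; rewrite expr0 mul1r; apply: ce; lia.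
  rewrite -[X in `|X|](subrK ((-1) ^+ d * c (i - d%:Z))) (le_trans (ler_normD _ _))//.
  rewrite -[leRHS](subrK e) -{2}[e]mul1r -mulrBl lerD//.
    by apply: h1 => k kk; apply: ce; lia.
  by rewrite normrM normrX normrN1 expr1n mul1r; apply: ce; lia.
have {}h2 : `|iter d nabla c (i - 1) - (-1) ^+ d * c (i - 1 - d%:Z)| <= (2 ^+ d - 1) * e.
  by apply: h2 => k kk; apply: ce; lia.
have -> : i - d.+1%:Z = i - 1 - d%:Z by lia.
have -> : iter d nabla c i - iter d nabla c (i - 1) - (-1) ^+ d.+1 * c (i - 1 - d%:Z)
  = iter d nabla c i - (iter d nabla c (i - 1) - (-1) ^+ d * c (i - 1 - d%:Z)).
  by rewrite exprS mulN1r mulNr; ring.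
rewrite (le_trans (ler_normB _ _))// (le_trans (lerD h1 h2))//.
suff -> : 2 ^+ d * e + (2 ^+ d - 1) * e = (2 ^+ d.+1 - 1) * e by [].
by rewrite exprS; ring.
Qed.

(** The vanishing difference is a recurrence that can be solved for its leftmost value, at the price
    of a factor [2^(d+1)] per step to the left. *)
Lemma extrapolate d c (e : R) (n : nat) :
  (forall i, iter d.+1 nabla c i = 0) ->
  (forall k : nat, (k <= d)%N -> `|c k%:Z| <= e) ->
  forall i, - n%:Z <= i <= d%:Z -> `|c i| <= (2 ^+ d.+1) ^+ n * e.
Proof.
move=> c0 ce; have e0 : 0 <= e by exact: le_trans (ce 0%N _).
elim: n => [|n IH] i ii.
  by rewrite expr0 mul1r -(@gez0_abs i) ?ce//; lia.
have [ni|ni] := leP (- n%:Z) i.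
  rewrite (le_trans (IH i _))//; first lia.
  by rewrite ler_wpM2r// [leRHS]exprS ler_peMl ?exprn_ge0 ?exprn_ege1 ?ler1n.
have h := @iter_nabla_head d.+1 c (i + d.+1%:Z) ((2 ^+ d.+1) ^+ n * e).
move: h; rewrite c0 sub0r normrN addrK normrM normrX normrN1 expr1n mul1r => h.
apply: (le_trans (h _)); first by move=> k kk; apply: IH; lia.
rewrite [in leRHS](exprS _ n) -mulrA ler_wpM2r ?mulr_ge0 ?exprn_ge0//.
by rewrite gerBl.
Qed.

Lemma iter_nabla_sample0 m F : (forall j, iter m nabla F j = 0) ->
  forall i, iter m nabla (sample F) i = 0.
Proof.
move=> F0 i; rewrite iter_nabla_sample.
have -> : iter m nabla F = (fun=> 0) by exact/funext.
by rewrite iter_avg_cst /sample mulr0.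
Qed.

(** Each average is bounded below by one of its [q] terms: the shift [q - 1] is selected [r] times,
    the shift 0 otherwise. Varying [r] reaches coefficients further to the left. *)
Lemma spline_ge_coef m c j (r : nat) : (forall i, 0 <= c i) -> (r <= m)%N ->
  q%:R^-1 ^+ m * c ((j - (r * q.-1)%N%:Z) %/ q%:Z)%Z <= spline m c j.
Proof.
move=> c0; elim: m j r => [|m IH] j r.
  by rewrite leqn0 => /eqP ->; rewrite mul0n subr0 expr0 mul1r.
move=> rm; rewrite /spline iterS -/(spline m c) exprS -mulrA /avg ler_pM2l ?invr_gt0 ?ltr0n//.
have s0 k : 0 <= spline m c k.
  rewrite -[leLHS](_ : spline m (fun=> 0) k = _); last by rewrite spline_cst.
  exact: le_spline.
case: r rm => [_|r rm].
  rewrite (bigD1 (Ordinal q_gt0))//= ler_wpDr ?sumr_ge0//.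
  by have := IH j 0%N (leq0n _); rewrite mul0n !subr0.
have qq : (q.-1 < q)%N by rewrite prednK.
rewrite (bigD1 (Ordinal qq))//= ler_wpDr ?sumr_ge0//.
rewrite mulSn PoszD opprD addrA; exact: IH.
Qed.

End discrete_spline.

(** * Local polynomials of Hoelder functions *)

Section derivatives_on_I01.
Context (R : realType).
Implicit Types (f : R -> R) (p : {poly R}).

Lemma derivable_inP f x : derivable_in I01 f x ->
  forall e, 0 < e -> exists2 d, 0 < d & forall y, I01 y -> y != x ->
    `|y - x| < d -> `|derive_in I01 f x - diff_quot f x y| < e.
Proof.
move=> fx e e0; have /cvgrPdist_lt/(_ e e0) := fx.
rewrite near_withinE => /nbhs_ballP[d /= d0 H]; exists d => // y Iy yx xyd.
by apply: H => //; rewrite /ball/= distrC.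
Qed.

Lemma I01_nbhs (x : R) : 0 < x < 1 -> exists2 d, 0 < d & forall y, `|y - x| < d -> I01 y.
Proof.
move=> /andP[x0 x1]; exists (Num.min x (1 - x)).
  by rewrite lt_min x0 subr_gt0.
by move=> y; rewrite lt_min !ltr_norml /I01/= in_itv/= => /andP[/andP[? ?] /andP[? ?]]; lra.
Qed.

Lemma derive_in_interior f x : derivable_in I01 f x -> 0 < x < 1 ->
  is_derive x 1 f (derive_in I01 f x).
Proof.
move=> fx x01.
have H : (fun h => h^-1 *: ((f \o shift x) (h *: 1) - f x)) @ 0^' --> derive_in I01 f x.
  apply/cvgrPdist_lt => e e0.
  have [d d0 Hd] := derivable_inP fx e0; have [d' d'0 Hd'] := I01_nbhs x01.
  rewrite near_withinE; apply/nbhs_ballP; exists (Num.min d d') => /=.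
    by rewrite lt_min d0.
  move=> h; rewrite /ball/= sub0r normrN lt_min => /andP[hd hd'] h0.
  have e1 : x + h - x = h by ring.
  have := Hd (x + h); rewrite /diff_quot e1 /GRing.scale/= mulr1 [h + x]addrC (mulrC _^-1).
  apply => //; last by rewrite -subr_eq0 e1.
  by apply: Hd'; rewrite e1.
by split; [apply/cvg_ex; eexists; exact: H|apply/cvg_lim].
Qed.

Lemma derivable_in_continuous f x : derivable_in I01 f x ->
  forall e, 0 < e -> exists2 d, 0 < d & forall y, I01 y -> `|y - x| < d ->
    `|f x - f y| < e.
Proof.
move=> fx e e0; have [d d0 Hd] := derivable_inP fx ltr01.
set l := `|derive_in I01 f x|.
have l1 : 0 < l + 1 by rewrite ltr_wpDl ?normr_ge0.
exists (Num.min d (e / (l + 1))).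
  by rewrite lt_min d0 divr_gt0.
move=> y Iy; rewrite lt_min => /andP[yd ye].
have [->|yx] := eqVneq y x; first by rewrite subrr normr0.
have yx0 : y - x != 0 by rewrite subr_eq0.
have -> : f x - f y = - (diff_quot f x y * (y - x)) by rewrite /diff_quot divfK// opprB.
rewrite normrN normrM; have := Hd y Iy yx yd; move=> dl.
have dq : `|diff_quot f x y| < l + 1.
  rewrite -[diff_quot f x y](subKr (derive_in I01 f x)).
  by rewrite (le_lt_trans (ler_normB _ _))// ltrD2l.
apply: (@le_lt_trans _ _ ((l + 1) * `|y - x|)); first by rewrite ler_wpM2r// ltW.
by rewrite mulrC -ltr_pdivlMr.
Qed.

(** Derivatives relative to [I01] are ordinary ones in the interior; at the endpoint 0 only relative
    continuity is available, which suffices. *)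
Lemma MVT_I01 f (df : R -> R) (a b : R) : a < b -> I01 a -> I01 b ->
  (forall x : R, 0 < x < 1 -> is_derive x 1 f (df x)) ->
  (forall x : R, I01 x -> forall e, 0 < e -> exists2 d, 0 < d & forall y, I01 y ->
    `|y - x| < d -> `|f x - f y| < e) ->
  exists2 c, a < c < b & f b - f a = df c * (b - a).
Proof.
move=> ab Ia Ib fdf fcont.
have := Ia; have := Ib; rewrite /I01/= !in_itv/= => /andP[b0 b1] /andP[a0 a1].
have [| |c cab fE] := @MVT R f df a b ab.
- by move=> x; rewrite in_itv/= => /andP[ax xb]; apply: fdf; lra.
- apply/continuous_within_itvP => //; split.
  + move=> x; rewrite in_itv/= => /andP[ax xb].
    have x01 : 0 < x < 1 by lra.
    have dfx := fdf x x01.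
    by apply/differentiable_continuous/derivable1_diffP.
  + apply/cvgrPdist_lt => e e0.
    have [d d0 Hd] := fcont a Ia e e0.
    rewrite near_withinE; apply/nbhs_ballP; exists (Num.min d (b - a)) => /=.
      by rewrite lt_min d0 subr_gt0.
    move=> y; rewrite /ball/= lt_min distrC => /andP[yd]; rewrite ltr_norml => /andP[? ?] ?.
    by apply: Hd => //; rewrite /I01/= in_itv/=; lra.
  + apply/cvgrPdist_lt => e e0.
    have [d d0 Hd] := fcont b Ib e e0.
    rewrite near_withinE; apply/nbhs_ballP; exists (Num.min d (b - a)) => /=.
      by rewrite lt_min d0 subr_gt0.
    move=> y; rewrite /ball/= lt_min distrC => /andP[yd]; rewrite ltr_norml => /andP[? ?] ?.
    by apply: Hd => //; rewrite /I01/= in_itv/=; lra.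
by exists c => //; move: cab; rewrite in_itv.
Qed.

Lemma horner_continuous_I01 p (x : R) : I01 x -> forall e, 0 < e ->
  exists2 d, 0 < d & forall y, I01 y -> `|y - x| < d -> `|p.[x] - p.[y]| < e.
Proof.
move=> _ e e0.
have : continuous (horner p).
  by move=> z; apply/differentiable_continuous/derivable1_diffP; exact: derivable_horner.
move=> /(_ x)/cvgrPdist_lt/(_ e e0)/nbhs_ballP[d /= d0 H]; exists d => // y _ yx.
by apply: H; rewrite /ball/= distrC.
Qed.

Lemma antiderivative_poly p (x c : R) n : (size p <= n)%N ->
  exists2 P : {poly R}, (size P <= n.+1)%N & P.[x] = c /\ P^`() = p.
Proof.
move=> pn; pose Q := \poly_(i < n.+1) (if i is k.+1 then p`_k / k.+1%:R else 0).
have sQ : (size Q <= n.+1)%N by exact: size_poly.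
exists (Q + (c - Q.[x])%:P).
  by rewrite (leq_trans (size_polyD _ _))// geq_max sQ (leq_trans (size_polyC_leq1 _)).
split; first by rewrite hornerD hornerC addrC subrK.
rewrite derivD derivC addr0; apply/polyP => i; rewrite coef_deriv coef_poly ltnS.
case: ltnP => ni; first by rewrite /= -[LHS]mulr_natr divfK// pnatr_eq0.
by rewrite nth_default ?mul0rn// (leq_trans pn).
Qed.

Lemma derivable_in_nS n f : derivable_in_n I01 n.+1 f ->
  (forall x, I01 x -> derivable_in I01 f x) /\
  derivable_in_n I01 n (derive_in I01 f).
Proof.
move=> fn; split=> [|j jn x Ix]; first exact: (fn 0%N).
by have := fn j.+1 jn x Ix; rewrite /derive_in_n iterSr.
Qed.

(** Induction on the derivative: its approximating polynomial is integrated to [P] with [P.[x] = f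
    x], and the mean value theorem for [f - P] supplies one more factor [|y - x|]. *)
Lemma holder_local_poly n f (K g : R) : 0 <= g -> 0 <= K ->
  derivable_in_n I01 n f ->
  (forall x y, I01 x -> I01 y ->
    `|derive_in_n I01 n f x - derive_in_n I01 n f y| <= K * `|x - y| `^ g) ->
  forall x, I01 x -> exists2 p : {poly R}, (size p <= n.+1)%N &
    forall y, I01 y -> `|f y - p.[y]| <= K * `|y - x| `^ g * `|y - x| ^+ n.
Proof.
move=> g0 K0; elim: n f => [|n IH] f fn fK x Ix.
  exists (f x)%:P; first exact: size_polyC_leq1.
  by move=> y Iy; rewrite hornerC expr0 mulr1; exact: fK.
have [f1 {}fn] := derivable_in_nS fn.
have [y z Iy Iz|p sp Hp] := IH _ fn _ x Ix.
  by have := fK y z Iy Iz; rewrite /derive_in_n !iterSr.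
have [P sP [Px dP]] := antiderivative_poly x (f x) sp.
exists P => // y Iy.
have [->|yx] := eqVneq y x; first by rewrite Px !subrr normr0 exprS mul0r mulr0.
pose h z := f z - P.[z].
have hder : forall z : R, 0 < z < 1 -> is_derive z 1 h (derive_in I01 f z - p.[z]).
  move=> z z01; have Iz : I01 z by rewrite /I01/= in_itv/=; lra.
  have dfz := derive_in_interior (f1 z Iz) z01.
  rewrite -dP; exact: is_deriveB.
have hcont : forall z : R, I01 z -> forall e, 0 < e -> exists2 d, 0 < d & forall y, I01 y ->
    `|y - z| < d -> `|h z - h y| < e.
  move=> z Iz e e0; have e2 : 0 < e / 2 by rewrite divr_gt0.
  have [d1 d10 H1] := derivable_in_continuous (f1 z Iz) e2.
  have [d2 d20 H2] := horner_continuous_I01 P Iz e2.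
  exists (Num.min d1 d2); first by rewrite lt_min d10.
  move=> w Iw; rewrite lt_min => /andP[w1 w2].
  have -> : h z - h w = (f z - f w) - (P.[z] - P.[w]) by rewrite /h; ring.
  rewrite (le_lt_trans (ler_normB _ _))// [ltRHS](splitr e) ltrD//.
    exact: H1.
  exact: H2.
have hx : h x = 0 by rewrite /h Px subrr.
have [c [Ic cx hy]] : exists c, [/\ I01 c, `|c - x| <= `|y - x| & h y = (derive_in I01 f c - p.[c]) * (y - x)].
  move: Ix Iy; rewrite /I01/= !in_itv/= => Ix Iy.
  have [xy|xy] := ltP x y.
    have [||c cxy hE] := MVT_I01 xy _ _ hder hcont; rewrite ?/I01/= ?in_itv//=.
    exists c; split; first by rewrite in_itv/=; lra.
      by rewrite !ger0_norm; lra.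
    by rewrite -hE hx subr0.
  have {}xy : y < x by rewrite lt_neqAle yx.
  have [||c cxy hE] := MVT_I01 xy _ _ hder hcont; rewrite ?/I01/= ?in_itv//=.
  exists c; split; first by rewrite in_itv/=; lra.
    by rewrite !ler0_norm; lra.
  have -> : h y = - (h x - h y) by rewrite hx sub0r opprK.
  by rewrite hE; ring.
rewrite -/(h y) hy normrM exprSr mulrA ler_wpM2r//.
rewrite (le_trans (Hp c Ic))//.
rewrite ler_pM ?mulr_ge0 ?powR_ge0 ?exprn_ge0//.
  by rewrite ler_wpM2l// ge0_ler_powR ?nnegrE.
by rewrite lerXn2r ?nnegrE.
Qed.

Lemma holder_bounded n f (K g : R) : 0 <= g -> 0 <= K ->
  derivable_in_n I01 n f ->
  (forall x y, I01 x -> I01 y ->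
    `|derive_in_n I01 n f x - derive_in_n I01 n f y| <= K * `|x - y| `^ g) ->
  exists C, forall x, I01 x -> `|f x| <= C.
Proof.
move=> g0 K0 fn fK; have I0 : I01 (0 : R) by rewrite /I01/= in_itv/= lexx ltr01.
have [p sp Hp] := holder_local_poly g0 K0 fn fK I0.
exists (K + \sum_(i < size p) `|p`_i|) => x Ix.
have x01 : `|x| <= 1.
  by move: Ix; rewrite /I01/= in_itv/= => /andP[? ?]; rewrite ger0_norm// ltW.
rewrite -[f x](subrK p.[x]) (le_trans (ler_normD _ _))// lerD//.
  apply: (le_trans (Hp x Ix)); rewrite subr0 -mulrA ler_piMr//.
  rewrite mulr_ile1 ?powR_ge0 ?exprn_ge0 ?exprn_ile1//.
  by apply: (@le_trans _ _ (1 `^ g)); [rewrite ge0_ler_powR ?nnegrE|rewrite powR1].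
rewrite horner_coef (le_trans (ler_norm_sum _ _ _))// ler_sum// => i _.
by rewrite normrM ler_piMr// normrX exprn_ile1.
Qed.

Lemma holder_lipschitz n f (K g : R) : 0 <= g -> 0 <= K ->
  derivable_in_n I01 n.+1 f ->
  (forall x y, I01 x -> I01 y ->
    `|derive_in_n I01 n.+1 f x - derive_in_n I01 n.+1 f y| <= K * `|x - y| `^ g) ->
  exists C, forall x y, I01 x -> I01 y -> `|f x - f y| <= C * `|x - y|.
Proof.
move=> g0 K0 /derivable_in_nS[f1 fn] fK.
have [y z Iy Iz|C HC] := holder_bounded g0 K0 fn.
  by have := fK y z Iy Iz; rewrite /derive_in_n !iterSr.
exists C.
have main x y : x < y -> I01 x -> I01 y -> `|f y - f x| <= C * `|y - x|.
  move=> xy Ix Iy.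
  have [z z01|z Iz e e0|c cxy ->] := @MVT_I01 f (derive_in I01 f) x y xy Ix Iy.
  - by apply: derive_in_interior => //; apply: f1; rewrite /I01/= in_itv/=; lra.
  - exact: derivable_in_continuous (f1 z Iz) _ e0.
  rewrite normrM ler_wpM2r// HC//.
  by move: Ix Iy; rewrite /I01/= !in_itv/=; lra.
move=> x y Ix Iy; have [xy|xy|->] := ltgtP x y.
- by rewrite distrC [`|x - y|]distrC main.
- exact: main.
- by rewrite !subrr normr0 mulr0.
Qed.

Section holder_class.
Variables (f : R -> R) (alpha K : R).
Hypothesis alpha_gt0 : 0 < alpha.
Hypothesis fH : holder_class alpha f.
Hypothesis fK : holder_norm alpha f = K%:E.
Let m := sfloor alpha.
Let g := alpha - m%:R.

Let g_gt0 : 0 < g.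
Proof. by rewrite subr_gt0; have /andP[] := sfloorP alpha_gt0. Qed.

Lemma holder_normP x y : I01 x -> I01 y ->
  `|derive_in_n I01 m f x - derive_in_n I01 m f y| <= K * `|x - y| `^ g.
Proof.
(* The supremum ranges over distinct points; on the diagonal both sides vanish because [g > 0]. *)
move=> Ix Iy; have [->|xy] := eqVneq x y.
  by rewrite !subrr normr0 powR0 ?mulr0// gt_eqF.
have xy0 : 0 < `|x - y| `^ g by rewrite powR_gt0// normr_gt0 subr_eq0.
rewrite -ler_pdivrMr// -lee_fin -fK; apply: ereal_sup_ubound.
by exists x, y.
Qed.

Lemma holder_norm_ge0 : 0 <= K.
Proof.
have I0 : I01 (0 : R) by rewrite /I01/= in_itv/= lexx ltr01.
have I2 : I01 (2^-1 : R) by rewrite /I01/= in_itv/=; lra.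
have := holder_normP I0 I2; rewrite sub0r normrN => /(le_trans (normr_ge0 _)).
by rewrite pmulr_lge0// powR_gt0// normr_gt0 invr_eq0.
Qed.

Lemma holder_class_poly x : I01 x -> exists2 p : {poly R}, (size p <= m.+1)%N &
  forall y, I01 y -> `|f y - p.[y]| <= K * `|y - x| `^ alpha.
Proof.
move=> Ix.
have [p sp Hp] := holder_local_poly (ltW g_gt0) holder_norm_ge0 fH.1 holder_normP Ix.
exists p => // y Iy; apply: (le_trans (Hp y Iy)).
rewrite -mulrA ler_wpM2l ?holder_norm_ge0//.
have [->|yx] := eqVneq y x.
  by rewrite subrr normr0 !powR0 ?gt_eqF// mul0r.
have yx0 : 0 < `|y - x| by rewrite normr_gt0 subr_eq0.
rewrite -powR_mulrn// -powRD; last by apply/implyP => _; rewrite gt_eqF.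
by rewrite /g subrK.
Qed.

Lemma holder_class_bounded : exists C, forall x, I01 x -> `|f x| <= C.
Proof. exact: holder_bounded (ltW g_gt0) holder_norm_ge0 fH.1 holder_normP. Qed.

(** For [alpha <= 1] this is the Hoelder bound itself, for [alpha > 1] the derivative is bounded. In
    the second case [C] is not controlled by [K], so it may enter thresholds on [n] but not [M]. *)
Lemma holder_class_modulus : exists2 C, 0 <= C & forall x y, I01 x -> I01 y ->
  `|f x - f y| <= C * `|x - y| `^ (Num.min alpha 1).
Proof.
have m_alpha := sfloorP alpha_gt0.
case mE : m => [|n].
  exists K; first exact: holder_norm_ge0.
  move=> x y Ix Iy; have := holder_normP Ix Iy.
  have /andP[_] := m_alpha; rewrite -/m mE => a1.
  by rewrite /g mE subr0 min_l.
have := holder_class_poly; have hn := holder_normP; have fn := fH.1.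
rewrite -/m mE in fn; rewrite mE in hn => _.
have [C HC] := holder_lipschitz (ltW g_gt0) holder_norm_ge0 fn hn.
exists `|C| => // x y Ix Iy.
have /andP[a1 _] := m_alpha; rewrite -/m mE in a1.
rewrite min_r ?powRr1//; last by rewrite (le_trans _ (ltW a1))// ler1n.
by rewrite (le_trans (HC x y Ix Iy))// ler_wpM2r// ler_norm.
Qed.

End holder_class.

Lemma nabla_horner (h : R) p d : (size p <= d)%N ->
  forall j, iter d (@nabla R) (fun j : int => p.[j%:~R * h]) j = 0.
Proof.
elim: d p => [|d IH] p sp j.
  by move: sp; rewrite leqn0 size_poly_eq0 => /eqP ->; rewrite /= horner0.
rewrite iterSr.
(* Taylor expansion of [p.[x - h]] at [x]: the constant term cancels in the difference and the
   degree drops by one. *)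
pose p' := - \sum_(i < (size p).-1) (- h) ^+ i.+1 *: p^`N(i.+1).
have -> : nabla (fun j : int => p.[j%:~R * h]) = (fun j : int => p'.[j%:~R * h]).
  apply/funext => k; rewrite /nabla intrD mulrDl mulN1r.
  have [p0|p0] := eqVneq p 0.
    by rewrite /p' p0 size_poly0 big_ord0 oppr0 !horner0 subrr.
  have /prednK sp1 : (0 < size p)%N by rewrite size_poly_gt0.
  rewrite (nderiv_taylor _ (mulrC _ _)) -sp1 big_ord_recl/= nderivn0 expr0 mulr1.
  rewrite opprD addrA subrr sub0r /p' hornerN horner_sum; congr (- _).
  by apply: eq_bigr => i _; rewrite hornerZ mulrC.
apply: IH; rewrite /p' size_polyN (leq_trans (size_sum _ _ _))//.
apply/bigmax_leqP => i _; rewrite (leq_trans (size_scale_leq _ _))//.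
rewrite (leq_trans (size_poly _ _))// leq_subLR (leq_trans sp)//.
by rewrite addSn addnC ltnS leq_addr.
Qed.

End derivatives_on_I01.

(** * Densities in the support of the prior *)

Section step_functions.
Context (R : realType).
Local Notation mu := (@lebesgue_measure R).

Lemma I01_cell (M : nat) (x : R) : (0 < M)%N -> I01 x ->
  0 <= Num.floor (M%:R * x) < M%:Z.
Proof.
move=> M0; rewrite /I01/= in_itv/= => /andP[x0 x1].
have M0' : 0 < M%:R :> R by rewrite ltr0n.
have /andP[h1 h2] := floor_itv (M%:R * x); apply/andP; split.
  rewrite -ltzD1 -(ltr_int R); apply: le_lt_trans h2.
  by rewrite mulr_ge0// ltW.
by rewrite -(ltr_int R) (le_lt_trans h1)// gtr_pMr.
Qed.

Lemma cellP (M : nat) (x : R) (j : int) : (0 < M)%N ->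
  (Num.floor (M%:R * x) == j) = (j%:~R / M%:R <= x < (j + 1)%:~R / M%:R).
Proof.
move=> M0; have M0' : 0 < M%:R :> R by rewrite ltr0n.
rewrite ler_pdivrMr// ltr_pdivlMr// (mulrC x).
apply/eqP/idP => [<-|]; first exact: floor_itv.
exact: floor_def.
Qed.

(** A finite combination of indicators of intervals, from which measurability and the integral are
    read off. *)
Lemma cell_sum (M : nat) (c : int -> R) (x : R) : (0 < M)%N -> I01 x ->
  c (Num.floor (M%:R * x)) = \sum_(j < M) c j%:Z *
    \1_(`[j%:R / M%:R, j.+1%:R / M%:R[%classic) x.
Proof.
move=> M0 Ix; have jM := I01_cell M0 Ix.
set j := Num.floor _ in jM *.
have jn : (`|j| < M)%N by lia.
rewrite (bigD1 (Ordinal jn))//= big1 => [|i ij].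
  have je : j = `|j|%N%:Z by lia.
  rewrite addr0 indicE mem_set ?mulr1 -?je//= in_itv/=.
  by have := cellP x `|j|%N M0; rewrite -je eqxx intrD {1 2}je -!pmulrn natr1.
rewrite indicE memNset ?mulr0//= in_itv/= => xi.
move/negP: ij; apply; rewrite -val_eqE/=.
have : Num.floor (M%:R * x) == i%:Z by rewrite cellP// intrD -!pmulrn natr1.
rewrite -/j => /eqP ->; exact/eqP.
Qed.

Lemma measurable_cell (M : nat) (c : int -> R) : (0 < M)%N ->
  measurable_fun I01 (fun x : R => c (Num.floor (M%:R * x))).
Proof.
move=> M0; pose h (x : R) : R := \sum_(j < M) c j%:Z *
  \1_(`[j%:R / M%:R, j.+1%:R / M%:R[%classic : set R) x.
apply: (eq_measurable_fun h).
  by move=> x; rewrite inE => Ix; rewrite (cell_sum _ M0 Ix).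
by apply: measurable_sum => i; apply: measurable_funM.
Qed.

Lemma integral_cell (M : nat) (c : int -> R) : (0 < M)%N ->
  (forall j : nat, (j < M)%N -> 0 <= c j%:Z) ->
  (\int[mu]_(x in I01) (c (Num.floor (M%:R * x : R)))%:E =
   (M%:R^-1 * \sum_(j < M) c j%:Z)%:E)%E.
Proof.
move=> M0 c0; have M0' : 0 < M%:R :> R by rewrite ltr0n.
have mI : measurable (I01 : set (measurableTypeR R)) by exact: measurable_itv.
under eq_integral.
  move=> x; rewrite inE => Ix; rewrite (cell_sum _ M0 Ix) -sumEFin; over.
rewrite ge0_integral_sum//; last 2 first.
- by move=> i; apply/measurable_EFinP; apply: measurable_funM.
- by move=> i x _; rewrite lee_fin mulr_ge0// c0.
rewrite mulr_sumr -sumEFin; apply: eq_bigr => i _.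
under eq_integral do rewrite EFinM.
rewrite ge0_integralZl//; last 2 first.
- exact/measurable_EFinP.
- by rewrite lee_fin c0.
rewrite muleC EFinM; congr (_ * _)%E.
rewrite integral_indic//.
have E : `[i%:R / M%:R, i.+1%:R / M%:R[ `&` I01 =
    `[i%:R / M%:R, i.+1%:R / M%:R[%classic :> set R.
  apply/seteqP; split => [x []//|x /=]; rewrite in_itv/= => /andP[xi xi1]; split.
    by rewrite /= ?in_itv/= ?xi ?xi1.
  rewrite /I01/= in_itv/= (le_trans _ xi) ?divr_ge0//=.
  by rewrite (lt_le_trans xi1)// ler_pdivrMr// mul1r ler_nat.
transitivity (mu `[i%:R / M%:R, i.+1%:R / M%:R[%classic); first by congr (mu _).
rewrite lebesgue_measure_itv/= lte_fin ltr_pM2r ?invr_gt0// ltr_nat ltnSn.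
by rewrite -EFinB -mulrBl -natrB// subSnn mul1r.
Qed.

End step_functions.

Section coef_density.
Context (R : realType).
Local Notation RM := (measurableTypeR R).
Local Notation mu := (@lebesgue_measure R).
Variables (m L q : nat).
Hypothesis q_gt0 : (0 < q)%N.
Implicit Types (t : nat -> R) (u : int -> R).

Let N := (2 ^ L)%N.
Let M := (q * N)%N.

Let N_gt0 : (0 < N)%N. Proof. by rewrite expn_gt0. Qed.
Let M_gt0 : (0 < M)%N. Proof. by rewrite muln_gt0 q_gt0. Qed.

Definition periodic t : int -> R := fun i => t `|(i %% (2 ^ L + m)%N)%Z|%N.

(* The aggregated histogram is constant on grid cells of length 1 / (q * 2 ^ L). Its
   factor 2 ^ L is dropped since densities are normalized by [coef_mass]. *)
Definition spline_fun u (x : R) : R := spline q m u (Num.floor ((q * 2 ^ L)%:R * x)).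

Definition coef_mass t : R :=
  (q * 2 ^ L)%:R^-1 * \sum_(j < q * 2 ^ L) spline q m (periodic t) j%:Z.

Definition coef_density t (x : R) : R :=
  spline_fun (periodic t) x / coef_mass t.

Lemma floor_stretch (x : R) :
  (Num.floor (M%:R * x) %/ q%:Z)%Z = Num.floor (N%:R * x).
Proof.
have /andP[h1 h2] := floor_itv (N%:R * x).
set k := Num.floor (N%:R * x) in h1 h2 *; set j := Num.floor _.
have q0 : 0 < q%:R :> R by rewrite ltr0n.
have kj : k * q%:Z <= j.
  rewrite -ltzD1 -(ltr_int R); have /andP[_] := floor_itv (M%:R * x).
  apply: le_lt_trans; rewrite intrM /M natrM -mulrA (mulrC q%:R) -pmulrn.
  by rewrite ler_pM2r.
have jk : j < (k + 1) * q%:Z.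
  rewrite -(ltr_int R); have /andP[+ _] := floor_itv (M%:R * x).
  move=> /le_lt_trans; apply; rewrite intrM /M natrM -mulrA (mulrC q%:R) -pmulrn.
  by rewrite ltr_pM2r.
have -> : j = k * q%:Z + (j - k * q%:Z) by lia.
rewrite divzMDl; last by lia.
by rewrite divz_small ?addr0//; move: jk; rewrite mulrDl; lia.
Qed.

Lemma aggregate_cell (k : nat) (F : int -> R) (x : R) :
  aggregate k q (2 ^- L) (fun x => F (Num.floor (M%:R * x))) x =
  iter k (avg q) F (Num.floor (M%:R * x)).
Proof.
elim: k F x => // k IH F x; rewrite /aggregate iterSr iterSr -IH /aggregate.
congr (iter k _ _ x); apply/funext => y; rewrite /aggregate1 /avg; congr (_ * _).
apply: eq_bigr => i _; congr F.
have -> : M%:R * (y - i%:R * 2 ^- L / q%:R) = M%:R * y - i%:R :> R.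
  rewrite /M natrM /N natrX; field.
  by rewrite expf_neq0//= pnatr_eq0 -lt0n q_gt0.
apply: floor_def; have /andP[h1 h2] := floor_itv (M%:R * y).
by move: h1 h2; rewrite !intrD intrN -!pmulrn; lra.
Qed.

Lemma histoE (i : int) (x : R) :
  histo L i x = 2 ^+ L * (Num.floor (N%:R * x) == i)%:R :> R.
Proof.
rewrite /histo indicE; congr (_ * _%:R); congr nat_of_bool.
rewrite cellP// /N natrX; apply/idP/idP; rewrite inE/= in_itv//.
Qed.

Lemma sum_histo u (x : R) :
  \sum_(i \in [set: int]) u i * histo L i x = 2 ^+ L * u (Num.floor (N%:R * x)).
Proof.
rewrite -(fsbig_widen [set Num.floor (N%:R * x)])//.
  by rewrite fsbig_set1 histoE eqxx mulr1 mulrC.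
move=> i [_ /= ij]; rewrite histoE; case: eqP => [e|_]; last by rewrite !mulr0.
by case: ij.
Qed.

Lemma aggregate_histogram u (x : R) :
  aggregate m q (2 ^- L) (fun x => \sum_(i \in [set: int]) u i * histo L i x) x =
  2 ^+ L * spline_fun u x.
Proof.
have -> : (fun x => \sum_(i \in [set: int]) u i * histo L i x) =
    (fun x => (fun j : int => 2 ^+ L * stretch q u j) (Num.floor (M%:R * x))).
  by apply/funext => y; rewrite sum_histo /stretch floor_stretch.
by rewrite (aggregate_cell m (fun j => 2 ^+ L * stretch q u j)) iter_avgZ.
Qed.

Section nonneg.
Variable t : nat -> R.
Hypothesis t_ge0 : forall k, (k < 2 ^ L + m)%N -> 0 <= t k.

Let P := (2 ^ L + m)%N.
Let P_gt0 : (0 < P)%N. Proof. by rewrite addn_gt0 N_gt0. Qed.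

Lemma periodic_ge0 i : 0 <= periodic t i.
Proof.
apply: t_ge0; have := modz_ge0 i (_ : P%:Z != 0); have := ltz_pmod i (_ : 0 < P%:Z).
by rewrite -/P; lia.
Qed.

Lemma spline_periodic_ge0 j : 0 <= spline q m (periodic t) j.
Proof.
rewrite -[leLHS](_ : spline q m (fun=> 0) j = _); last by rewrite spline_cst.
by apply: le_spline => // i _; exact: periodic_ge0.
Qed.

Lemma spline_fun_ge0 x : 0 <= spline_fun (periodic t) x.
Proof. exact: spline_periodic_ge0. Qed.

Lemma integral_spline_fun (c : R) : 0 <= c ->
  (\int[mu]_(x in I01) (c * spline_fun (periodic t) x)%:E = (c * coef_mass t)%:E)%E.
Proof.
move=> c0; rewrite (@integral_cell _ _ (fun j => c * spline q m (periodic t) j))//.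
  by rewrite -mulr_sumr mulrCA.
by move=> j _; rewrite mulr_ge0// spline_periodic_ge0.
Qed.

(** A single fine cell already sees coefficient [k] with weight [q^-m]. The mass therefore cannot be
    much smaller than the largest coefficient. *)
Lemma coef_mass_ge k : (m < q)%N -> (k < 2 ^ L + m)%N ->
  q%:R^-1 ^+ m.+1 * (2 ^ L)%:R^-1 * t k <= coef_mass t.
Proof.
move=> mq kP; have M0 : 0 < M%:R :> R by rewrite ltr0n.
suff [j jM tj] : exists2 j : nat, (j < M)%N &
    q%:R^-1 ^+ m * t k <= spline q m (periodic t) j%:Z.
  rewrite /coef_mass -/M (bigD1 (Ordinal jM))//= mulrDr ler_wpDr//.
    by rewrite mulr_ge0 ?invr_ge0 ?(ltW M0)// sumr_ge0// => i _; exact: spline_periodic_ge0.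
  rewrite exprS /M natrM invfM -[leLHS]mulrA -[leRHS]mulrA -!mulrA.
  rewrite ler_pM2l ?invr_gt0 ?ltr0n// mulrCA ler_pM2l ?invr_gt0 ?ltr0n ?N_gt0//.
have [kN|kN] := ltnP k N.
  exists (k * q)%N; first by rewrite /M mulnC ltn_pmul2l.
  have := spline_ge_coef q_gt0 (k * q)%N%:Z periodic_ge0 (leq0n m).
  rewrite mul0n subr0 PoszM mulzK ?eqz_nat -?lt0n//.
  by rewrite {1}/periodic modz_small ?absz_nat//; lia.
(* A wrapped coefficient has index [-r] modulo the period, with [0 < r <= m]; it is seen from cell 0
   by [r] shifts of [q - 1], and [r < q] ensures that the quotient is exactly [-r]. *)
exists 0%N; first exact: M_gt0.
pose r := (P - k)%N.
have rm : (r <= m)%N by rewrite /r /P; lia.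
have r0 : (0 < r)%N by rewrite /r /P subn_gt0.
have := spline_ge_coef q_gt0 0%N%:Z periodic_ge0 rm.
have -> : (0%N%:Z - (r * q.-1)%N%:Z) = - r%:Z * q%:Z + r%:Z.
  by case: (q) q_gt0 => // q' _; lia.
rewrite divzMDl; last by lia.
rewrite [(r %/ q)%Z]divz_small; last by lia.
rewrite addr0 {1}/periodic -/P.
have -> : (- r%:Z %% P)%Z = k%:Z.
  have -> : - r%:Z = (- 1) * P%:Z + k%:Z by rewrite /r; lia.
  by rewrite modzMDl modz_small//; lia.
by rewrite absz_nat.
Qed.

End nonneg.

Lemma coef_massZ t (c : R) : coef_mass (fun k => c * t k) = c * coef_mass t.
Proof.
rewrite /coef_mass [RHS]mulrCA [in RHS]mulr_sumr; congr (_ * _); apply: eq_bigr => j _.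
by rewrite -[RHS](_ : spline q m (fun i => c * periodic t i) j%:Z = _) ?splineZ.
Qed.

Lemma spline_fun_le t t' x : (forall k, (k < 2 ^ L + m)%N -> t k <= t' k) ->
  spline_fun (periodic t) x <= spline_fun (periodic t') x.
Proof.
move=> tt; apply: le_spline => // i _; rewrite /periodic; apply: tt.
have P0 : (0 < 2 ^ L + m)%N by rewrite addn_gt0 N_gt0.
have := modz_ge0 i (_ : (2 ^ L + m)%N%:Z != 0).
have := ltz_pmod i (_ : 0 < (2 ^ L + m)%N%:Z); lia.
Qed.

Lemma coef_mass_le t t' : (forall k, (k < 2 ^ L + m)%N -> t k <= t' k) ->
  coef_mass t <= coef_mass t'.
Proof.
move=> tt; rewrite ler_wpM2l ?invr_ge0//; apply: ler_sum => j _.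
apply: le_spline => // i _; rewrite /periodic; apply: tt.
have P0 : (0 < 2 ^ L + m)%N by rewrite addn_gt0 N_gt0.
have := modz_ge0 i (_ : (2 ^ L + m)%N%:Z != 0).
have := ltz_pmod i (_ : 0 < (2 ^ L + m)%N%:Z); lia.
Qed.

Lemma coef_massD_cst t (c : R) : coef_mass (fun k => t k + c) = coef_mass t + c.
Proof.
rewrite /coef_mass.
under eq_bigr => j _.
  rewrite (_ : periodic _ = fun i => periodic t i + c)//.
  rewrite (@splineD R q m (periodic t) (fun=> c)) spline_cst//; over.
rewrite big_split/= mulrDr sumr_const card_ord -(mulr_natl c) mulKf//.
by rewrite pnatr_eq0 -lt0n.
Qed.

Lemma DPA_densityE (y : (size (nodes L)).-tuple RM) (v : m.-tuple RM) x :
  (forall k, (k < 2 ^ L + m)%N -> 0 <= theta y v k) ->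
  DPA_density q y v x = coef_density (theta y v) x.
Proof.
move=> t0; rewrite /DPA_density /histogram.
rewrite (_ : (fun _ : R => \sum_(i \in _) _) =
   (fun x => \sum_(i \in [set: int]) periodic (theta y v) i * histo L i x))//.
rewrite (_ : aggregate _ _ _ _ = (fun x => 2 ^+ L * spline_fun (periodic (theta y v)) x)); last first.
  by apply/funext => z; exact: aggregate_histogram.
rewrite /Rintegral integral_spline_fun//= /coef_density -mulf_div divff ?mul1r//.
Qed.

End coef_density.

(** * A finite family of grid densities dominating the support *)

Section upper_cover.
Context (R : realType).
Variables (m L q : nat).
Hypothesis q_gt0 : (0 < q)%N.
Hypothesis mq : (m < q)%N.
Local Notation mu := (@lebesgue_measure R).
Local Notation P := (2 ^ L + m)%N.

(** Densities are invariant under scaling of the coefficients, so the grid can have step 1. The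
    successor keeps every coefficient, hence the mass, positive. *)
Definition grid_coef (K : nat) (w : P.-tuple 'I_K.+1) (k : nat) : R :=
  (nth ord0 w k).+1%:R.

Lemma coef_mass_gt0 (t : nat -> R) k : (forall k, (k < P)%N -> 0 <= t k) ->
  (k < P)%N -> 0 < t k -> 0 < coef_mass m L q t.
Proof.
move=> t0 kP tk; apply: lt_le_trans (coef_mass_ge q_gt0 t0 mq kP).
by rewrite !mulr_gt0// ?invr_gt0 ?exprn_gt0// ?invr_gt0 ltr0n// expn_gt0.
Qed.

Lemma coef_density_ge0 (t : nat -> R) x : (forall k, (k < P)%N -> 0 <= t k) ->
  0 < coef_mass m L q t -> 0 <= coef_density m L q t x.
Proof. by move=> t0 Z0; rewrite divr_ge0 ?spline_fun_ge0// ltW. Qed.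

Lemma measurable_coef_density (t : nat -> R) :
  measurable_fun I01 (coef_density m L q t).
Proof.
apply: measurable_funM => //; apply: (@measurable_cell R _ (spline q m (periodic m L t))).
by rewrite muln_gt0 q_gt0 expn_gt0.
Qed.

Lemma coef_density_int1 (t : nat -> R) : (forall k, (k < P)%N -> 0 <= t k) ->
  0 < coef_mass m L q t ->
  (\int[mu]_(x in I01) (coef_density m L q t x)%:E = 1)%E.
Proof.
move=> t0 Z0; under eq_integral do rewrite /coef_density mulrC.
by rewrite integral_spline_fun// ?mulVf ?gt_eqF// invr_ge0 ltW.
Qed.

Lemma grid_coef_ge1 K (w : P.-tuple 'I_K.+1) k : 1 <= grid_coef w k.
Proof. by rewrite ler1n. Qed.

Lemma grid_coef_mass_gt0 K (w : P.-tuple 'I_K.+1) : 0 < coef_mass m L q (grid_coef w).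
Proof.
apply: (@coef_mass_gt0 _ 0) => [k _||].
- exact: le_trans ler01 (grid_coef_ge1 w k).
- by rewrite addn_gt0 expn_gt0.
- exact: lt_le_trans ltr01 (grid_coef_ge1 w 0).
Qed.

(** With [b = q^(m+1) * N^2 * n] for [N = 2^L], a coefficient of size at least [1/N] forces
    [1/b <= coef_mass t / n]. Rounding up to multiples of [1/b] raises the spline and increases the
    mass by a factor at most [1 + 1/n]. The condition on [K] makes room for all rounded values. *)
Lemma coef_density_cover (t : nat -> R) (C : R) (K n : nat) : (0 < n)%N ->
  (forall k, (k < P)%N -> 0 <= t k <= C) ->
  (exists2 k, (k < P)%N & (2 ^ L)%:R^-1 <= t k) ->
  C * (q%:R ^+ m.+1 * (2 ^ L)%:R ^+ 2 * n%:R) <= K%:R ->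
  exists w : P.-tuple 'I_K.+1, forall x,
    coef_density m L q t x <= (1 + n%:R^-1) * coef_density m L q (grid_coef w) x.
Proof.
move=> n0 tC [k kP tk] CK.
have t0 i : (i < P)%N -> 0 <= t i by move=> /tC/andP[].
have N0 : 0 < (2 ^ L)%:R :> R by rewrite ltr0n expn_gt0.
set b := q%:R ^+ m.+1 * _ * _ in CK.
have q0 : 0 < q%:R :> R by rewrite ltr0n.
have n0' : 0 < n%:R :> R by rewrite ltr0n.
have b0 : 0 < b by rewrite /b !mulr_gt0 ?exprn_gt0.
have Z0 : 0 < coef_mass m L q t.
  by apply: (@coef_mass_gt0 _ k) => //; apply: lt_le_trans tk; rewrite invr_gt0.
have bZ : b^-1 <= n%:R^-1 * coef_mass m L q t.
  apply: le_trans (ler_wpM2l _ (coef_mass_ge q_gt0 t0 mq kP)); rewrite ?invr_ge0//.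
  have -> : b^-1 = n%:R^-1 * (q%:R^-1 ^+ m.+1 * (2 ^ L)%:R^-1 * (2 ^ L)%:R^-1).
    by rewrite /b exprVn; field; rewrite !gt_eqF// exprn_gt0.
  by rewrite !ler_wpM2l ?mulr_ge0 ?exprn_ge0 ?invr_ge0// ltW.
have wP i : (`|Num.floor (b * t i)|%N < K.+1)%N || (P <= i)%N.
  case: (ltnP i P) => [iP|_]; last by rewrite orbT.
  rewrite orbF ltnS.
  have /andP[ti tiC] := tC i iP.
  have h : 0 <= Num.floor (b * t i) by rewrite floor_ge0 mulr_ge0// ltW.
  rewrite -lez_nat gez0_abs// -(ler_int R) (le_trans (floor_le _))//.
  by apply: le_trans CK; rewrite mulrC ler_pM2r.
pose w : P.-tuple 'I_K.+1 := [tuple inord `|Num.floor (b * t i)|%N | i < P].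
have wE i : (i < P)%N -> grid_coef w i = (Num.floor (b * t i) + 1)%:~R.
  move=> iP; rewrite /grid_coef /w.
  rewrite -[nth _ _ _](_ : tnth w (Ordinal iP) = _); last by rewrite (tnth_nth ord0).
  rewrite tnth_mktuple inordK; last by have := wP i; rewrite (leqNgt P i) iP orbF.
  have h : 0 <= Num.floor (b * t i) by rewrite floor_ge0 mulr_ge0 ?t0// ltW.
  by rewrite -[in LHS]natr1 intrD pmulrn gez0_abs.
exists w => x.
have Zw := grid_coef_mass_gt0 w.
have Zw_le : coef_mass m L q (grid_coef w) <= b * ((1 + n%:R^-1) * coef_mass m L q t).
  have -> : coef_mass m L q (grid_coef w) = b * coef_mass m L q (fun i => b^-1 * grid_coef w i).
    by rewrite coef_massZ mulVKf// gt_eqF.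
  rewrite ler_pM2l// mulrDl mul1r.
  apply: le_trans (lerD (lexx _) bZ); rewrite -coef_massD_cst//.
  apply: coef_mass_le => // i iP.
  rewrite ler_pdivrMl// mulrDr divff ?gt_eqF// wE// intrD lerD2r.
  exact: floor_le.
have S_le : spline_fun m L q (periodic m L t) x <=
    b^-1 * spline_fun m L q (periodic m L (grid_coef w)) x.
  rewrite -[leRHS](_ : spline_fun m L q (periodic m L (fun i => b^-1 * grid_coef w i)) x = _).
    apply: spline_fun_le => // i iP; rewrite ler_pdivlMl// wE//.
    exact/ltW/floorD1_gt.
  exact: (congr1 (fun F => F (Num.floor ((q * 2 ^ L)%:R * x)))
    (@splineZ R q m b^-1 (periodic m L (grid_coef w)))).
have S0 : 0 <= spline_fun m L q (periodic m L (grid_coef w)) x.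
  by apply: spline_fun_ge0 => // i _; apply: le_trans ler01 (grid_coef_ge1 w i).
have St0 : 0 <= spline_fun m L q (periodic m L t) x by exact: spline_fun_ge0.
rewrite /coef_density mulrA ler_pdivrMr// mulrAC ler_pdivlMr//.
apply: (le_trans (ler_pM St0 (ltW Zw) S_le Zw_le)).
rewrite le_eqVlt; apply/orP; left; apply/eqP; field.
by rewrite !gt_eqF.
Qed.

End upper_cover.

(** * From distance to affinity *)

Section affinity.
Context (R : realType).
Local Notation mu := (@lebesgue_measure R).
Implicit Types f g : R -> R.

Lemma integral_lin2 (a b : R) f g : 0 <= a -> 0 <= b ->
  measurable_fun I01 f -> measurable_fun I01 g ->
  (forall x, I01 x -> 0 <= f x) -> (forall x, I01 x -> 0 <= g x) ->
  (\int[mu]_(x in I01) (a * f x + b * g x)%:E =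
   a%:E * \int[mu]_(x in I01) (f x)%:E + b%:E * \int[mu]_(x in I01) (g x)%:E)%E.
Proof.
move=> a0 b0 mf mg f0 g0; under eq_integral do rewrite EFinD !EFinM.
have mI : measurable (I01 : set (measurableTypeR R)) by exact: measurable_itv.
rewrite ge0_integralD//; last 4 first.
- by move=> x Ix; rewrite mule_ge0// lee_fin f0.
- by apply: measurable_funeM; exact/measurable_EFinP.
- by move=> x Ix; rewrite mule_ge0// lee_fin g0.
- by apply: measurable_funeM; exact/measurable_EFinP.
by rewrite !ge0_integralZl//; exact/measurable_EFinP.
Qed.

Variables (f0 f g : R -> R) (n : nat).
Hypothesis mf0 : measurable_fun I01 f0.
Hypothesis mf : measurable_fun I01 f.
Hypothesis mg : measurable_fun I01 g.
Hypothesis f0_ge0 : forall x, I01 x -> 0 <= f0 x.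
Hypothesis f_ge0 : forall x, I01 x -> 0 <= f x.
Hypothesis g_ge0 : forall x, I01 x -> 0 <= g x.
Hypothesis f0_int : (\int[mu]_(x in I01) (f0 x)%:E = 1)%E.
Hypothesis f_int : (\int[mu]_(x in I01) (f x)%:E = 1)%E.
Hypothesis g_int : (\int[mu]_(x in I01) (g x)%:E = 1)%E.
Hypothesis fg : forall x, I01 x -> f x <= (1 + n%:R^-1) * g x.

Let aff := (\int[mu]_(x in I01) (Num.sqrt (f0 x * g x))%:E)%E.

Let n0 : 0 <= n%:R^-1 :> R. Proof. by rewrite invr_ge0. Qed.

(** With [a], [b], [c] the roots of [f0], [f], [g]: [(a - b)^2 <= 2 (a - c)^2 + 2 (c - b)^2], and
    [f <= (1 + 1/n) g] gives [(c - b)^2 <= 2 c^2 / n + c^2 - b^2], whose integral is at most [2/n].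
    Terms are placed so that both sides have nonnegative summands. *)
Lemma hellinger_pointwise x : I01 x ->
  (Num.sqrt (f0 x) - Num.sqrt (f x)) ^+ 2 + 4 * Num.sqrt (f0 x * g x) + 2 * f x <=
  2 * f0 x + (4 + 4 * n%:R^-1) * g x.
Proof.
move=> Ix; have := fg Ix; have := f0_ge0 Ix; have := f_ge0 Ix; have := g_ge0 Ix.
move=> gx fx f0x fgx; rewrite sqrtrM//.
have ea := sqr_sqrtr f0x; have eb := sqr_sqrtr fx; have ec := sqr_sqrtr gx.
have a0 := sqrtr_ge0 (f0 x); have b0 := sqrtr_ge0 (f x); have c0 := sqrtr_ge0 (g x).
have kg : 0 <= n%:R^-1 * g x by rewrite mulr_ge0.
have -> : (4 + 4 * n%:R^-1) * g x = 4 * g x + 4 * (n%:R^-1 * g x) by ring.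
move: fgx kg; have -> : (1 + n%:R^-1) * g x = g x + n%:R^-1 * g x by ring.
move: a0 b0 c0 ea eb ec.
set a := Num.sqrt _; set b := Num.sqrt _; set c := Num.sqrt _.
set k := n%:R^-1 * _ => a0 b0 c0 ea eb ec bc k0.
have h1 : 0 <= (a - 2 * c + b) ^+ 2 by exact: sqr_ge0.
have : (c - b) ^+ 2 <= 2 * k + (c ^+ 2 - b ^+ 2).
  have [cb|cb] := leP b c.
    have h : 0 <= b * (c - b) by rewrite mulr_ge0// subr_ge0.
    suff : 0 <= 2 * (b * (c - b)) + 2 * k by lra.
    by lra.
  have h : 0 <= c * (b - c) by rewrite mulr_ge0// subr_ge0 ltW.
  suff : 0 <= 2 * (c * (b - c)) + 2 * (c ^+ 2 + k - b ^+ 2) by lra.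
  lra.
by move: h1; lra.
Qed.

Let mI : measurable (I01 : set (measurableTypeR R)).
Proof. exact: measurable_itv. Qed.

Let msqrt (h : R -> R) : measurable_fun I01 h -> measurable_fun I01 (fun x => Num.sqrt (h x)).
Proof. by move=> mh; apply: (measurableT_comp (@measurable_sqrt R)). Qed.

Let maff : measurable_fun I01 (fun x => Num.sqrt (f0 x * g x)).
Proof. by apply: msqrt; exact: measurable_funM. Qed.

Lemma affinity_hellinger (r : R) :
  (r%:E < \int[mu]_(x in I01) ((Num.sqrt (f0 x) - Num.sqrt (f x)) ^+ 2)%:E)%E ->
  0 <= r ->
  (aff <= (1 + n%:R^-1 - r / 4)%:E)%E.
Proof.
move=> rh r0.
pose H x := (Num.sqrt (f0 x) - Num.sqrt (f x)) ^+ 2.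
have mH : measurable_fun I01 H.
  by apply: measurable_funX; apply: measurable_funB; exact: msqrt.
have H0 x : I01 x -> 0 <= H x by move=> _; exact: sqr_ge0.
have a0 x : I01 x -> 0 <= Num.sqrt (f0 x * g x) by move=> _; exact: sqrtr_ge0.
have : (\int[mu]_(x in I01) (1 * H x + 1 * (4 * Num.sqrt (f0 x * g x) + 2 * f x))%:E <=
        \int[mu]_(x in I01) (2 * f0 x + (4 + 4 * n%:R^-1) * g x)%:E)%E.
  apply: ge0_le_integral => //.
  - move=> x Ix; rewrite lee_fin !mul1r addr_ge0 ?H0// addr_ge0// mulr_ge0//.
    exact: f_ge0.
  - apply/measurable_EFinP; apply: measurable_funD; apply: measurable_funM => //.
    by apply: measurable_funD; apply: measurable_funM.
  - by apply/measurable_EFinP; apply: measurable_funD; apply: measurable_funM.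
  - by move=> x Ix; rewrite lee_fin !mul1r addrA; exact: hellinger_pointwise.
rewrite !integral_lin2//; do ?[
  by rewrite addr_ge0// mulr_ge0 | by rewrite mulr_ge0// ?sqr_ge0// ltW
 | by apply: measurable_funD; apply: measurable_funM
 | by move=> x Ix; rewrite addr_ge0// mulr_ge0// ?addr_ge0 ?mulr_ge0 ?f_ge0 ?f0_ge0 ?g_ge0 ].
rewrite f0_int g_int f_int -/aff !mul1e !mule1.
have aff0 : (0 <= aff)%E by apply: integral_ge0 => x _; rewrite lee_fin sqrtr_ge0.
move: rh; rewrite -/(H _); set I := (\int[_]_(x in _) _)%E => rh h.
have : (r%:E + (4%:E * aff + 2%:E) <= 2%:E + (4 + 4 * n%:R^-1)%:E)%E.
  by apply: le_trans h; rewrite leeD2r// ltW.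
move: aff0; case: aff => [a| |]//; last first.
  by move=> _; rewrite gt0_muley ?lte_fin// addye// addey// leye_eq.
by rewrite !lee_fin => _; lra.
Qed.

Lemma affinity_far (r : R) : 0 < r ->
  (r%:E < L1_dist f0 f)%E \/ (r%:E < hellinger_dist f0 f)%E ->
  (aff <= (1 + n%:R^-1 - r ^+ 2 / 16)%:E)%E.
Proof.
move=> r0 [rd|rd]; last first.
  have r2 : 0 <= r ^+ 2 by exact: sqr_ge0.
  apply: (@le_trans _ _ (1 + n%:R^-1 - r ^+ 2 / 4)%:E); last by rewrite lee_fin; lra.
  apply: affinity_hellinger => //; rewrite ltNge; apply/negP => Ir.
  move: rd; rewrite /hellinger_dist ltNge => /negP; apply.
  have H (J : \bar R) : (0 <= J -> J <= (r ^+ 2)%:E -> J `^ (2%:R^-1)%R <= r%:E)%E.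
    case: J => [i| |]//; rewrite !lee_fin => i0 ir.
    rewrite powR12_sqrt//.
    by rewrite -(ger0_norm (ltW r0)) -sqrtr_sqr ler_wsqrtr.
  by apply: H => //; apply: integral_ge0 => x _; rewrite lee_fin sqr_ge0.
(* From [2 tau |f0 - f| <= (a - b)^2 + 2 tau^2 (f0 + f)], an L1 distance above [r] forces a squared
   Hellinger distance above [2 tau r - 4 tau^2]. The choice [tau = r / 4] maximizes this, giving
   [r^2 / 4]. *)
pose tau := r / 4.
have tau0 : 0 < tau by rewrite divr_gt0.
pose D x := `|f0 x - f x|.
have mD : measurable_fun I01 D.
  by apply: measurableT_comp => //; exact: measurable_funB.
have D0 x : I01 x -> 0 <= D x by move=> _; exact: normr_ge0.
have a0 x : I01 x -> 0 <= Num.sqrt (f0 x * g x) by move=> _; exact: sqrtr_ge0.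
have : (\int[mu]_(x in I01) ((2 * tau) * D x + 1 * (4 * Num.sqrt (f0 x * g x) + 2 * f x))%:E <=
        \int[mu]_(x in I01) (1 * (2 * f0 x + (4 + 4 * n%:R^-1) * g x) +
            (2 * tau ^+ 2) * (1 * f0 x + 1 * f x))%:E)%E.
  apply: ge0_le_integral => //.
  - move=> x Ix; rewrite lee_fin addr_ge0// mulr_ge0// ?D0//; first by rewrite mulr_ge0// ltW.
    by rewrite addr_ge0// mulr_ge0// f_ge0.
  - apply/measurable_EFinP; apply: measurable_funD; apply: measurable_funM => //.
    by apply: measurable_funD; apply: measurable_funM.
  - apply/measurable_EFinP; apply: measurable_funD; apply: measurable_funM => //.
      by apply: measurable_funD; apply: measurable_funM.
    by apply: measurable_funD; apply: measurable_funM.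
  - move=> x Ix; rewrite lee_fin !mul1r.
    have := hellinger_pointwise Ix.
    suff : 2 * tau * D x <= (Num.sqrt (f0 x) - Num.sqrt (f x)) ^+ 2 + 2 * tau ^+ 2 * (f0 x + f x) by lra.
    pose a := Num.sqrt (f0 x); pose b := Num.sqrt (f x).
    have ea : a ^+ 2 = f0 x by rewrite sqr_sqrtr ?f0_ge0.
    have eb : b ^+ 2 = f x by rewrite sqr_sqrtr ?f_ge0.
    have ab0 : 0 <= a + b by rewrite addr_ge0 ?sqrtr_ge0.
    have -> : D x = `|a - b| * (a + b).
      by rewrite /D -ea -eb subr_sqr normrM (ger0_norm ab0).
    rewrite -/a -/b -ea -eb -[(a - b) ^+ 2]real_normK ?num_real//.
    have dd : 0 <= tau ^+ 2 * (a - b) ^+ 2 by rewrite mulr_ge0 ?sqr_ge0.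
    have ee : 0 <= (`|a - b| - tau * (a + b)) ^+ 2 by exact: sqr_ge0.
    by lra.
rewrite !integral_lin2//; do ?[
  by rewrite addr_ge0// mulr_ge0 | by rewrite mulr_ge0// ?sqr_ge0// ltW
 | by apply: measurable_funD; apply: measurable_funM
 | by move=> x Ix; rewrite addr_ge0// mulr_ge0// ?addr_ge0 ?mulr_ge0 ?f_ge0 ?f0_ge0 ?g_ge0 ].
rewrite f0_int g_int f_int -/aff !mul1e !mule1.
have aff0 : (0 <= aff)%E by apply: integral_ge0 => x _; rewrite lee_fin sqrtr_ge0.
move: rd; rewrite /L1_dist -/(D _); set I := (\int[_]_(x in _) _)%E => rd h.
have : ((2 * tau * r)%:E + (4%:E * aff + 2%:E) <=
   (2%:E + (4 + 4 * n%:R^-1)%:E) + (2 * tau ^+ 2)%:E * (1 + 1))%E.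
  by apply: le_trans h; rewrite leeD2r// EFinM lee_wpmul2l ?lee_fin ?mulr_ge0 ?(ltW tau0)// ltW.
move: aff0; case: aff => [a| |]//; last first.
  by move=> _; rewrite gt0_muley ?lte_fin// addye// addey// leye_eq.
by rewrite !lee_fin /tau => _; lra.
Qed.

End affinity.

(** * Mass of the prior near a target *)

Section beta_law_mass.
Context (R : realType).
Local Notation mu := (@lebesgue_measure R).
Local Notation RM := (measurableTypeR R).

(** A majorant of the Beta weight with the explicit primitive [prim], valid for all [a > 0]: it
    bounds the normalizing constant by [4 / a + 1], although the weight is unbounded at both ends
    for [a < 1]. *)
Let dom (a t : R) : R := 2 * t `^ (a - 1) + 2 * (1 - t) `^ (a - 1) + 1.
Let prim (a t : R) : R := 2 / a * (t `^ a - (1 - t) `^ a) + t.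

Let is_derive_prim (a t : R) : 0 < a -> 0 < t < 1 -> is_derive t 1 (prim a) (dom a t).
Proof.
move=> a0 /andP[t0 t1].
have d1 := is_derive1_powR a t0.
have t1' : 0 < 1 - t by rewrite subr_gt0.
have d2 : is_derive t 1 (fun x : R => 1 - x) (-1).
  by have := is_deriveB (is_derive_cst (1 : R) t 1) (is_derive_id t (1 : R)); rewrite sub0r.
have d3 := @is_derive1_comp R (fun x => x `^ a) (fun x => 1 - x) t _ _ (is_derive1_powR a t1') d2.
have d4 := is_deriveZ (2 / a) (is_deriveB d1 d3).
have d5 := is_deriveD d4 (is_derive_id t 1).
apply: (is_derive_eq d5).
rewrite /dom /GRing.scale/=; field; exact: lt0r_neq0.
Qed.

Let dom_continuous (a t : R) : 0 < t < 1 -> {for t, continuous (dom a)}.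
Proof.
move=> /andP[t0 t1].
have t1' : 0 < 1 - t by rewrite subr_gt0.
have c1 (s b : R) : 0 < s -> {for s, continuous (fun x : R => x `^ b)}.
  move=> s0; apply/differentiable_continuous/derivable1_diffP.
  by have [] := is_derive1_powR b s0.
have c2 : {for t, continuous (fun x : R => 1 - x)}.
  by apply: cvgB; [exact: cvg_cst|exact: cvg_id].
apply: continuousD; last exact: cvg_cst.
apply: continuousD; apply: continuousM; try exact: cvg_cst.
  exact: c1.
apply: (@continuous_comp _ _ _ (fun x : R => 1 - x) (fun x : R => x `^ (a - 1))).
  exact: c2.
exact: c1.
Qed.

(** The open unit interval is exhausted by [[xn n, 1 - xn n]], where the fundamental theorem
    applies; [n.+3] makes these intervals nondegenerate from the start. *)
Let xn (n : nat) : R := n.+3%:R^-1.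

Let xn_gt0 n : 0 < xn n. Proof. by rewrite invr_gt0. Qed.

Let xn_lt n : xn n < 1 - xn n.
Proof.
have : xn n <= 3^-1 by rewrite lef_pV2 ?posrE// ler_nat.
lra.
Qed.

Let integral_dom_itv (a : R) n : 0 < a ->
  (\int[mu]_(t in `[xn n, (1 - xn n)%R]) (dom a t)%:E <= (4 / a + 1)%:E)%E.
Proof.
move=> a0; have x0 := xn_gt0 n; have x1 := xn_lt n.
have D01 t : t \in `[xn n, 1 - xn n] -> 0 < t < 1.
  by rewrite in_itv/=; lra.
have dp t : t \in `[xn n, 1 - xn n] -> {for t, continuous (prim a)}.
  move=> /D01 t01; apply/differentiable_continuous/derivable1_diffP.
  by have [] := is_derive_prim a0 t01.
rewrite (@continuous_FTC2 _ (dom a) (prim a))//; last 3 first.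
- apply/continuous_within_itvP => //; split.
  + by move=> t; rewrite in_itv/= => ?; apply: dom_continuous; lra.
  + by apply: cvg_at_right_filter; apply: dom_continuous; lra.
  + by apply: cvg_at_left_filter; apply: dom_continuous; lra.
- split.
  + move=> t; rewrite in_itv/= => ?; have t01 : 0 < t < 1 by lra.
    by have [] := is_derive_prim a0 t01.
  + by apply: cvg_at_right_filter; apply: dp; rewrite in_itv/= lexx ltW.
  + by apply: cvg_at_left_filter; apply: dp; rewrite in_itv/= lexx andbT ltW.
- move=> t; rewrite in_itv/= => ?; have t01 : 0 < t < 1 by lra.
  by rewrite derive1E; have [_ ->] := is_derive_prim a0 t01.
rewrite -EFinB lee_fin /prim.
have -> : 1 - (1 - xn n) = xn n by ring.
set u := (1 - xn n) `^ a; set v := xn n `^ a.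
have v0 : 0 <= v by exact: powR_ge0.
have u1 : u <= 1.
  apply: (@le_trans _ _ (1 `^ a)); last by rewrite powR1.
  by rewrite ge0_ler_powR ?nnegrE ?(ltW a0)//; lra.
have : 2 / a * (2 * (u - v)) <= 2 / a * 2 by rewrite ler_wpM2l ?divr_ge0 ?(ltW a0)//; lra.
have -> : 4 / a = 2 / a * 2 by field; exact: lt0r_neq0.
by lra.
Qed.

Lemma measurable_dom (a : R) : measurable_fun setT (dom a).
Proof.
apply: measurable_funD => //; apply: measurable_funD; apply: measurable_funM => //.
by apply: (measurableT_comp (measurable_powR (a - 1))); exact: measurable_funB.
Qed.

Let integral_dom (a : R) : 0 < a ->
  (\int[mu]_(t in `]0%R, 1%R[) (dom a t)%:E <= (4 / a + 1)%:E)%E.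
Proof.
move=> a0.
have dom0 t : (0 <= (dom a t)%:E)%E.
  by rewrite lee_fin !addr_ge0// mulr_ge0// powR_ge0.
have -> : `]0%R, 1%R[%classic = \bigcup_n `[xn n, 1 - xn n]%classic :> set R.
  apply/seteqP; split => [t /=|t [n _] /=]; rewrite !in_itv/=; last first.
    by have := xn_gt0 n; lra.
  move=> /andP[t0 t1].
  pose e := Num.min t (1 - t).
  have e0 : 0 < e by rewrite lt_min t0 subr_gt0.
  exists (Num.truncn e^-1) => //=; rewrite in_itv/=.
  have xe : xn (Num.truncn e^-1) <= e.
    rewrite -[leRHS]invrK lef_pV2 ?posrE ?invr_gt0//.
    have ei0 : 0 <= e^-1 by rewrite invr_ge0 ltW.
    have /andP[_ h] := truncn_itv ei0.
    by apply: ltW; apply: (lt_trans h); rewrite ltr_nat.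
  by move: xe; rewrite le_min => /andP[]; lra.
have h : (\int[mu]_(t in `[xn i, (1 - xn i)%R]) (dom a t)%:E)%E @[i --> \oo] -->
    (\int[mu]_(t in \bigcup_n `[xn n, (1 - xn n)%R]%classic) (dom a t)%:E)%E.
  apply: ge0_nondecreasing_set_cvg_integral => //.
  - apply/nondecreasing_seqP => n; apply/subsetPset => t /=; rewrite !in_itv/=.
    have : xn n.+1 <= xn n by rewrite lef_pV2 ?posrE// ler_nat.
    by lra.
  - move=> n; apply/measurable_EFinP; apply: measurable_funTS; exact: measurable_dom.
rewrite -(cvg_lim _ h)//; apply: lime_le; first by apply/cvg_ex; eexists; exact: h.
by near=> n; exact: integral_dom_itv.
Unshelve. all: by end_near.
Qed.

Let beta_weight_le_dom (a t : R) : 0 < a -> 0 < t < 1 -> beta_weight a a t <= dom a t.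
Proof.
move=> a0 /andP[t0 t1]; rewrite /beta_weight /dom.
have t1' : 0 < 1 - t by rewrite subr_gt0.
have p1 : 0 <= t `^ (a - 1) by exact: powR_ge0.
have p2 : 0 <= (1 - t) `^ (a - 1) by exact: powR_ge0.
have le1 s : 0 < s <= 1 -> 1 <= a -> s `^ (a - 1) <= 1.
  move=> /andP[s0 s1] a1; apply: (@le_trans _ _ (1 `^ (a - 1))); last by rewrite powR1.
  by rewrite ge0_ler_powR ?nnegrE ?subr_ge0// ltW.
have [a1|a1] := leP 1 a.
  have h1 : t `^ (a - 1) <= 1 by apply: le1 => //; lra.
  have h2 : (1 - t) `^ (a - 1) <= 1 by apply: le1 => //; lra.
  have : t `^ (a - 1) * (1 - t) `^ (a - 1) <= 1 by rewrite mulr_ile1.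
  lra.
(* For [a < 1] one of [t], [1 - t] is at least [1/2], so only the other factor can be large. *)
have le2 s : 2^-1 <= s -> s `^ (a - 1) <= 2.
  move=> s2; have s0 : 0 < s by lra.
  have -> : a - 1 = - (1 - a) by ring.
  rewrite powRN -[leRHS]invrK lef_pV2 ?posrE ?powR_gt0//.
  apply: (@le_trans _ _ (2^-1 `^ (1 - a))).
    rewrite -[leLHS]powRr1//; apply: ger_powR => //; lra.
  by rewrite ge0_ler_powR ?nnegrE ?subr_ge0//; lra.
have [t2|t2] := leP t 2^-1.
  have h : (1 - t) `^ (a - 1) <= 2 by apply: le2; lra.
  have := ler_wpM2l p1 h; lra.
have h : t `^ (a - 1) <= 2 by apply: le2; lra.
have := ler_wpM2r p2 h; lra.
Qed.

Section fixed_parameter.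
Variable a : R.
Hypothesis a_gt0 : 0 < a.

Let nu := with_density (measurable_itv `]0, 1[)
    (measurable_beta_weight a a) (@beta_weight_ge0 R a a).

Let nuT_le : (nu setT <= (4 / a + 1)%:E)%E.
Proof.
apply: le_trans (integral_dom a_gt0); rewrite /nu /with_density setTI.
apply: ge0_le_integral => //.
- by move=> t t01; rewrite lee_fin beta_weight_ge0.
- by apply/measurable_EFinP; exact: measurable_beta_weight.
- by apply/measurable_EFinP; apply: measurable_funTS; exact: measurable_dom.
- by move=> t; rewrite /= in_itv/= lee_fin => t01; exact: beta_weight_le_dom.
Qed.

Let nu_itv_ge (c u v r : R) : 0 < c -> c <= u -> u <= v -> v <= 1 - c ->
  1 <= r -> a <= r -> ((c `^ (2 * r) * (v - u))%:E <= nu `[u, v]%classic)%E.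
Proof.
move=> c0 cu uv vc r1 ar; rewrite /nu /with_density.
(* Since [c <= 1]: for [a >= 1], [c^r <= c^(a-1) <= s^(a-1)]; for [a < 1], [c^r <= 1 <= s^(a-1)]. *)
have le1 s : c <= s <= 1 -> c `^ r <= s `^ (a - 1).
  move=> /andP[cs s1]; have s0 := lt_le_trans c0 cs.
  have c1 := le_trans cs s1.
  have [a1|a1] := leP 1 a.
    apply: (@le_trans _ _ (c `^ (a - 1))).
      by apply: ger_powR; lra.
    by rewrite ge0_ler_powR ?nnegrE ?subr_ge0//; lra.
  apply: (@le_trans _ _ 1).
    rewrite -[leRHS](powRr0 c); apply: ger_powR; lra.
  by rewrite -[leLHS](powRr0 s); apply: ger_powR; lra.
have -> : `[u, v] `&` `]0, 1[ = `[u, v]%classic :> set R.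
  apply/seteqP; split => [t []//|t /=]; rewrite !in_itv/= => tuv; split => //; lra.
apply: (@le_trans _ _ (\int[mu]_(x in `[u, v]) (c `^ (2 * r))%:E)%E).
  by rewrite integral_cst//= lebesgue_measure_itv/= lte_fin; case: ltP => [_|vu];
   rewrite -?EFinB ?EFinM// (_ : v = u) ?subrr ?mulr0 ?mule0//; apply/eqP; rewrite eq_le vu uv.
apply: ge0_le_integral => //.
- by move=> t _; rewrite lee_fin powR_ge0.
- apply/measurable_EFinP; apply: measurable_funS (measurable_beta_weight a a) => //.
  by move=> t /=; rewrite !in_itv/=; lra.
- move=> t; rewrite /= in_itv/= => tuv; rewrite lee_fin /beta_weight.
  have -> : c `^ (2 * r) = c `^ r * c `^ r.
    have -> : 2 * r = r + r by ring.
    by rewrite powRD//; apply/implyP => _; rewrite gt_eqF.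
  by rewrite ler_pM ?powR_ge0// le1//; lra.
Qed.

Let nuT_gt0 : (0 < nu setT)%E.
Proof.
have h : ((4^-1 `^ (2 * Num.max 1 a) * (3 / 4 - 4^-1))%:E <= nu `[(4^-1)%R, (3 / 4)%R]%classic)%E.
  by apply: nu_itv_ge; rewrite ?le_max ?lexx ?orbT//; lra.
have h2 : (nu `[(4^-1)%R, (3 / 4)%R]%classic <= nu setT)%E.
  rewrite /nu; apply: le_measure => //; rewrite inE.
    exact: measurable_itv.
  exact: measurableT.
apply: (lt_le_trans _ (le_trans h h2)).
by rewrite lte_fin mulr_gt0 ?powR_gt0//; lra.
Qed.

Let nuTE : nu setT = (fine (nu setT))%:E.
Proof. by rewrite fineK// ge0_fin_numE ?ltW// (le_lt_trans nuT_le) ?ltry. Qed.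

Let beta_lawE (U : set RM) : beta_law a a U = (nu U * ((fine (nu setT))^-1)%:E)%E.
Proof.
rewrite /beta_law /= /mnormalize -/nu.
have nfin : (nu setT < +oo)%E by rewrite (le_lt_trans nuT_le) ?ltry.
by rewrite (gt_eqF nuT_gt0) (lt_eqF nfin).
Qed.

Lemma beta_law_supp : beta_law a a `]0, 1[%classic = 1%E.
Proof.
rewrite beta_lawE (_ : nu _ = nu setT); last first.
  by rewrite /nu /with_density setIid setTI.
rewrite {1}nuTE -EFinM mulfV// gt_eqF//.
by rewrite -lte_fin -nuTE.
Qed.

(** Polynomial dependence on [c] and on [a] is the point: a parameter as small as a power of [1/n]
    loses only a power of [n]. *)
Lemma beta_law_itv_ge (c u v r : R) : 0 < c -> c <= u -> u <= v -> v <= 1 - c ->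
  1 <= r -> a <= r ->
  ((c `^ (2 * r) * (v - u) / (4 / a + 1))%:E <= beta_law a a `[u, v]%classic)%E.
Proof.
move=> c0 cu uv vc r1 ar; rewrite beta_lawE EFinM.
have f0 : 0 < fine (nu setT) by rewrite -lte_fin -nuTE.
rewrite lee_pmul ?lee_fin ?mulr_ge0 ?powR_ge0 ?subr_ge0 ?invr_ge0 ?addr_ge0 ?divr_ge0 ?(ltW a_gt0)//.
  exact: nu_itv_ge.
by rewrite lef_pV2 ?posrE ?addr_gt0 ?divr_gt0// -lee_fin -nuTE.
Qed.

End fixed_parameter.

Lemma uniform_law_supp (b : R) : 0 <= b -> uniform_law 0 b `[0, b]%classic = 1%E.
Proof.
move=> b0; rewrite /uniform_law; case: pselect => [ab|nab].
  by rewrite /= /uniform_prob integral_uniform_pdf1.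
by rewrite /= diracE mem_set//= in_itv/= lexx.
Qed.

Lemma uniform_law_itv_ge (b u v : R) : 0 <= u -> u <= v -> v <= b -> 0 < b ->
  (((v - u) / b)%:E <= uniform_law 0 b `[u, v]%classic)%E.
Proof.
move=> u0 uv vb b0; rewrite /uniform_law; case: pselect => [ab|//].
rewrite /= /uniform_prob (eq_integral (fun=> (b^-1)%:E)); last first.
  move=> t; rewrite inE/= in_itv/= => /andP[ut tv].
  by rewrite /uniform_pdf subr0 (le_trans u0 ut) (le_trans tv vb).
rewrite integral_cst//= lebesgue_measure_itv/= lte_fin; case: ltP => [_|vu].
  by rewrite -EFinB -EFinM mulrC.
by rewrite mule0 lee_fin (_ : v = u) ?subrr ?mul0r//; apply/eqP; rewrite eq_le vu uv.
Qed.

End beta_law_mass.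

(** * The weights [omega] lie strictly between 0 and 1 *)

Section omega_bounds.
Context (R : realType).
Local Notation mu := (@lebesgue_measure R).
Local Notation RM := (measurableTypeR R).

(** Invariant of the convolution powers of [chi]. Positivity is required locally uniformly in the
    open interval from 0 to [k + 1], so that it passes through the next convolution. *)
Let good (k : nat) (g : R -> R) : Prop :=
  [/\ measurable_fun setT g, (forall x, 0 <= g x <= 1),
      (\int[mu]_x (g x)%:E <= 1)%E &
      forall a b, 0 < a -> a <= b -> b < k.+1%:R ->
        exists2 c, 0 < c & forall x, a <= x <= b -> c <= g x].

Let chiE (x : R) : chi x = (0 <= x <= 1)%R%:R.
Proof. by rewrite /chi indicE; congr (nat_of_bool _)%:R; apply/idP/idP; rewrite inE/= in_itv. Qed.

Let measurable_chi : measurable_fun setT (@chi R).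
Proof. by apply: measurable_indic; exact: measurable_itv. Qed.

Let chi_shift (x : R) : (fun t => chi (x - t)) = \1_(`[x - 1, x]%classic) :> (R -> R).
Proof.
apply/funext => t; rewrite chiE indicE; congr (nat_of_bool _)%:R.
by apply/idP/idP; rewrite inE/= in_itv/=; lra.
Qed.

Let chi_shift' (t : R) : (fun x => chi (x - t)) = \1_(`[t, t + 1]%classic) :> (R -> R).
Proof.
apply/funext => x; rewrite chiE indicE; congr (nat_of_bool _)%:R.
by apply/idP/idP; rewrite inE/= in_itv/=; lra.
Qed.

Let good0 : good 0 (@chi R).
Proof.
split.
- exact: measurable_chi.
- by move=> x; rewrite chiE; case: (0 <= x <= 1); rewrite ?lexx ?ler01.
- rewrite /chi integral_indic//= setIT lebesgue_measure_itv/= lte_fin ltr01.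
  by rewrite sube0.
- move=> a b a0 ab b1; exists 1 => // x /andP[ax xb].
  by rewrite chiE (le_trans (ltW a0) ax) (le_trans xb (ltW b1)).
Qed.

Let goodS k g : good k g -> good k.+1 (convolution (@chi R) g).
Proof.
move=> [mg g01 gint glow].
have g0 x : 0 <= g x by have /andP[] := g01 x.
pose F (z : RM * RM) : \bar R := (chi (z.1 - z.2) * g z.2)%:E.
have mF : measurable_fun setT F.
  apply/measurable_EFinP; apply: measurable_funM.
    apply: (measurableT_comp measurable_chi).
    by apply: measurable_funB; [exact: measurable_fst|exact: measurable_snd].
  by apply: (measurableT_comp mg); exact: measurable_snd.
have chi0 x : 0 <= chi x :> R by rewrite chiE.
have F0 z : (0 <= F z)%E by rewrite lee_fin mulr_ge0.
pose J x : \bar R := (\int[mu]_t F (x, t))%E.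
have J0 x : (0 <= J x)%E by apply: integral_ge0.
have J1 x : (J x <= 1)%E.
  apply: (@le_trans _ _ (\int[mu]_t (\1_(`[x - 1, x]%classic : set R) t)%:E)%E).
    apply: ge0_le_integral_nomeas => // t.
    rewrite /F/= -chi_shift lee_fin ler_piMr//; have /andP[]// := g01 t.
  rewrite integral_indic//= setIT lebesgue_measure_itv/= lte_fin.
  by rewrite ltrBlDr ltrDl ltr01 -EFinB lee_fin; lra.
have JE x : J x = (convolution (@chi R) g x)%:E.
  have Jf : J x \is a fin_num by rewrite ge0_fin_numE// (le_lt_trans (J1 x))// ltry.
  by rewrite -[LHS]fineK.
have mJ : measurable_fun setT J.
  exact: (@measurable_fun_fubini_tonelli_F _ _ RM RM R mu F mF).
split.
- apply/measurable_EFinP; rewrite (_ : EFin \o _ = J)//.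
  by apply/funext => x; rewrite /= JE.
- by move=> x; rewrite -!lee_fin -JE J0 J1.
- rewrite -(eq_integral _ _ (fun x _ => JE x)) /J.
  rewrite (@fubini_tonelli _ _ RM RM R mu mu F mF F0)//.
  apply: le_trans gint; apply: ge0_le_integral_nomeas => t; first exact: integral_ge0.
  rewrite /F/=; under eq_integral do rewrite EFinM muleC.
  rewrite ge0_integralZl ?lee_fin//; last 2 first.
  - by apply/measurable_EFinP; rewrite chi_shift'; exact: measurable_indic.
  - by move=> x _; rewrite lee_fin.
  have E x : chi (x - t) = \1_(`[t, t + 1]%classic) x :> R by rewrite -chi_shift'.
  under eq_integral do rewrite E.
  rewrite integral_indic//= setIT lebesgue_measure_itv/= lte_fin ltrDl ltr01.
  by rewrite -EFinB addrC addKr mule1.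
- move=> a b a0 ab bk.
  (* A third of every available gap: for [x] in [[a, b]], the window [[x - 1, x]] then meets
     [[e, k + 1 - e]], where [g >= c], in length at least [e]. *)
  pose e := Num.min a (Num.min (k.+2%:R - b) 1) / 3.
  have e0 : 0 < e by rewrite divr_gt0// !lt_min a0 subr_gt0 bk ltr01.
  have : 3 * e <= Num.min a (Num.min (k.+2%:R - b) 1) by rewrite /e mulrC divfK.
  rewrite !le_min => /andP[ea /andP[eb e1]].
  have kk : 1 <= k.+1%:R :> R by rewrite ler1n.
  have k2 : k.+2%:R = k.+1%:R + 1 :> R by rewrite natr1.
  have [||c c0 gc] := glow e (k.+1%:R - e) e0; [lra|lra|].
  exists (c * e); first by rewrite mulr_gt0.
  move=> x /andP[ax xb]; rewrite -lee_fin -JE /J.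
  pose l := Num.max e (x - 1); pose u := Num.min x (k.+1%:R - e).
  have le_l : e <= l by rewrite le_max lexx.
  have x1_l : x - 1 <= l by rewrite le_max lexx orbT.
  have ux : u <= x by rewrite ge_min lexx.
  have uk : u <= k.+1%:R - e by rewrite ge_min lexx orbT.
  have lu : l + e <= u.
    by rewrite -lerBrDr ge_max !lerBrDr !le_min; apply/andP; split; apply/andP; split; lra.
  have : (c%:E * mu `[l, u]%classic <= \int[mu]_t F (x, t))%E.
    apply: ge0_le_integral_indic => //; first exact: ltW.
    move=> t; rewrite /= in_itv/= => tlu; rewrite lee_fin /= chiE.
    have t1 : e <= t <= k.+1%:R - e by lra.
    have -> : (0 <= x - t <= 1) = true by lra.
    by rewrite mul1r gc.
  apply: le_trans.
  rewrite lebesgue_measure_itv/= lte_fin (_ : (l < u) = true); last by lra.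
  by rewrite -EFinB -EFinM lee_fin ler_pM2l//; lra.
Qed.

Let conv_good k : good k (@conv_chi R k).
Proof. by elim: k => [|k IH]; [exact: good0|exact: goodS]. Qed.

Variables (m j : nat).
Hypothesis j_gt0 : (0 < j)%N.
Hypothesis jm : (j <= m)%N.

Let omegaE : (\int[mu]_(t in `[0%R, j%:R]) (conv_chi m t)%:E = (omega R m j)%:E)%E.
Proof.
have [mg g01 gint glow] := conv_good m.
rewrite /omega /Rintegral fineK// ge0_fin_numE; last first.
  by apply: integral_ge0 => t _; rewrite lee_fin; have /andP[] := g01 t.
apply: le_lt_trans (ltry 1); apply: le_trans gint.
apply: ge0_subset_integral => //; first exact/measurable_EFinP.
by move=> t _; rewrite lee_fin; have /andP[] := g01 t.
Qed.

Lemma omega_gt0 : 0 < omega R m j.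
Proof.
have [mg g01 gint glow] := conv_good m.
have g0 t : 0 <= conv_chi m t :> R by have /andP[] := g01 t.
have j1 : 1 <= j%:R :> R by rewrite ler1n.
have m1 : 1 <= m.+1%:R :> R by rewrite ler1n.
have [|||c c0 gc] := glow 4^-1 (3 / 4); [lra|lra|lra|].
rewrite -lte_fin -omegaE integral_mkcond.
have : (c%:E * mu `[(4^-1)%R, (3 / 4)%R]%classic <=
    \int[mu]_t ((EFin \o conv_chi m) \_ (`[0%R, (j%:R)%R]%classic : set R)) t)%E.
  apply: ge0_le_integral_indic => //; first exact: ltW.
    by move=> t; apply: erestrict_ge0 => s _; rewrite lee_fin.
  move=> t; rewrite /= in_itv/= => t01; rewrite patchE mem_set/=.
    by rewrite lee_fin gc.
  by rewrite in_itv/=; lra.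
apply: lt_le_trans.
rewrite lebesgue_measure_itv/= lte_fin (_ : (4^-1 < _) = true); last by lra.
by rewrite -EFinB -EFinM lte_fin mulr_gt0//; lra.
Qed.

(** The density is bounded below on [[j + 1/4, j + 3/4]], inside its support because [j <= m] and
    disjoint from [[0, j]], while its total mass is at most 1. *)
Lemma omega_lt1 : omega R m j < 1.
Proof.
have [mg g01 gint glow] := conv_good m.
have g0 t : 0 <= conv_chi m t :> R by have /andP[] := g01 t.
have jm' : j%:R + 1 <= m.+1%:R :> R by rewrite natr1 ler_nat.
have j0 : 0 <= j%:R :> R by [].
have [|||c c0 gc] := glow (j%:R + 4^-1) (j%:R + 3 / 4); [lra|lra|lra|].
pose A : set RM := `[0, j%:R]%classic.
have mA : measurable A by exact: measurable_itv.
have : ((omega R m j)%:E + (c / 2)%:E <= 1)%E.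
  apply: le_trans gint; rewrite -omegaE.
  rewrite -(setvU A) ge0_integral_setU//=; last 4 first.
  - exact: measurableC.
  - by apply/measurable_EFinP; exact: measurable_funTS.
  - by move=> t _; rewrite lee_fin.
  - by rewrite disj_set2E setICl.
  rewrite addeC leeD2r// integral_mkcond.
  have : (c%:E * mu `[(j%:R + 4^-1)%R, (j%:R + 3 / 4)%R]%classic <=
      \int[mu]_t ((EFin \o conv_chi m) \_ (~` A)) t)%E.
    apply: ge0_le_integral_indic => //; first exact: ltW.
      by move=> t; apply: erestrict_ge0 => s _; rewrite lee_fin.
    move=> t; rewrite /= in_itv/= => t01; rewrite patchE mem_set/=.
      by rewrite lee_fin gc.
    by rewrite /A/= in_itv/=; lra.
  apply: le_trans.
  rewrite lebesgue_measure_itv/= lte_fin (_ : (_ + 4^-1 < _) = true); last by lra.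
  by rewrite -EFinB -EFinM lee_fin; lra.
by rewrite -EFinD lee_fin; lra.
Qed.

End omega_bounds.

(** * The tree: coding of dyadic intervals and target splits *)

Section dyadic_tree.

Lemma kappaS L i : kappa L.+1 i = rcons (kappa L (i %/ 2)) (odd i).
Proof.
have E : iota 1 L.+1 = rcons (iota 1 L) L.+1 by rewrite -{1}(addn1 L) iotaD cats1 add1n.
rewrite /kappa E map_rcons subnn expn0 divn1.
congr rcons; apply/eq_in_map => j; rewrite mem_iota => /andP[j1 jL].
by rewrite subSn ?expnS ?divnMA//; lia.
Qed.

Lemma size_kappa L i : size (kappa L i) = L.
Proof. by rewrite size_map size_iota. Qed.

Lemma kappa_surj L (b : seq bool) : size b = L ->
  exists2 i, (i < 2 ^ L)%N & kappa L i = b.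
Proof.
elim: L b => [|L IH] b bL.
  by exists 0%N => //; move/size0nil: bL => ->.
case/lastP: b bL => // b x; rewrite size_rcons => -[/IH[i iL <-]].
exists (2 * i + x)%N; first by rewrite expnS; case: x; lia.
rewrite kappaS; congr rcons; last by rewrite oddD mul2n odd_double; case: x.
by congr kappa; rewrite mulnC divnMDl// divn_small ?addn0//; case: x.
Qed.

Lemma kappa_inj L i j : (i < 2 ^ L)%N -> (j < 2 ^ L)%N ->
  kappa L i = kappa L j -> i = j.
Proof.
elim: L i j => [|L IH] i j; first by rewrite expn0; lia.
rewrite expnS => iL jL; rewrite !kappaS => /eqP; rewrite eqseq_rcons => /andP[/eqP k /eqP o].
have := IH (i %/ 2)%N (j %/ 2)%N _ _ k.
rewrite !ltn_divLR// !(mulnC _ 2%N) => /(_ iL jL) e.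
by rewrite (divn_eq i 2) (divn_eq j 2) e !modn2 o.
Qed.

Lemma mem_nodes L (k : seq bool) : (k \in nodes L) = (size k < L)%N.
Proof.
apply/flatten_mapP/idP => [[n]|kL].
  by rewrite mem_iota add0n => /andP[_ nL] /mapP[t _ ->]; rewrite size_tuple.
exists (size k); first by rewrite mem_iota.
by apply/mapP; exists (in_tuple k) => //; rewrite mem_enum.
Qed.

Lemma size_nodes L : (size (nodes L) <= 2 ^ L)%N.
Proof.
rewrite size_flatten /shape -map_comp (@eq_map _ _ _ (fun k => 2 ^ k)%N); last first.
  by move=> k /=; rewrite size_map -cardE card_tuple card_bool.
suff : (sumn [seq (2 ^ k)%N | k <- iota 0 L] < 2 ^ L)%N by exact: ltnW.
elim: L => // L IH.
have E : iota 0 L.+1 = rcons (iota 0 L) L by rewrite -(addn1 L) iotaD cats1 add0n.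
rewrite E map_rcons sumn_rcons expnS.
by move: IH; lia.
Qed.

Context (R : realType).
Local Notation RM := (measurableTypeR R).
Variable L : nat.
Local Notation splits := ((size (nodes L)).-tuple RM).
Implicit Type y : splits.

Definition node_value y (k : seq bool) : R := nth 0 y (index k (nodes L)).

Lemma split_var_rcons y k b : split_var y (rcons k b) =
  if b then 1 - node_value y k else node_value y k.
Proof. by rewrite /split_var last_rcons size_rcons/= -cats1 take_size_cat. Qed.

Lemma node_valueE y k : (size k < L)%N -> exists2 i : 'I_(size (nodes L)),
  node_value y k = tnth y i & nth [::] (nodes L) i = k.
Proof.
move=> kL; have ki : (index k (nodes L) < size (nodes L))%N by rewrite index_mem mem_nodes.
exists (Ordinal ki); first by rewrite (tnth_nth 0).
by rewrite nth_index// mem_nodes.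
Qed.

Definition unit_box : set splits := box (fun=> `]0, 1[%classic).

Lemma node_value01 y k : unit_box y -> (size k < L)%N -> 0 < node_value y k < 1.
Proof.
move=> yU kL; have [i -> _] := node_valueE y kL.
by have := yU i; rewrite /= in_itv.
Qed.

Lemma split_var01 y (k : seq bool) : unit_box y -> (0 < size k <= L)%N ->
  0 < split_var y k < 1.
Proof.
move=> yU; case/lastP: k => // k b; rewrite size_rcons/= => kL.
rewrite split_var_rcons; have := node_value01 yU kL.
by case: b; lra.
Qed.

Lemma Theta01 y i : unit_box y -> 0 < Theta y i <= 1.
Proof.
move=> yU; rewrite /Theta big_nat.
have s01 j : (0 < j < L.+1)%N -> 0 < split_var y (take j (kappa L i)) < 1.
  move=> jL; apply: split_var01 => //; rewrite size_take size_kappa.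
  by case: ifP; lia.
apply/andP; split.
  by apply: prodr_gt0 => j /s01/andP[].
by apply: prodr_ile1 => j /s01/andP[h1 h2]; rewrite ltW//= ltW.
Qed.

(** Descend from the root, always taking a child whose split variable is at least [1/2]. *)
Lemma Theta_ge_pow2 y : unit_box y ->
  exists2 i, (i < 2 ^ L)%N & (2 ^ L)%:R^-1 <= Theta y i.
Proof.
move=> yU.
suff H n : (n <= L)%N -> exists2 b : seq bool, size b = n &
    (2 ^ n)%:R^-1 <= \prod_(1 <= j < n.+1) split_var y (take j b).
  have [b bL Hb] := H L (leqnn L); have [i iL ki] := kappa_surj bL.
  by exists i => //; rewrite /Theta ki.
elim: n => [_|n IH nL].
  by exists [::]; rewrite // big_geq// expn0 invr1.
have [b bn Hb] := IH (ltnW nL).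
have [c Hc] : exists c, 2^-1 <= split_var y (rcons b c).
  have [h|h] := leP 2^-1 (node_value y b).
    by exists false; rewrite split_var_rcons.
  by exists true; rewrite split_var_rcons; lra.
exists (rcons b c); first by rewrite size_rcons bn.
rewrite big_nat_recr//= take_oversize ?size_rcons ?bn//.
rewrite expnS mulnC natrM invfM ler_pM ?invr_ge0//.
apply: (le_trans Hb); rewrite le_eqVlt; apply/orP; left; apply/eqP.
apply: eq_big_nat => j /andP[j1 jn]; congr split_var.
by rewrite -cats1 takel_cat// bn.
Qed.

Section target.
Variables (T : nat -> R) (tau : R).
Hypothesis tau_gt0 : 0 < tau.
Hypothesis T_ge : forall i, (i < 2 ^ L)%N -> tau <= T i.
Hypothesis T_sum : \sum_(i < 2 ^ L) T i = 1.

Definition prefix_mass (k : seq bool) : R :=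
  \sum_(i < 2 ^ L | take (size k) (kappa L i) == k) T i.

Lemma prefix_mass_ge k : (size k <= L)%N -> tau <= prefix_mass k.
Proof.
move=> kL.
have [i iL ki] : exists2 i, (i < 2 ^ L)%N & take (size k) (kappa L i) = k.
  have [|i iL ki] := @kappa_surj L (k ++ nseq (L - size k) false).
    by rewrite size_cat size_nseq subnKC.
  by exists i => //; rewrite ki take_size_cat.
rewrite /prefix_mass (bigD1 (Ordinal iL))/=; last exact/eqP.
rewrite ler_wpDr ?T_ge// sumr_ge0// => j _.
by rewrite (le_trans (ltW tau_gt0))// T_ge.
Qed.

Lemma prefix_mass_le1 k : prefix_mass k <= 1.
Proof.
rewrite -T_sum /prefix_mass [leRHS](bigID (fun i : 'I__ => take (size k) (kappa L i) == k))/=.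
by rewrite lerDl sumr_ge0// => j _; rewrite (le_trans (ltW tau_gt0))// T_ge.
Qed.

Lemma prefix_massD k : (size k < L)%N ->
  prefix_mass k = prefix_mass (rcons k false) + prefix_mass (rcons k true).
Proof.
move=> kL; rewrite /prefix_mass !size_rcons.
have E (i : 'I_(2 ^ L)) b : (take (size k).+1 (kappa L i) == rcons k b) =
    (take (size k) (kappa L i) == k) && (nth false (kappa L i) (size k) == b).
  by rewrite (take_nth false) ?size_kappa// eqseq_rcons.
rewrite (bigID (fun i : 'I__ => nth false (kappa L i) (size k) == false))/=.
congr (_ + _); apply: eq_bigl => i; rewrite E//.
by congr (_ && _); case: nth.
Qed.

(** Conditional target mass of the left child. With these values of the split variables, [Theta]
    would equal [T] exactly. *)
Definition target_split (k : seq bool) : R :=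
  prefix_mass (rcons k false) / prefix_mass k.

Lemma prefix_mass_gt0 k : (size k <= L)%N -> 0 < prefix_mass k.
Proof. by move=> /prefix_mass_ge; apply: lt_le_trans. Qed.

Lemma target_split_ge k : (size k < L)%N ->
  tau <= target_split k /\ tau <= 1 - target_split k.
Proof.
move=> kL; have k0 := prefix_mass_gt0 (ltnW kL).
have h b : tau <= prefix_mass (rcons k b) / prefix_mass k.
  have h1 : tau <= prefix_mass (rcons k b) by apply: prefix_mass_ge; rewrite size_rcons.
  rewrite ler_pdivlMr// (le_trans _ h1)// ler_piMr ?(ltW tau_gt0)//.
  exact: prefix_mass_le1.
split; first exact: h.
have -> : 1 - target_split k = prefix_mass (rcons k true) / prefix_mass k; last exact: h.
by rewrite /target_split -{1}(divff (lt0r_neq0 k0)) -mulrBl prefix_massD// addrC addKr.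
Qed.

Lemma prod_prefix_mass i n : (n <= L)%N -> (i < 2 ^ L)%N ->
  \prod_(1 <= j < n.+1) (prefix_mass (take j (kappa L i)) / prefix_mass (take j.-1 (kappa L i)))
  = prefix_mass (take n (kappa L i)).
Proof.
move=> nL iL; elim: n nL => [_|n IH nL].
  rewrite big_geq// take0 /prefix_mass /= -T_sum; apply: eq_bigl => j.
  by rewrite take0 eqxx.
rewrite big_nat_recr//= IH ?(ltnW nL)// mulrCA divff ?mulr1//.
by rewrite lt0r_neq0// prefix_mass_gt0// size_take size_kappa; case: ifP; lia.
Qed.

Lemma prefix_mass_full i : (i < 2 ^ L)%N -> prefix_mass (kappa L i) = T i.
Proof.
move=> iL; rewrite /prefix_mass size_kappa (bigD1 (Ordinal iL)) ?take_oversize ?size_kappa//=.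
rewrite big1 ?addr0// => j /andP[/eqP + ji].
rewrite take_oversize ?size_kappa// => /kappa_inj e.
by case/negP: ji; rewrite -val_eqE/= e.
Qed.

(** An absolute error [eta * tau] is a relative error at most [eta] both for a split and for its
    complement, as both targets are at least [tau]. *)
Definition target_box (eta : R) : set splits :=
  box (fun i => let c := target_split (nth [::] (nodes L) i) in
    `[c - eta * tau, c + eta * tau]%classic).

(** [T i] is the telescoping product of conditional masses along its branch, and each of the [L]
    factors has relative error at most [eta]. *)
Lemma Theta_near y (eta : R) i : 0 <= eta <= 1 -> target_box eta y -> (i < 2 ^ L)%N ->
  (1 - eta) ^+ L * T i <= Theta y i <= (1 + eta) ^+ L * T i.
Proof.
move=> /andP[eta0 eta1] yT iL.
pose s j := prefix_mass (take j (kappa L i)) / prefix_mass (take j.-1 (kappa L i)).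
have TE : T i = \prod_(1 <= j < L.+1) s j.
  rewrite /s (prod_prefix_mass (leqnn L) iL) -(prefix_mass_full iL).
  by rewrite take_oversize ?size_kappa.
have main j : (1 <= j < L.+1)%N -> 0 < s j /\
    (1 - eta) * s j <= split_var y (take j (kappa L i)) <= (1 + eta) * s j.
  move=> /andP[j1 jL]; case: j j1 jL => // j _ jL.
  have kj : (size (take j (kappa L i)) < L)%N by rewrite size_take size_kappa; case: ifP; lia.
  rewrite /s/= (take_nth false) ?size_kappa//.
  set k := take j _ in kj *; set b := nth _ _ _.
  rewrite split_var_rcons.
  have [l yl kl] := node_valueE y kj; have := yT l; rewrite /= in_itv/= kl -yl.
  have [h1 h2] := target_split_ge kj.
  set c := target_split k in h1 h2 *; set v := node_value y k => vc.
  have sE : prefix_mass (rcons k b) / prefix_mass k = if b then 1 - c else c.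
    have k0 := prefix_mass_gt0 (ltnW kj).
    case: (b) => //; rewrite /c /target_split -[X in X - _](divff (lt0r_neq0 k0)) -mulrBl.
    by rewrite [in X in X - _]prefix_massD// addrC addKr.
  rewrite sE; have e1 : eta * tau <= eta * c by rewrite ler_wpM2l.
  have e2 : eta * tau <= eta * (1 - c) by rewrite ler_wpM2l.
  split; first by case: (b); exact: lt_le_trans tau_gt0 _.
  by case: (b); rewrite mulrBl mulrDl !mul1r; lra.
rewrite /Theta.
have prodc (c : R) : c ^+ L = \prod_(1 <= j < L.+1) c by rewrite prodr_const_nat subn1.
rewrite TE !prodc -!big_split/= !big_nat.
apply/andP; split; apply: ler_prod => j /main[s0 /andP[h1 h2]].
  by rewrite h1 andbT mulr_ge0 ?subr_ge0// ltW.
by rewrite h2 andbT (le_trans _ h1)// mulr_ge0 ?subr_ge0// ltW.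
Qed.

End target.
End dyadic_tree.

(** * The prior as a law on spline coefficients *)

Section prior.
Context (R : realType).
Local Notation RM := (measurableTypeR R).
Variables (m L q : nat) (a : nat -> R) (U w0 : R).
Local Notation splits := ((size (nodes L)).-tuple RM).
Local Notation N := (2 ^ L)%N.
Hypothesis mL : (m <= 2 ^ L)%N.
Hypothesis w0_gt0 : 0 < w0.
Hypothesis w0_le1 : w0 <= 1.
Hypothesis omega_w0 : forall j, (0 < j <= m)%N -> w0 <= omega R m j <= 1 - w0.
Hypothesis U_large : 1 <= w0 * U.
Hypothesis a_gt0 : forall l, (0 < l <= L)%N -> 0 < a l.
Implicit Types (y : splits) (v : m.-tuple RM).

Let mid_arith (j : 'I_m) : [/\ (N - m + j < N - m)%N = false, (N - m + j < N)%N,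
  (N + j < N + m)%N, (N - (N - m + j) = m - j)%N & (N - m + j + m = N + j)%N].
Proof. by have := ltn_ord j; split; lia. Qed.

Let mid_index i : (N - m <= i)%N -> (i < N)%N -> exists j : 'I_m, i = (N - m + j)%N.
Proof.
move=> i1 i2; have jm : (i - (N - m) < m)%N by lia.
by exists (Ordinal jm); rewrite /= subnKC.
Qed.

Let lo_index i : (i < N - m)%N -> (i < N)%N.
Proof. lia. Qed.

Let lt_Nm i : (i < N)%N -> (i < N + m)%N.
Proof. lia. Qed.

Definition boundary_max y (j : 'I_m) : R := Theta y (N - m + j) / omega R m (m - j).

Definition boundary_box y : set (m.-tuple RM) := box (fun j => `[0, boundary_max y j]%classic).

Let w_ord (j : 'I_m) : w0 <= omega R m (m - j) <= 1 - w0.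
Proof. by apply: omega_w0; have := ltn_ord j; lia. Qed.

Lemma boundary_max_ge0 y j : unit_box y -> 0 <= boundary_max y j.
Proof.
move=> yU; have /andP[w1 w2] := w_ord j.
by have /andP[t0 _] := Theta01 (N - m + j) yU; rewrite divr_ge0 ?(ltW t0)// (le_trans (ltW w0_gt0)).
Qed.

(** Once [w0 * U >= 1], both truncations by [U] are inactive, because [Theta <= 1] and [omega] stays
    at distance [w0] from 0 and 1. *)
Lemma boundary_lawE y : unit_box y ->
  boundary_law m U y = prod_prob (fun j => uniform_law 0 (boundary_max y j)).
Proof.
move=> yU; rewrite /boundary_law; congr prod_prob; apply/funext => j.
have -> : (N - (N - m + j) = m - j)%N by have := ltn_ord j; lia.
have /andP[w1 w2] := w_ord j.
have /andP[t0 t1] := Theta01 (N - m + j) yU.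
set w := omega R m (m - j) in w1 w2 *; set t := Theta _ _ in t0 t1 *.
have w_gt0 : 0 < w by exact: lt_le_trans w1.
have U0 : 0 <= U.
  by rewrite -(pmulr_rge0 _ w0_gt0) (le_trans _ U_large).
congr uniform_law.
  apply/max_idPl; rewrite pmulr_lle0 ?invr_gt0// subr_le0 (le_trans t1)//.
  by rewrite (le_trans U_large)// ler_wpM2r//; lra.
apply/min_idPr; rewrite /boundary_max -/w -/t ler_pdivrMr// (le_trans t1)//.
by rewrite mulrC (le_trans U_large)// ler_wpM2r.
Qed.

Lemma theta_lo y v k : (k < N - m)%N -> theta y v k = Theta y k.
Proof. by rewrite /theta => ->. Qed.

Lemma theta_mid y v (j : 'I_m) : theta y v (N - m + j) = tnth v j.
Proof.
rewrite /theta ifF; last by lia.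
rewrite ifT; last by have := ltn_ord j; lia.
by rewrite addKn (tnth_nth 0).
Qed.

Lemma theta_hi y v (j : 'I_m) : theta y v (N + j) =
  (Theta y (N - m + j) - omega R m (m - j) * tnth v j) / (1 - omega R m (m - j)).
Proof.
rewrite /theta ifF; last by lia.
rewrite ifF; last by lia.
have -> : (N + j - m = N - m + j)%N by lia.
have -> : (N + m - (N + j) = m - j)%N by lia.
by rewrite addKn (tnth_nth 0).
Qed.

Lemma theta_cases (P : nat -> Prop) :
  (forall k, (k < N - m)%N -> P k) ->
  (forall j : 'I_m, P (N - m + j)%N) ->
  (forall j : 'I_m, P (N + j)%N) -> forall k, (k < N + m)%N -> P k.
Proof.
move=> h1 h2 h3 k kN; have [k1|k1] := ltnP k (N - m); first exact: h1.
have [k2|k2] := ltnP k N.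
  have jm : (k - (N - m) < m)%N by lia.
  by have := h2 (Ordinal jm); rewrite /= subnKC.
have jm : (k - N < m)%N by lia.
by have := h3 (Ordinal jm); rewrite /= subnKC.
Qed.

Lemma theta_bounds y v : unit_box y -> boundary_box y v ->
  forall k, (k < N + m)%N -> 0 <= theta y v k <= w0^-1.
Proof.
move=> yU vB; have w00 := w0_gt0; have wi0 : 0 < w0^-1 by rewrite invr_gt0.
have wi1 (t w : R) : 0 <= t <= 1 -> w0 <= w -> t / w <= w0^-1.
  move=> /andP[t0 t1] ww; have w_gt0 := lt_le_trans w0_gt0 ww.
  rewrite ler_pdivrMr// (le_trans t1)// mulrC ler_pdivlMr// mul1r//.
have V j : 0 <= tnth v j <= boundary_max y j by have := vB j; rewrite /= in_itv.
apply: theta_cases => [k kN|j|j].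
- rewrite theta_lo//; have /andP[t0 t1] := Theta01 k yU; rewrite (ltW t0)/= (le_trans t1)//.


  by rewrite -[leLHS]invr1 lef_pV2 ?posrE.
- rewrite theta_mid; have /andP[v0 v1] := V j; rewrite v0/= (le_trans v1)// wi1//.
    by have /andP[t0 t1] := Theta01 (N - m + j) yU; rewrite (ltW t0).
  by have /andP[] := w_ord j.
- rewrite theta_hi; have /andP[v0 v1] := V j; have /andP[w1 w2] := w_ord j.
  have /andP[t0 t1] := Theta01 (N - m + j) yU.
  rewrite /boundary_max in v1.
  set w := omega R m (m - j) in v1 w1 w2 *; set t := Theta _ _ in v1 t0 t1 *.
  have w_gt0 : 0 < w by exact: lt_le_trans w1.
  have wv : w * tnth v j <= t by rewrite mulrC -ler_pdivlMr.
  have wv0 : 0 <= w * tnth v j by rewrite mulr_ge0// ltW.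
  have w1' : 0 < 1 - w by lra.
  apply/andP; split; first by rewrite divr_ge0 ?(ltW w1')// subr_ge0.
  apply: wi1; last by lra.
  by lra.
Qed.

(** A tree weight of size at least [1/N] either is a coefficient or is the convex combination [omega
    * theta_i + (1 - omega) * theta_(i+m)], one term of which is then at least [1/N]. *)
Lemma theta_ge_pow2 y v : unit_box y ->
  exists2 k, (k < N + m)%N & N%:R^-1 <= theta y v k.
Proof.
move=> yU; have [i iN ti] := Theta_ge_pow2 yU.
have [iN'|iN'] := ltnP i (N - m).
  by exists i; rewrite ?theta_lo//; lia.
have jm : (i - (N - m) < m)%N by lia.
pose j := Ordinal jm; have ij : (i = N - m + j)%N by rewrite /= subnKC.
have /andP[w1 w2] := w_ord j.
have [h|h] := leP N%:R^-1 (theta y v (N - m + j)).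
  by exists (N - m + j)%N; rewrite ?h//; have := ltn_ord j; lia.
exists (N + j)%N; first by have := ltn_ord j; lia.
move: h; rewrite theta_mid theta_hi -ij.
set w := omega R m (m - j) in w1 w2 *; move=> h; have w00 := w0_gt0.
have w_gt0 : 0 < w by exact: lt_le_trans w1.
have w1' : 0 < 1 - w by lra.
rewrite ler_pdivlMr// mulrBr mulr1.
have : w * tnth v j <= w * N%:R^-1 by rewrite ler_wpM2l// ltW.
lra.
Qed.

Lemma splits_law_unit_box : splits_law L a (~` @unit_box R L) = 0%E.
Proof.
apply: prod_prob_boxC => // i; apply: beta_law_supp; apply: a_gt0.
have : nth [::] (nodes L) i \in nodes L by exact: mem_nth.
by rewrite mem_nodes.
Qed.

Lemma boundary_law_box y : unit_box y -> boundary_law m U y (~` boundary_box y) = 0%E.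
Proof.
move=> yU; rewrite boundary_lawE//; apply: prod_prob_boxC => // j.
by apply: uniform_law_supp; exact: boundary_max_ge0.
Qed.

Let measurable_unit_box : measurable (@unit_box R L).
Proof. by apply: measurable_box => i; exact: measurable_itv. Qed.

Let measurable_boundary_box y : measurable (boundary_box y).
Proof. by apply: measurable_box => i; exact: measurable_itv. Qed.

(** The parameters left out form null sets, and on these boxes the bounds on the coefficients hold
    everywhere, so [E] can be estimated pointwise. *)
Definition DPA_support : set (R -> R) := [set f | exists y v,
  [/\ unit_box y, boundary_box y v & f = DPA_density q y v]].

Local Notation E := (DPA_expectation m L q a U).

Let E_restrict (Phi : (R -> R) -> \bar R) : E Phi =
  (\int[splits_law L a]_y (((fun y => \int[boundary_law m U y]_v
     ((fun v => Phi (DPA_density q y v)) \_ (boundary_box y)) v) \_ (@unit_box R L)) y))%E.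
Proof.
rewrite /DPA_expectation (integral_restrict_ae _ measurable_unit_box); last first.
  exact: splits_law_unit_box.
rewrite integral_mkcond; apply: eq_integral => y _; rewrite !patchE.
case: ifPn => //; rewrite inE => yU.
rewrite (integral_restrict_ae _ (measurable_boundary_box y)); last exact: boundary_law_box.
by rewrite integral_mkcond.
Qed.

Let inner_ge0 (Phi : (R -> R) -> \bar R) y :
  (forall f, DPA_support f -> 0 <= Phi f)%E -> unit_box y ->
  forall v, (0 <= ((fun v => Phi (DPA_density q y v)) \_ (boundary_box y)) v)%E.
Proof.
by move=> Phi0 yU v; apply: erestrict_ge0 => w wB; apply: Phi0; exists y, w.
Qed.

Lemma DPA_expectation_le (Phi Psi : (R -> R) -> \bar R) :
  (forall f, DPA_support f -> 0 <= Phi f <= Psi f)%E -> (0 <= E Phi <= E Psi)%E.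
Proof.
move=> H.
have Phi0 f : DPA_support f -> (0 <= Phi f)%E by move=> /H/andP[].
have outer0 y : (0 <= ((fun y => \int[boundary_law m U y]_v
     ((fun v => Phi (DPA_density q y v)) \_ (boundary_box y)) v) \_ (@unit_box R L)) y)%E.
  by apply: erestrict_ge0 => z zU; apply: integral_ge0 => v _; exact: inner_ge0.
rewrite !E_restrict; apply/andP; split; first exact: integral_ge0.
apply: ge0_le_integral_nomeas => // y; rewrite !patchE; case: ifPn => //; rewrite inE => yU.
apply: ge0_le_integral_nomeas => v; first exact: inner_ge0.
rewrite !patchE; case: ifPn => //; rewrite inE => vB.
by have /andP[] : (0 <= Phi (DPA_density q y v) <= Psi (DPA_density q y v))%E by apply: H; exists y, v.
Qed.

Lemma DPA_expectation_le_cst (Phi : (R -> R) -> \bar R) (c : R) : 0 <= c ->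
  (forall f, DPA_support f -> 0 <= Phi f <= c%:E)%E -> (E Phi <= c%:E)%E.
Proof.
move=> c0 /DPA_expectation_le/andP[_ /le_trans]; apply.
have cstE d (T : measurableType d) (P : probability T R) : (\int[P]_x c%:E = c%:E)%E.
  by rewrite integral_cst// [X in (_ * X)%E]probability_setT mule1.
by rewrite /DPA_expectation; under eq_integral do rewrite cstE; rewrite cstE.
Qed.

Section neighbourhood.
Variables (A1 : set splits) (A2 : splits -> set (m.-tuple RM)) (p1 p2 : R).
Hypothesis mA1 : measurable A1.
Hypothesis mA2 : forall y, measurable (A2 y).
Hypothesis A1_unit : forall y, A1 y -> unit_box y.
Hypothesis A2_box : forall y, A1 y -> forall v, A2 y v -> boundary_box y v.
Hypothesis p2_ge0 : 0 <= p2.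
Hypothesis p1_le : (p1%:E <= splits_law L a A1)%E.
Hypothesis p2_le : forall y, A1 y -> (p2%:E <= boundary_law m U y (A2 y))%E.

Definition DPA_neighbourhood : set (R -> R) := [set f | exists y v,
  [/\ A1 y, A2 y v & f = DPA_density q y v]].

Lemma DPA_neighbourhood_support f : DPA_neighbourhood f -> DPA_support f.
Proof.
move=> [y [v [yA vA ->]]]; exists y, v; split => //; first exact: A1_unit.
exact: (A2_box yA).
Qed.

Lemma DPA_expectation_ge (Phi : (R -> R) -> \bar R) (c : R) :
  (forall f, DPA_support f -> 0 <= Phi f)%E -> 0 <= c ->
  (forall f, DPA_neighbourhood f -> c%:E <= Phi f)%E ->
  ((p1 * p2 * c)%:E <= E Phi)%E.
Proof.
move=> Phi0 c0 Phic; rewrite E_restrict.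
have outer0 y : (0 <= ((fun y => \int[boundary_law m U y]_v
     ((fun v => Phi (DPA_density q y v)) \_ (boundary_box y)) v) \_ (@unit_box R L)) y)%E.
  by apply: erestrict_ge0 => z zU; apply: integral_ge0 => v _; exact: inner_ge0.
have := @ge0_le_integral_indic _ _ R (splits_law L a) A1 (c * p2) _ mA1 (mulr_ge0 c0 p2_ge0) outer0.
move=> H; apply: le_trans (H _).
  have -> : (p1 * p2 * c)%:E = ((c * p2)%:E * p1%:E)%E by rewrite -EFinM; congr _%:E; ring.
  by rewrite lee_wpmul2l// lee_fin mulr_ge0.
move=> y yA; rewrite patchE mem_set; last exact: A1_unit.
have yU := A1_unit yA.
have := @ge0_le_integral_indic _ _ R (boundary_law m U y) (A2 y) c _ (mA2 y) c0 (inner_ge0 Phi0 yU).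
move=> H2; apply: le_trans (H2 _).
  by rewrite EFinM lee_wpmul2l ?lee_fin ?p2_le.
move=> v vA; rewrite patchE mem_set; last exact: (A2_box yA).
by apply: Phic; exists y, v.
Qed.

End neighbourhood.

Section target.
Variables (t : nat -> R) (lo kap eta xi amin r : R).
Hypothesis lo_gt0 : 0 < lo.
Hypothesis t_bounds : forall k, (k < N + m)%N -> lo <= t k <= kap * lo.

(** Inverse of step (1b) of the prior: the tree weights from which coefficients [t] arise. *)
Definition target_Theta (i : nat) : R :=
  if (i < N - m)%N then t i else
  omega R m (N - i) * t i + (1 - omega R m (N - i)) * t (i + m)%N.

Hypothesis Theta_sum : \sum_(i < N) target_Theta i = 1.
Hypothesis eta_gt0 : 0 < eta.
Hypothesis xi_lt1 : xi < 1.

Let del := 2 * L%:R * eta.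

Hypothesis del_le : del <= 2^-1.
Hypothesis del_gt0 : 0 < del.
Hypothesis eta_le : eta <= 2^-1.
Hypothesis del_xi : del <= xi.
Hypothesis del_kap_xi : 2 * del * kap <= xi * w0.
Hypothesis amin_gt0 : 0 < amin.
Hypothesis r_ge1 : 1 <= r.
Hypothesis a_bounds : forall l, (0 < l <= L)%N -> amin <= a l <= r.

Lemma bernoulli_ineq (x : R) n : 0 <= x <= 1 -> 1 - n%:R * x <= (1 - x) ^+ n.
Proof.
move=> /andP[x0 x1]; elim: n => [|n IH]; first by rewrite mul0r subr0 expr0.
have [h|h] := leP 0 (1 - n%:R * x).
  rewrite exprS; apply: (@le_trans _ _ ((1 - x) * (1 - n%:R * x))).
    have : 0 <= n%:R * x * x by rewrite !mulr_ge0.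
    by rewrite -natr1; lra.
  by rewrite ler_wpM2l// subr_ge0.
apply: (@le_trans _ _ 0); last by rewrite exprn_ge0// subr_ge0.
by rewrite -natr1; lra.
Qed.

Let eta01 : 0 <= eta <= 1. Proof. by rewrite (ltW eta_gt0)/= (le_trans eta_le)//; lra. Qed.

Let pow_lo : 1 - del <= (1 - eta) ^+ L.
Proof.
apply: le_trans (bernoulli_ineq L eta01); rewrite /del.
have : 0 <= L%:R * eta by rewrite mulr_ge0// ltW.
by lra.
Qed.

(** From [(1 + eta)^L * (1 - eta)^L <= 1] and Bernoulli, the power is at most [1 / (1 - L * eta)],
    and [L * eta <= 1/4] gives the bound. *)
Let pow_hi : (1 + eta) ^+ L <= 1 + del.
Proof.
have h := bernoulli_ineq L eta01; have e0 := eta_gt0; have e1 := eta_le.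
have h0 : 0 < 1 - L%:R * eta by move: del_le; rewrite /del; lra.
have h1 : (1 + eta) ^+ L * (1 - eta) ^+ L <= 1.
  rewrite -exprMn exprn_ile1//; first by nra.
  by nra.
have h2 : (1 + eta) ^+ L * (1 - L%:R * eta) <= 1.
  apply: le_trans h1; rewrite ler_wpM2l// exprn_ge0//; lra.
rewrite -(ler_pM2r h0) (le_trans h2)// /del.
move: del_le; rewrite /del; set z := L%:R * eta.
have z0 : 0 <= z by rewrite mulr_ge0// ltW.
by rewrite -mulrA -/z; nra.
Qed.

Let kap_ge1 : 1 <= kap.
Proof.
have P0 : (0 < N + m)%N by rewrite addn_gt0 expn_gt0.
have /andP[h1 h2] := t_bounds P0.
by rewrite -(ler_pM2r lo_gt0) mul1r (le_trans h1).
Qed.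

Let target_mid (j : 'I_m) : target_Theta (N - m + j) =
  omega R m (m - j) * t (N - m + j)%N + (1 - omega R m (m - j)) * t (N + j)%N.
Proof.
by have [h1 _ _ h2 h3] := mid_arith j; rewrite /target_Theta h1 h2 h3.
Qed.

Lemma target_Theta_bounds i : (i < N)%N -> lo <= target_Theta i <= kap * lo.
Proof.
move=> iN; have [iN'|iN'] := ltnP i (N - m).
  by rewrite /target_Theta iN'; apply: t_bounds; exact: lt_Nm.
have [j ->] := mid_index iN' iN; rewrite target_mid.
have [_ j1 j2 _ _] := mid_arith j.
have /andP[w1 w2] := w_ord j.
have /andP[a1 a2] := t_bounds (lt_Nm j1).
have /andP[b1 b2] := t_bounds j2.
move: w1 w2 a1 a2 b1 b2; set w := omega R m _; set A := t _; set B := t _ => w1 w2 a1 a2 b1 b2.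
have w00 := w0_gt0; have w_gt0 : 0 <= w by exact: le_trans (ltW w0_gt0) w1.
have w1' : 0 <= 1 - w by lra.
have := ler_wpM2l w_gt0 a1; have := ler_wpM2l w_gt0 a2.
have := ler_wpM2l w1' b1; have := ler_wpM2l w1' b2.
by move=> *; apply/andP; split; lra.
Qed.

(** One-sided intervals below the target, so that [v_i] stays under its upper limit
    [Theta_i / omega]. *)
Definition near_box (y : splits) : set (m.-tuple RM) :=
  box (fun j : 'I_m => `[(1 - del) * t (N - m + j)%N, t (N - m + j)%N]%classic).

Local Notation Abox := (target_box target_Theta lo eta).

Let T_ge i : (i < N)%N -> lo <= target_Theta i.
Proof. by move=> /target_Theta_bounds/andP[]. Qed.

Lemma target_box_unit y : Abox y -> unit_box y.
Proof.
move=> yA i; have := yA i; rewrite /= !in_itv/=.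
have kL : (size (nth [::] (nodes L) i) < L)%N by rewrite -mem_nodes mem_nth.
have [] := target_split_ge lo_gt0 T_ge Theta_sum kL.
have : eta * lo <= 2^-1 * lo by rewrite ler_wpM2r// ltW.
by have := lo_gt0; lra.
Qed.

Lemma Theta_del y i : Abox y -> (i < N)%N ->
  (1 - del) * target_Theta i <= Theta y i <= (1 + del) * target_Theta i.
Proof.
move=> yA iN; have /andP[h1 h2] := Theta_near lo_gt0 T_ge Theta_sum eta01 yA iN.
have T0 : 0 <= target_Theta i by rewrite (le_trans (ltW lo_gt0))// T_ge.
by rewrite (le_trans _ h1) ?ler_wpM2r//= (le_trans h2)// ler_wpM2r.
Qed.

Let near_mid (j : 'I_m) : (N - m + j < N + m)%N /\ (N + j < N + m)%N /\ (N - m + j < N)%N.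
Proof. by have [_ j1 j2 _ _] := mid_arith j; split => //; exact: lt_Nm. Qed.

Lemma near_box_boundary y : Abox y -> forall v, near_box y v -> boundary_box y v.
Proof.
move=> yA v vV j; have w00 := w0_gt0; have l0 := lo_gt0; have := vV j; rewrite /= !in_itv/=.
have [n1 [n2 n3]] := near_mid j.
have /andP[h1 h2] := Theta_del yA n3; have /andP[w1 w2] := w_ord j.
have /andP[a1 a2] := t_bounds n1; have /andP[b1 b2] := t_bounds n2.
have /andP[c1 c2] := target_Theta_bounds n3.
rewrite /boundary_max => /andP[v1 v2]; apply/andP; split.
  apply: le_trans v1; apply: mulr_ge0; last exact: le_trans (ltW lo_gt0) a1.
  by rewrite subr_ge0 (le_trans del_le)// invf_le1// ler1n.
have w_gt0 : 0 < omega R m (m - j) by exact: lt_le_trans w1.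
rewrite ler_pdivlMr// (le_trans _ h1)//.
apply: (@le_trans _ _ (t (N - m + j)%N * omega R m (m - j))); first by rewrite ler_wpM2r// ltW.
(* The part [(1 - omega) * t (N + j) >= w0 * lo] of the target weight outweighs the tree error
   [del * kap * lo], whence [omega * t <= Theta]. *)
have : del * target_Theta (N - m + j) <= del * (kap * lo) by rewrite ler_wpM2l// ltW.
have : (1 - omega R m (m - j)) * lo <= (1 - omega R m (m - j)) * t (N + j)%N.
  by rewrite ler_wpM2l//; lra.
have : w0 * lo <= (1 - omega R m (m - j)) * lo by rewrite ler_wpM2r//; [exact: ltW|lra].
have : del * kap * lo <= w0 * lo.
  rewrite ler_wpM2r ?(ltW lo_gt0)//.
  have : xi * w0 <= 1 * w0 by rewrite ler_wpM2r ?(ltW w0_gt0)// (ltW xi_lt1).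
  have : 0 <= del * kap by rewrite mulr_ge0 ?(ltW del_gt0)//; have := kap_ge1; lra.
  by have := del_kap_xi; lra.
by rewrite target_mid; lra.
Qed.

(** At the last [m] indices the errors of [Theta] and [v] are divided by [1 - omega >= w0], and the
    quantities they perturb may exceed the coefficient by the ratio [kap];
    [2 * del * kap <= xi * w0] absorbs both effects. *)
Lemma theta_near y v : Abox y -> near_box y v -> forall k, (k < N + m)%N ->
  (1 - xi) * t k <= theta y v k <= (1 + xi) * t k.
Proof.
move=> yA vV; have dx := del_xi; have d0 := del_gt0; have l0 := lo_gt0; have w00 := w0_gt0.
apply: theta_cases => [k kN|j|j].
- rewrite theta_lo//; have kN' := lo_index kN.
  have := Theta_del yA kN'; rewrite /target_Theta kN.
  have /andP[a1 a2] : lo <= t k <= kap * lo by apply: t_bounds; exact: lt_Nm.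
  have : del * t k <= xi * t k by rewrite ler_wpM2r//; lra.
  by lra.
- have [n1 [n2 n3]] := near_mid j; rewrite theta_mid; have := vV j; rewrite /= in_itv/=.
  have /andP[a1 a2] := t_bounds n1.
  have : del * t (N - m + j)%N <= xi * t (N - m + j)%N by rewrite ler_wpM2r//; lra.
  have : 0 <= xi * t (N - m + j)%N by rewrite mulr_ge0//; lra.
  by lra.
have [n1 [n2 n3]] := near_mid j; rewrite theta_hi; have := vV j; rewrite /= in_itv/=.
have := Theta_del yA n3; have := w_ord j.
have := t_bounds n1; have := t_bounds n2.
have := target_Theta_bounds n3; rewrite target_mid.
have := kap_ge1; have := del_kap_xi.
set w := omega R m (m - j); set A := t (N - m + j)%N; set B := t (N + j)%N.
set Th := Theta y _; set V := tnth v j.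
move=> dk k1 /andP[T1 T2] /andP[b1 b2] /andP[a1 a2] /andP[w1 w2] /andP[h1 h2] /andP[v1 v2].
have w_gt0 : 0 < w by exact: lt_le_trans w1.
have w1' : 0 < 1 - w by lra.
have e1 : del * (w * A + (1 - w) * B) <= del * (kap * lo) by rewrite ler_wpM2l//; lra.
have e2 : w * ((1 - del) * A) <= w * V by rewrite ler_wpM2l//; lra.
have e3 : w * V <= w * A by rewrite ler_wpM2l//; lra.
have e4 : w * A <= 1 * A by rewrite ler_wpM2r//; lra.
have e4' : del * (w * A) <= del * A by rewrite ler_wpM2l//; lra.
have e5 : del * A <= del * (kap * lo) by rewrite ler_wpM2l//; lra.
have e6 : 2 * del * kap * lo <= xi * w0 * lo by rewrite ler_wpM2r//; lra.
have xw : 0 <= xi by lra.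
have e7 : xi * w0 * lo <= xi * ((1 - w) * B).
  rewrite -mulrA ler_wpM2l// ler_pM//; lra.
by rewrite ler_pdivlMr// ler_pdivrMr//; apply/andP; split; lra.
Qed.

End target.

End prior.

(** * Lower bound for the prior mass of a target neighbourhood *)

Section prior_mass.
Context (R : realType).
Local Notation RM := (measurableTypeR R).

Lemma prode_ge_expn n (b : R) (F : 'I_n -> \bar R) : 0 <= b ->
  (forall i, b%:E <= F i)%E -> ((b ^+ n)%:E <= \prod_(i < n) F i)%E.
Proof.
move=> b0; elim: n F => [|n IH] F bF; first by rewrite big_ord0 expr0.
by rewrite big_ord_recl exprS EFinM lee_pmul// ?lee_fin ?exprn_ge0// IH.
Qed.

Lemma spline_funZ m L q (c : R) (t : nat -> R) x :
  spline_fun m L q (periodic m L (fun k => c * t k)) x =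
  c * spline_fun m L q (periodic m L t) x.
Proof.
exact: (congr1 (fun F => F (Num.floor ((q * 2 ^ L)%:R * x)))
  (@splineZ R q m c (periodic m L t))).
Qed.

Lemma coef_density_near m L q (t th : nat -> R) (xi : R) x : (0 < q)%N ->
  0 <= xi < 1 -> (forall k, (k < 2 ^ L + m)%N -> 0 <= t k) ->
  0 < coef_mass m L q t -> 0 < coef_mass m L q th ->
  (forall k, (k < 2 ^ L + m)%N -> (1 - xi) * t k <= th k <= (1 + xi) * t k) ->
  coef_density m L q t x <= (1 + xi) / (1 - xi) * coef_density m L q th x.
Proof.
move=> q0 /andP[xi0 xi1] t0 Z0 Zth0 tth.
have x1 : 0 < 1 - xi by rewrite subr_gt0.
have x2 : 0 < 1 + xi by rewrite ltr_wpDr.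
have S0 := spline_fun_ge0 q0 t0 x.
have hS : spline_fun m L q (periodic m L t) x <=
    (1 - xi)^-1 * spline_fun m L q (periodic m L th) x.
  rewrite ler_pdivlMl// -spline_funZ; apply: spline_fun_le => // k kP.
  by have /andP[] := tth k kP.
have hZ : coef_mass m L q th <= (1 + xi) * coef_mass m L q t.
  rewrite -coef_massZ; apply: coef_mass_le => // k kP.
  by have /andP[] := tth k kP.
rewrite /coef_density mulrA ler_pdivrMr// mulrAC ler_pdivlMr//.
apply: (le_trans (ler_pM S0 (ltW Zth0) hS hZ)).
rewrite le_eqVlt; apply/orP; left; apply/eqP; field.
by rewrite gt_eqF.
Qed.

Lemma mid_index_lt m L (j : 'I_m) : (2 ^ L - m + j < 2 ^ L + m)%N.
Proof. by have := ltn_ord j; lia. Qed.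

Lemma sub_ord_bounds m (j : 'I_m) : (0 < m - j <= m)%N.
Proof. by have := ltn_ord j; lia. Qed.

Variables (m L q : nat) (a : nat -> R) (U w0 : R).
Local Notation splits := ((size (nodes L)).-tuple RM).
Local Notation N := (2 ^ L)%N.
Hypothesis q_gt0 : (0 < q)%N.
Hypothesis mq : (m < q)%N.
Hypothesis mL : (m <= 2 ^ L)%N.
Hypothesis w0_gt0 : 0 < w0.
Hypothesis w0_le1 : w0 <= 1.
Hypothesis omega_w0 : forall j, (0 < j <= m)%N -> w0 <= omega R m j <= 1 - w0.
Hypothesis U_large : 1 <= w0 * U.

Variables (t : nat -> R) (lo kap eta xi amin r : R).
Hypothesis lo_gt0 : 0 < lo.
Hypothesis t_bounds : forall k, (k < N + m)%N -> lo <= t k <= kap * lo.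
Hypothesis Theta_sum : \sum_(i < N) target_Theta m L t i = 1.
Hypothesis eta_gt0 : 0 < eta.
Hypothesis xi_lt1 : xi < 1.
Let del := 2 * L%:R * eta.
Hypothesis del_le : del <= 2^-1.
Hypothesis del_gt0 : 0 < del.
Hypothesis eta_le : eta <= 2^-1.
Hypothesis del_xi : del <= xi.
Hypothesis del_kap_xi : 2 * del * kap <= xi * w0.
Hypothesis amin_gt0 : 0 < amin.
Hypothesis r_ge1 : 1 <= r.
Hypothesis a_bounds : forall l, (0 < l <= L)%N -> amin <= a l <= r.

Let a_gt0 l : (0 < l <= L)%N -> 0 < a l.
Proof. by move=> /a_bounds/andP[/(lt_le_trans amin_gt0)]. Qed.

Let T_ge i : (i < N)%N -> lo <= target_Theta m L t i.
Proof.
by move=> iN; have /andP[] := target_Theta_bounds mL w0_gt0 w0_le1 omega_w0 U_large t_bounds iN.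
Qed.

Lemma lo_le1 : lo <= 1.
Proof.
have N0 : (0 < N)%N by rewrite expn_gt0.
rewrite -Theta_sum (bigD1 (Ordinal N0))//= ler_wpDr ?T_ge// sumr_ge0// => i _.
by rewrite (le_trans (ltW lo_gt0))// T_ge.
Qed.

Local Notation Abox := (target_box (target_Theta m L t) lo eta : set splits).
Local Notation Vbox := (near_box t eta).

(** The bound [beta_law_itv_ge] for an interval of length [2 * eta * lo]. It stays at distance
    [lo / 2] from 0 and 1, because target splits do so by [lo] and [eta <= 1/2]. *)
Definition split_mass_bound : R :=
  (lo / 2) `^ (2 * r) * (2 * eta * lo) / (4 / amin + 1).

Lemma split_mass_bound_ge0 : 0 <= split_mass_bound.
Proof.
by rewrite /split_mass_bound divr_ge0 ?mulr_ge0 ?powR_ge0 ?addr_ge0 ?divr_ge0 ?(ltW eta_gt0) ?(ltW lo_gt0) ?(ltW amin_gt0).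
Qed.

Lemma split_mass_bound_le1 : split_mass_bound <= 1.
Proof.
have l1 := lo_le1; have l0 := lo_gt0; have e0 := eta_gt0; have e1 := eta_le; have r1 := r_ge1.
have a4 : 0 < 4 / amin by rewrite divr_gt0.
rewrite /split_mass_bound ler_pdivrMr ?mul1r; last by lra.
apply: (@le_trans _ _ 1); last by lra.
rewrite mulr_ile1 ?powR_ge0//.
- by rewrite mulr_ge0//; lra.
- apply: (@le_trans _ _ (1 `^ (2 * r))); last by rewrite powR1.
  by rewrite ge0_ler_powR ?nnegrE//; lra.
- by rewrite mulr_ile1//; lra.
Qed.

Lemma splits_law_target_box : ((split_mass_bound ^+ N)%:E <= splits_law L a Abox)%E.
Proof.
apply: (@le_trans _ _ (split_mass_bound ^+ size (nodes L))%:E).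
  rewrite lee_fin ler_wiXn2l ?split_mass_bound_ge0 ?split_mass_bound_le1//.
  exact: size_nodes.
rewrite /splits_law /target_box prod_prob_box//.
apply: prode_ge_expn; first exact: split_mass_bound_ge0.
move=> i; set k := nth _ _ _.
have kL : (size k < L)%N by rewrite -mem_nodes mem_nth.
have [s1 s2] := target_split_ge lo_gt0 T_ge Theta_sum kL.
set c := target_split _ _ k in s1 s2 *.
have /andP[al ar] : amin <= a (size k).+1 <= r by apply: a_bounds.
have l0 := lo_gt0; have e0 := eta_gt0.
have el : eta * lo <= 2^-1 * lo by rewrite ler_wpM2r// ltW.
have el0 : 0 < eta * lo by rewrite mulr_gt0.
have ak0 : 0 < a (size k).+1 by exact: a_gt0.
have B : (((lo / 2) `^ (2 * r) * ((c + eta * lo) - (c - eta * lo)) / (4 / a (size k).+1 + 1))%:E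
    <= beta_law (a (size k).+1) (a (size k).+1) `[(c - eta * lo)%R, (c + eta * lo)%R]%classic)%E.
  by apply: beta_law_itv_ge => //; lra.
apply: le_trans B; rewrite lee_fin /split_mass_bound.
have -> : c + eta * lo - (c - eta * lo) = 2 * eta * lo by ring.
have a4 : 0 < 4 / amin by rewrite divr_gt0.
have b4 : 0 < 4 / a (size k).+1 by rewrite divr_gt0.
rewrite ler_wpM2l ?mulr_ge0 ?powR_ge0 ?(ltW e0) ?(ltW l0)//.
rewrite lef_pV2 ?posrE; try lra.
by rewrite lerD2r ler_wpM2l// lef_pV2 ?posrE.
Qed.

Lemma boundary_law_near_box y : Abox y ->
  (((del * lo * w0) ^+ m)%:E <= boundary_law m U y (Vbox y))%E.
Proof.
move=> yA; have yU := target_box_unit mL w0_gt0 w0_le1 omega_w0 U_large lo_gt0 t_bounds Theta_sum eta_le yA.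
rewrite (boundary_lawE mL w0_gt0 w0_le1 omega_w0 U_large yU).
rewrite /near_box prod_prob_box//.
have dl0 : 0 <= del * lo by exact: mulr_ge0 (ltW del_gt0) (ltW lo_gt0).
apply: prode_ge_expn; first exact: mulr_ge0 dl0 (ltW w0_gt0).
move=> j; have jm := ltn_ord j.
(* The target itself lies in [Vbox], hence below the upper end of the uniform law, so the whole
   interval is inside its support. *)
pose v : m.-tuple RM := [tuple t (N - m + i)%N | i < m].
have d1 : 0 <= 1 - del by rewrite subr_ge0 (le_trans del_le)// invf_le1// ler1n.
have jN := mid_index_lt L j.
have /andP[t1 t2] := t_bounds jN.
have t0 : 0 <= t (N - m + j)%N by rewrite (le_trans (ltW lo_gt0)).
have vV : Vbox y v.
  move=> i; rewrite /= tnth_mktuple in_itv/= lexx andbT.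
  have iN := mid_index_lt L i.
  have /andP[i1 i2] := t_bounds iN.
  apply: ler_piMl; first exact: le_trans (ltW lo_gt0) i1.
  by rewrite gerBl (ltW del_gt0).
have vB := near_box_boundary mL w0_gt0 w0_le1 omega_w0 U_large lo_gt0 t_bounds Theta_sum eta_gt0 xi_lt1 del_le
  del_gt0 eta_le del_kap_xi yA vV.
have tb : t (N - m + j)%N <= boundary_max y j.
  by have := vB j; rewrite /= tnth_mktuple in_itv/= => /andP[].
have b0 : 0 < boundary_max y j by apply: lt_le_trans tb; exact: lt_le_trans t1.
apply: le_trans (uniform_law_itv_ge _ _ tb b0); last 2 first.
- exact: mulr_ge0.
- by apply: ler_piMl => //; rewrite gerBl (ltW del_gt0).
rewrite lee_fin.
have -> : t (N - m + j)%N - (1 - del) * t (N - m + j)%N = del * t (N - m + j)%N by ring.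
apply: (ler_pM dl0 (ltW w0_gt0)); first by rewrite ler_wpM2l// (ltW del_gt0).
rewrite -[leLHS]invrK lef_pV2 ?posrE ?invr_gt0//.
have /andP[w1 w2] : w0 <= omega R m (m - j) <= 1 - w0 by apply: omega_w0; exact: sub_ord_bounds.
have wj : 0 < omega R m (m - j) by exact: lt_le_trans w1.
have /andP[h0 h1] := Theta01 (N - m + j) yU.
by rewrite /boundary_max ler_pdivrMr// (le_trans h1)// mulrC ler_pdivlMr// mul1r.
Qed.

End prior_mass.

(** * Spline approximation of f0 *)

Lemma window_bounds (k n i : int) (d : nat) : 0 <= k < n -> k - d%:Z <= i <= k ->
  - d%:Z <= i < n.
Proof. lia. Qed.

Section spline_approximation.
Context (R : realType).
Variables (f0 : R -> R) (alpha K : R).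
Hypothesis alpha_gt0 : 0 < alpha.
Hypothesis f0H : holder_class alpha f0.
Hypothesis f0K : holder_norm alpha f0 = K%:E.
Let m := sfloor alpha.

Let K_ge0 : 0 <= K. Proof. exact: (holder_norm_ge0 alpha_gt0 f0K). Qed.

Lemma eq_spline q d c c' j : (0 < q)%N ->
  (forall i, (j %/ q%:Z)%Z - d%:Z <= i <= (j %/ q%:Z)%Z -> c i = c' i) ->
  spline q d c j = spline q d c' j :> R.
Proof.
move=> q0 cc; apply/eqP; rewrite eq_le; apply/andP.
by split; apply: le_spline => // i ii; rewrite cc.
Qed.

(** Reach to the left of the quasi-interpolant, in coarse cells: [m] for the spline and [m] for each
    of at most [m] residuals. *)
Definition near_pts : nat := (m + m * m)%N.

Definition approx_const : R :=
  2 ^+ m.+1 * ((2 ^+ m.+1) ^+ near_pts * 2) * near_pts.+1%:R `^ alpha + 1.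

Lemma approx_const_ge0 : 0 <= approx_const.
Proof. by rewrite addr_ge0// !mulr_ge0 ?exprn_ge0 ?powR_ge0. Qed.

Section fixed_resolution.
Variables (L q : nat) (P0 : {poly R}).
Hypothesis q_gt0 : (0 < q)%N.
Let N := (2 ^ L)%N.
Let M := (q * N)%N.
Hypothesis mN : (m < N)%N.
Hypothesis P0_size : (size P0 <= m.+1)%N.
Hypothesis P0_near : forall y, I01 y -> `|f0 y - P0.[y]| <= K * `|y - 0| `^ alpha.

Let N_gt0 : (0 < N)%N. Proof. by rewrite expn_gt0. Qed.
Let M_gt0 : (0 < M)%N. Proof. by rewrite muln_gt0 q_gt0. Qed.
Let N_gt0' : 0 < N%:R :> R. Proof. by rewrite ltr0n. Qed.
Let M_gt0' : 0 < M%:R :> R. Proof. by rewrite ltr0n. Qed.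

(** Left of 0, where [f0] gives no information, its local polynomial at 0 takes over. *)
Definition grid_fun (j : int) : R :=
  if 0 <= j then f0 (j%:~R * M%:R^-1) else P0.[j%:~R * M%:R^-1].

Definition spline_coef (i : int) : R := quasi_coef q m grid_fun i.

(* The coefficients of indices -m, ..., -1, computed from a polynomial extrapolating f0
   to the left of 0, are stored by periodicity at the indices N, ..., N + m - 1. *)
Definition wrapped_coef (k : nat) : R :=
  spline_coef (if (k < N)%N then k%:Z else k%:Z - (N + m)%N%:Z).

Lemma periodic_wrapped i : - m%:Z <= i < N%:Z ->
  periodic m L wrapped_coef i = spline_coef i.
Proof.
move=> ii; rewrite /periodic /wrapped_coef -/N.
have [i0|i0] := leP 0 i.
  by rewrite modz_small; [|lia]; rewrite ifT ?gez0_abs//; lia.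
have -> : (i %% (N + m)%N)%Z = i + (N + m)%N%:Z.
  have -> : i = (-1) * (N + m)%N%:Z + (i + (N + m)%N%:Z) by lia.
  by rewrite modzMDl modz_small; lia.
rewrite ifF; last by lia.
by congr spline_coef; lia.
Qed.

Let scale (i : int) : (i * q%:Z)%:~R * M%:R^-1 = i%:~R / N%:R :> R.
Proof.
rewrite intrM /M natrM invfM -!mulrA; congr (_ * _).
by rewrite -pmulrn mulVKf// ?pnatr_eq0 -?lt0n//= mulrCA mulfV ?mulr1// pnatr_eq0 -lt0n.
Qed.

Let I01_frac (i : int) : 0 <= i < N%:Z -> I01 (i%:~R / N%:R : R).
Proof.
move=> /andP[i0 iN]; rewrite /I01/= in_itv/= divr_ge0 ?ler0z//=.
by rewrite ltr_pdivrMr// mul1r pmulrn ltr_int.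
Qed.

(** Left of 0 the polynomials [P0] and [Px] are compared: both approximate [f0] at the nodes
    [0, ..., m], so their difference is at most [2 * e0] there, and [extrapolate] carries this to
    the left. Constants depend on [alpha] only. *)
Lemma grid_fun_near (x : R) (Px : {poly R}) (i : int) : I01 x ->
  (size Px <= m.+1)%N ->
  (forall y, I01 y -> `|f0 y - Px.[y]| <= K * `|y - x| `^ alpha) ->
  Num.floor (N%:R * x) - near_pts%:Z <= i <= Num.floor (N%:R * x) ->
  `|grid_fun (i * q%:Z) - Px.[(i * q%:Z)%:~R * M%:R^-1]| <=
   (2 ^+ m.+1) ^+ near_pts * (2 * (K * (near_pts.+1%:R / N%:R) `^ alpha)).
Proof.
move=> Ix sP Pnear; set k := Num.floor _ => ki.
have kN := I01_cell N_gt0 Ix; rewrite -/k in kN.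
have /andP[xk xk1] : k%:~R / N%:R <= x < (k + 1)%:~R / N%:R.
  by rewrite -cellP.
set e0 := K * _.
have e0_ge0 : 0 <= e0 by rewrite mulr_ge0// powR_ge0.
have base i' : 0 <= i' < N%:Z -> k - near_pts%:Z <= i' <= k + near_pts%:Z ->
    `|f0 (i'%:~R / N%:R) - Px.[i'%:~R / N%:R]| <= e0.
  move=> i'N i'k; apply: (le_trans (Pnear _ (I01_frac i'N))).
  rewrite ler_wpM2l// ge0_ler_powR ?nnegrE ?(ltW alpha_gt0)//.
  have h1 : (i' - k)%:~R <= near_pts%:R :> R by rewrite pmulrn ler_int; lia.
  have h2 : - near_pts%:R <= (i' - k)%:~R :> R by rewrite pmulrn -intrN ler_int; lia.
  rewrite intrB in h1 h2; rewrite intrD mulrDl mul1r in xk1.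
  have Ni0 : 0 < N%:R^-1 :> R by rewrite invr_gt0.
  have h1' := ler_wpM2r (ltW Ni0) h1; have h2' := ler_wpM2r (ltW Ni0) h2.
  rewrite mulrBl in h1'; rewrite mulrBl mulNr in h2'.
  rewrite -natr1 mulrDl mul1r ler_norml; apply/andP; split; lra.
have two : e0 <= (2 ^+ m.+1) ^+ near_pts * (2 * e0).
  have h1 : 1 <= (2 ^+ m.+1) ^+ near_pts :> R by rewrite !exprn_ege1 ?ler1n.
  have : 1 * (2 * e0) <= (2 ^+ m.+1) ^+ near_pts * (2 * e0) by rewrite ler_wpM2r// mulr_ge0.
  by apply: le_trans; lra.
have qz : 0 < q%:Z by rewrite ltz_nat.
have [i0|i0] := leP 0 i.
  rewrite /grid_fun pmulr_lge0// i0 scale; apply: le_trans two; apply: base; lia.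
rewrite /grid_fun pmulr_lge0// (leNgt 0 i) i0/=.
pose D (j : int) : R := (P0 - Px).[j%:~R * M%:R^-1].
have D0 j : iter m.+1 (@nabla R) D j = 0.
  apply: nabla_horner; rewrite (leq_trans (size_polyD _ _))// geq_max P0_size.
  by rewrite size_polyN.
have Ds := iter_nabla_sample0 q_gt0 D0.
have near0 (l : nat) : (l <= m)%N -> `|sample q D l%:Z| <= 2 * e0.
  move=> lm; rewrite /sample /D scale hornerD hornerN.
  set y := _ / _.
  have lN : 0 <= l%:Z < N%:Z by lia.
  have Iy : I01 y by exact: I01_frac.
  rewrite (_ : _ - _ = - (f0 y - P0.[y]) + (f0 y - Px.[y])); last by ring.
  rewrite (le_trans (ler_normD _ _))// normrN mulr_natl mulr2n lerD//.
    apply: (le_trans (P0_near Iy)); rewrite subr0 ler_wpM2l// ge0_ler_powR ?nnegrE ?(ltW alpha_gt0)//.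
    rewrite ger0_norm ?divr_ge0 ?ler0z// ler_wpM2r ?invr_ge0// -pmulrn ler_nat.
    by rewrite /near_pts; lia.
  by apply: base => //; move: lm ki; rewrite /near_pts; lia.
have := @extrapolate R q q_gt0 m (sample q D) (2 * e0) near_pts Ds near0 i.
rewrite /sample /D hornerD hornerN; apply.
by move: ki i0; lia.
Qed.

(** With [y] the left end of the fine cell of [x], the error splits into spline against [Px] at [y],
    [Px] against [f0] at [y], and the move from [y] to [x]. The second is the [+ 1] in
    [approx_const]; the third has the scale of the fine grid. *)
Lemma spline_wrapped_near (x : R) (C g : R) : I01 x -> 0 <= C -> 0 <= g ->
  (forall x y, I01 x -> I01 y -> `|f0 x - f0 y| <= C * `|x - y| `^ g) ->
  `|spline_fun m L q (periodic m L wrapped_coef) x - f0 x| <=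
   approx_const * K * N%:R `^ (- alpha) + C * M%:R^-1 `^ g.
Proof.
move=> Ix C0 g0 mod.
have [Px sP Pnear] := holder_class_poly alpha_gt0 f0H f0K Ix.
pose j := Num.floor (M%:R * x).
have jM := I01_cell M_gt0 Ix; rewrite -/j in jM.
have jk : (j %/ q%:Z)%Z = Num.floor (N%:R * x) by exact: floor_stretch.
have kN := I01_cell N_gt0 Ix; rewrite -jk in kN.
pose y : R := j%:~R * M%:R^-1.
have Iy : I01 y.
  move: jM => /andP[j0 jM]; rewrite /I01/= in_itv/= divr_ge0 ?ler0z//=.
  by rewrite ltr_pdivrMr// mul1r pmulrn ltr_int.
have /andP[yx xy] : y <= x < (j + 1)%:~R / M%:R by rewrite -cellP.
have yx1 : `|y - x| <= M%:R^-1.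
  by move: xy; rewrite intrD mulrDl mul1r -/y => xy; rewrite ler_norml; apply/andP; split; lra.
have xy1 : `|x - y| <= M%:R^-1 by rewrite distrC.
rewrite /spline_fun -/N -/M -/j.
rewrite (@eq_spline _ _ _ spline_coef)//; last first.
  by move=> i ii; apply: periodic_wrapped; exact: window_bounds kN ii.
pose e := (2 ^+ m.+1) ^+ near_pts * (2 * (K * (near_pts.+1%:R / N%:R) `^ alpha)).
have h1 : `|spline q m spline_coef j - Px.[y]| <= 2 ^+ m.+1 * e.
  apply: (@spline_quasi_coef_near R q q_gt0 m grid_fun (fun i => Px.[i%:~R * M%:R^-1])).
    exact: nabla_horner.
  by move=> i; rewrite jk => ii; exact: (grid_fun_near Ix sP Pnear ii).
have h2 : `|Px.[y] - f0 y| <= K * M%:R^-1 `^ alpha.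
  rewrite distrC (le_trans (Pnear y Iy))// ler_wpM2l// ge0_ler_powR ?nnegrE ?(ltW alpha_gt0)//.
have h3 : `|f0 y - f0 x| <= C * M%:R^-1 `^ g.
  rewrite (le_trans (mod _ _ Iy Ix))// ler_wpM2l// ge0_ler_powR ?nnegrE//.
have -> : spline q m spline_coef j - f0 x = (spline q m spline_coef j - Px.[y]) +
   (Px.[y] - f0 y) + (f0 y - f0 x) by ring.
rewrite (le_trans (ler_normD _ _))// lerD// (le_trans (ler_normD _ _))//.
apply: (le_trans (lerD h1 h2)).
have Na : (near_pts.+1%:R / N%:R) `^ alpha = near_pts.+1%:R `^ alpha * N%:R `^ (- alpha) :> R.
  by rewrite powRM// ?invr_ge0 ?(ltW N_gt0')// -powR_inv1 ?(ltW N_gt0')// -powRrM mulN1r.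
have Ma : M%:R^-1 `^ alpha <= N%:R `^ (- alpha) :> R.
  rewrite -[leRHS](_ : N%:R^-1 `^ alpha = _); last first.
    by rewrite -powR_inv1 ?(ltW N_gt0')// -powRrM mulN1r.
  rewrite ge0_ler_powR ?nnegrE ?(ltW alpha_gt0) ?invr_ge0 ?(ltW N_gt0') ?(ltW M_gt0')//.
  by rewrite lef_pV2 ?posrE// ler_nat /M leq_pmull.
have h4 : K * M%:R^-1 `^ alpha <= K * N%:R `^ (- alpha) by rewrite ler_wpM2l.
apply: (le_trans (lerD (lexx _) h4)).
rewrite /e Na /approx_const le_eqVlt; apply/orP; left; apply/eqP; ring.
Qed.

(** Quasi-interpolation may produce negative coefficients. This bound by the oscillation of [f0]
    over [m] cells will keep them near values of [f0], hence positive, at fine resolutions. *)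
Lemma spline_coef_near (C g tau : R) : 0 <= C -> 0 <= g -> 0 <= tau ->
  (forall x y, I01 x -> I01 y -> `|f0 x - f0 y| <= C * `|x - y| `^ g) ->
  (forall y, - (near_pts + m)%N%:R / N%:R <= y <= 0 -> `|P0.[y] - f0 0| <= tau) ->
  forall i, - m%:Z <= i < N%:Z ->
  `|spline_coef i - grid_fun (i * q%:Z)| <= 2 ^+ m * (C * (m%:R / N%:R) `^ g + 2 * tau) /\
  exists2 y, I01 y & `|grid_fun (i * q%:Z) - f0 y| <= tau.
Proof.
move=> C0 g0 tau0 mod P0tau i ii.
set w := C * _.
have w0 : 0 <= w by rewrite mulr_ge0 ?powR_ge0.
have qz : 0 < q%:Z by rewrite ltz_nat.
have I0 : I01 (0 : R) by rewrite /I01/= in_itv/= lexx ltr01.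
have gneg l : l < 0 -> - (near_pts + m)%N%:Z <= l -> `|grid_fun (l * q%:Z) - f0 0| <= tau.
  move=> l0 ll; rewrite /grid_fun pmulr_lge0// (leNgt 0 l) l0/= scale; apply: P0tau.
  rewrite ler_wpM2r ?invr_ge0 ?(ltW N_gt0')//=; last first.
    by rewrite pmulrn -intrN ler_int.
  by rewrite mulr_le0_ge0 ?invr_ge0 ?(ltW N_gt0')// lerz0 ltW.
have gpos l : 0 <= l -> grid_fun (l * q%:Z) = f0 (l%:~R / N%:R).
  by move=> l0; rewrite /grid_fun pmulr_lge0// l0 scale.
have modN l l' : 0 <= l < N%:Z -> 0 <= l' < N%:Z -> - m%:Z <= l - l' <= m%:Z ->
    `|f0 (l%:~R / N%:R) - f0 (l'%:~R / N%:R)| <= w.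
  move=> lN lN' ll; apply: (le_trans (mod _ _ (I01_frac lN) (I01_frac lN'))).
  rewrite ler_wpM2l// ge0_ler_powR ?nnegrE//.
  rewrite -mulrBl normrM [X in _ * X]ger0_norm ?invr_ge0 ?(ltW N_gt0')//.
  rewrite ler_wpM2r ?invr_ge0 ?(ltW N_gt0')// -intrB ler_norml pmulrn -intrN !ler_int.
  lia.
have osc l l' : - (near_pts + m)%N%:Z <= l' -> l' <= l -> l < N%:Z -> l - l' <= m%:Z ->
    `|grid_fun (l * q%:Z) - grid_fun (l' * q%:Z)| <= w + 2 * tau.
  move=> l'm ll lN llm.
  have [l0|l0] := leP 0 l; last first.
    have l'0 : l' < 0 by lia.
    have h1 : `|grid_fun (l * q%:Z) - f0 0| <= tau by apply: gneg => //; lia.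
    have h2 : `|grid_fun (l' * q%:Z) - f0 0| <= tau by apply: gneg.
    rewrite (_ : _ - _ = (grid_fun (l * q%:Z) - f0 0) - (grid_fun (l' * q%:Z) - f0 0)); last by ring.
    by rewrite (le_trans (ler_normB _ _))//; lra.
  have [l'0|l'0] := leP 0 l'.
    rewrite !gpos//; apply: (le_trans (modN l l' _ _ _)); [lia|lia|lia|lra].
  have h2 : `|grid_fun (l' * q%:Z) - f0 0| <= tau by apply: gneg.
  have h1 : `|grid_fun (l * q%:Z) - f0 0| <= w.
    rewrite gpos// -[f0 0](_ : f0 (0%:~R / N%:R) = _); last by rewrite mul0r.
    by apply: modN; clear -l0 lN llm l'0; lia.
  rewrite (_ : _ - _ = (grid_fun (l * q%:Z) - f0 0) - (grid_fun (l' * q%:Z) - f0 0)); last by ring.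
  by rewrite (le_trans (ler_normB _ _))//; lra.
split; last first.
  have [i0|i0] := leP 0 i.
    exists (i%:~R / N%:R); first by apply: I01_frac; lia.
    by rewrite gpos// subrr normr0.
  by exists 0 => //; apply: gneg => //; rewrite /near_pts; lia.
apply: (@quasi_coef_sub_sample R q q_gt0 m grid_fun (- near_pts%:Z) (N%:Z - 1)).
- by rewrite addr_ge0// mulr_ge0.
- move=> l ll; rewrite /sample /residual.
  (* Since constants are reproduced, the residual at a node is the spline of differences between
     nodes, hence bounded by the oscillation. *)
  rewrite -[X in X - _](_ : spline q m (fun=> grid_fun (l * q%:Z)) (l * q%:Z) = _); last by rewrite spline_cst.
  have -> : spline q m (fun=> grid_fun (l * q%:Z)) (l * q%:Z) - spline q m (sample q grid_fun) (l * q%:Z)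
    = spline q m (fun i => grid_fun (l * q%:Z) + -1 * sample q grid_fun i) (l * q%:Z).
    by rewrite (@splineD R q m (fun=> grid_fun (l * q%:Z)) (fun i => -1 * sample q grid_fun i)) splineZ mulN1r.
  apply: spline_norm_le => // l'; rewrite mulzK ?gt_eqF// => l'l.
  rewrite mulN1r; apply: osc; move: l'l ll; clear; lia.
- by rewrite /near_pts; lia.
Qed.

End fixed_resolution.

End spline_approximation.

(** * Chi-square bound for the normalized approximating spline *)

Section chi_square.
Context (R : realType).
Local Notation mu := (@lebesgue_measure R).
Variables (f0 : density R) (m L q : nat) (t : nat -> R) (lo e : R).
Local Notation P := (2 ^ L + m)%N.
Hypothesis q_gt0 : (0 < q)%N.
Hypothesis mq : (m < q)%N.
Hypothesis lo_gt0 : 0 < lo.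
Hypothesis t_ge : forall k, (k < P)%N -> lo <= t k.
Hypothesis e_bounds : 0 <= e <= 1.
Hypothesis t_near : forall x, I01 x -> `|spline_fun m L q (periodic m L t) x - f0 x| <= e.

Let P_gt0 : (0 < P)%N. Proof. by rewrite addn_gt0 expn_gt0. Qed.
Let t_ge0 k : (k < P)%N -> 0 <= t k.
Proof. by move=> /t_ge; apply: le_trans; exact: ltW. Qed.

Let S := spline_fun m L q (periodic m L t).
Let Z := coef_mass m L q t.

Let S_ge x : lo <= S x.
Proof.
rewrite /S -[leLHS](_ : spline_fun m L q (periodic m L (fun=> lo)) x = lo).
  exact: spline_fun_le.
by rewrite /spline_fun [X in spline _ _ X](_ : _ = fun=> lo)// spline_cst.
Qed.

Lemma coef_mass_pos : 0 < Z.
Proof.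
by apply: (coef_mass_gt0 q_gt0 mq t_ge0 P_gt0); exact: lt_le_trans (t_ge P_gt0).
Qed.

Let mI : measurable (I01 : set (measurableTypeR R)).
Proof. exact: measurable_itv. Qed.

Let mS : measurable_fun I01 S.
Proof. by apply: measurable_cell; rewrite muln_gt0 q_gt0 expn_gt0. Qed.

Let mf0 := @measurable_density _ f0.
Let f0_ge0 := @density_ge0 _ f0.

Let int1 : (\int[mu]_(x in I01) (1 : R)%:E = 1)%E.
Proof.
rewrite /I01 integral_cst//= lebesgue_measure_itv/= lte_fin ltr01 mul1e.
by rewrite sube0.
Qed.

Let S_ge0 x : 0 <= S x. Proof. exact: le_trans (ltW lo_gt0) (S_ge x). Qed.

Let intS : (\int[mu]_(x in I01) (S x)%:E = Z%:E)%E.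
Proof.
have := integral_spline_fun q_gt0 t_ge0 ler01.
by rewrite mul1r => <-; apply: eq_integral => x _; rewrite mul1r.
Qed.

Let Z_le2 : Z <= 2.
Proof.
have /andP[e0 e1] := e_bounds.
have : (\int[mu]_(x in I01) (S x)%:E <= \int[mu]_(x in I01) (1 * f0 x + e * 1)%:E)%E.
  apply: ge0_le_integral => //.
  - by move=> x _; rewrite lee_fin.
  - exact/measurable_EFinP.
  - by apply/measurable_EFinP; apply: measurable_funD => //; apply: measurable_funM.
  - move=> x Ix; rewrite lee_fin mul1r mulr1.
    by have := t_near Ix; rewrite ler_norml -/S => /andP[_]; lra.
rewrite integral_lin2// int1 density_int1 intS -!EFinM -EFinD lee_fin.
by lra.
Qed.

(** Integrating [f0^2 Z / S + Z S = 2 Z f0 + Z (S - f0)^2 / S] gives [1 - (Z - 1)^2] plus an error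
    term: normalization by [Z] costs nothing, and [Z <= 2] bounds the rest. *)
Lemma chi_square_bound :
  (\int[mu]_(x in I01) (f0 x ^+ 2 / coef_density m L q t x)%:E <=
   (1 + 2 * e ^+ 2 / lo)%:E)%E.
Proof.
have Z0 := coef_mass_pos; have l0 := lo_gt0.
pose h x := f0 x ^+ 2 / coef_density m L q t x.
have S0 x : 0 < S x by exact: lt_le_trans (S_ge x).
have h0 x : I01 x -> 0 <= h x.
  by move=> Ix; rewrite divr_ge0 ?sqr_ge0// /coef_density divr_ge0 ?S_ge0// ltW.
have mh : measurable_fun I01 h.
  apply: measurable_funM; first exact: measurable_funX.
  apply: (eq_measurable_fun (fun x => coef_density m L q t x `^ (-1))).
    move=> x _; rewrite powR_inv1//.
    by rewrite divr_ge0 ?S_ge0// ltW.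
  by apply: (measurableT_comp (measurable_powR _)); exact: measurable_coef_density.
have e2 : 0 <= Z * (e ^+ 2 / lo) by rewrite mulr_ge0 ?divr_ge0 ?sqr_ge0 ?ltW.
have : (\int[mu]_(x in I01) (1 * h x + Z * S x)%:E <=
        \int[mu]_(x in I01) ((2 * Z) * f0 x + (Z * (e ^+ 2 / lo)) * 1)%:E)%E.
  apply: ge0_le_integral => //.
  - by move=> x Ix; rewrite lee_fin mul1r addr_ge0 ?h0// mulr_ge0// ltW.
  - by apply/measurable_EFinP; apply: measurable_funD; apply: measurable_funM.
  - by apply/measurable_EFinP; apply: measurable_funD; apply: measurable_funM.
  - move=> x Ix; rewrite lee_fin mul1r mulr1 /h /coef_density -/S -/Z.
    have Sx := S0 x.
    have -> : f0 x ^+ 2 / (S x / Z) + Z * S x =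
        2 * Z * f0 x + Z * ((S x - f0 x) ^+ 2 / S x).
      by field; rewrite !gt_eqF.
    rewrite lerD2l ler_wpM2l ?(ltW Z0)//.
    rewrite ler_pM ?sqr_ge0 ?invr_ge0 ?S_ge0// ?lef_pV2 ?posrE ?S_ge//.
    have /andP[e0 e1] := e_bounds.
    rewrite -[leLHS]real_normK ?num_real// lerXn2r ?nnegrE//.
    exact: t_near.
rewrite !integral_lin2//; do ?[exact: (ltW Z0) | exact: (mulr_ge0 _ (ltW Z0))].
rewrite intS int1 density_int1 !mule1 mul1e.
have H0 : (0 <= \int[mu]_(x in I01) (h x)%:E)%E.
  by apply: integral_ge0 => x Ix; rewrite lee_fin h0.
rewrite -/(h _); move: H0; case: (\int[mu]_(x in I01) (h x)%:E)%E => [I| |]//.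
rewrite -EFinM -!EFinD !lee_fin => I0 HI.
have : Z * (e ^+ 2 / lo) <= 2 * (e ^+ 2 / lo).
  by rewrite ler_wpM2r ?divr_ge0 ?sqr_ge0 ?(ltW l0)// Z_le2.
have := sqr_ge0 (Z - 1); rewrite -mulrA.
by move: HI; lra.
Qed.

End chi_square.

(** * The posterior bound for one sample size *)

Section fixed_sample_size.
Context (R : realType).
Local Notation RM := (measurableTypeR R).
Local Notation mu := (@lebesgue_measure R).

Lemma coef_densityZ m L q (c : R) (t : nat -> R) x : 0 < c ->
  coef_density m L q (fun k => c * t k) x = coef_density m L q t x.
Proof.
move=> c0; rewrite /coef_density spline_funZ coef_massZ.
by rewrite -mulf_div divff ?mul1r// gt_eqF.
Qed.

Lemma target_ThetaZ m L (c : R) (t : nat -> R) i :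
  target_Theta m L (fun k => c * t k) i = c * target_Theta m L t i.
Proof. by rewrite /target_Theta; case: ifP => _ //; ring. Qed.

Variables (f0 : density R) (m L n : nat) (a : nat -> R) (U w0 : R).
Variables (t : nat -> R) (lo0 hi0 e amin r rr pm0 Kn : R) (K : nat).
Variable (B : set (R -> R)).
Local Notation N := (2 ^ L)%N.
Let kap := hi0 / lo0.
(** For [xi <= 1/4] one has [(1 + xi) / (1 - xi) <= 1 + 4 * xi = 1 + 1/n]. The choice of [eta] then
    makes [2 * del * kap = xi * w0]. *)
Let xi : R := (4 * n%:R)^-1.
Let eta := xi * w0 / (4 * kap * L%:R).
Let del := 2 * L%:R * eta.

Hypothesis n_gt0 : (0 < n)%N.
Hypothesis L_gt0 : (0 < L)%N.
Hypothesis mn : (m < n)%N.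
Hypothesis mL : (m <= N)%N.
Hypothesis w0_gt0 : 0 < w0.
Hypothesis w0_le1 : w0 <= 1.
Hypothesis omega_w0 : forall j, (0 < j <= m)%N -> w0 <= omega R m j <= 1 - w0.
Hypothesis U_large : 1 <= w0 * U.
Hypothesis f0_gt0 : forall x, I01 x -> 0 < f0 x.
Hypothesis lo0_gt0 : 0 < lo0.
Hypothesis t_bounds : forall k, (k < N + m)%N -> lo0 <= t k <= hi0.
Hypothesis e_bounds : 0 <= e <= 1.
Hypothesis t_near : forall x, I01 x -> `|spline_fun m L n (periodic m L t) x - f0 x| <= e.
Hypothesis amin_gt0 : 0 < amin.
Hypothesis r_ge1 : 1 <= r.
Hypothesis a_bounds : forall l, (0 < l <= L)%N -> amin <= a l <= r.
Hypothesis rr_gt0 : 0 < rr.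
Hypothesis B_far : forall f, B f ->
  (rr%:E < L1_dist f0 f)%E \/ (rr%:E < hellinger_dist f0 f)%E.
Hypothesis pm0_gt0 : 0 < pm0.
Hypothesis pm0_le : forall lo, (N%:R * kap)^-1 <= lo ->
  pm0 <= split_mass_bound lo eta amin r ^+ N * (del * lo * w0) ^+ m.
Hypothesis K_large : w0^-1 * (n%:R ^+ m.+1 * N%:R ^+ 2 * n%:R) <= K%:R.
Hypothesis Kn_gt0 : 0 < Kn.

Let q_gt0 := n_gt0.
Let N0 : 0 < N%:R :> R. Proof. by rewrite ltr0n expn_gt0. Qed.
Let n0 : 0 < n%:R :> R. Proof. by rewrite ltr0n. Qed.
Let n1 : 1 <= n%:R :> R. Proof. by rewrite ler1n. Qed.
Let L1 : 1 <= L%:R :> R. Proof. by rewrite ler1n. Qed.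
Let L0 : 0 < L%:R :> R. Proof. by rewrite ltr0n. Qed.
Let gt04 : 0 < 4 :> R. Proof. by []. Qed.
Let P0 : (0 < N + m)%N. Proof. by rewrite addn_gt0 expn_gt0. Qed.
Let hi0_ge : lo0 <= hi0.
Proof. by have /andP[h1 h2] := t_bounds P0; exact: le_trans h2. Qed.
Let kap_ge1 : 1 <= kap. Proof. by rewrite ler_pdivlMr// mul1r. Qed.
Let kap_gt0 : 0 < kap. Proof. exact: lt_le_trans kap_ge1. Qed.
Let xi_gt0 : 0 < xi. Proof. by rewrite invr_gt0 mulr_gt0. Qed.
Let xi_le : xi <= 4^-1.
Proof. by rewrite lef_pV2 ?posrE ?mulr_gt0// ler_peMr. Qed.
Let eta_gt0 : 0 < eta.
Proof.
exact: divr_gt0 (mulr_gt0 xi_gt0 w0_gt0) (mulr_gt0 (mulr_gt0 gt04 kap_gt0) L0).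
Qed.
Let delE : del = xi * w0 / (2 * kap).
Proof. rewrite /del /eta; have k0 := lt0r_neq0 kap_gt0; have l0 := lt0r_neq0 L0.
by move: k0 l0; set k := kap; set x := xi => k0 l0; field; rewrite k0 l0. Qed.
Let del_gt0 : 0 < del.
Proof. by rewrite delE; exact: divr_gt0 (mulr_gt0 xi_gt0 w0_gt0) (mulr_gt0 (ltr0Sn _ 1) kap_gt0). Qed.
Let del_xi : del <= xi.
Proof.
have k2 : 0 < 2 * kap := mulr_gt0 (ltr0Sn _ 1) kap_gt0.
rewrite delE (ler_pdivrMr _ _ k2) (ler_pM2l xi_gt0).
have k1 := kap_ge1; have w1 := w0_le1; lra.
Qed.
Let eta_del : eta <= del.
Proof. rewrite /del; apply: ler_peMl; first exact: ltW eta_gt0.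
by have l1 := L1; lra. Qed.
Let del_half : del <= 2^-1.
Proof. by have h1 := del_xi; have h2 := xi_le; lra. Qed.
Let eta_half : eta <= 2^-1.
Proof. exact: le_trans eta_del del_half. Qed.
Let xi_lt1 : xi < 1.
Proof. by have h2 := xi_le; lra. Qed.
Let del_kap : 2 * del * kap <= xi * w0.
Proof.
rewrite delE; have k0 := lt0r_neq0 kap_gt0.
by move: k0; set k := kap; set x := xi => k0; rewrite le_eqVlt; apply/orP; left; apply/eqP; field.
Qed.

Let t_kap k : (k < N + m)%N -> lo0 <= t k <= kap * lo0.
Proof. by rewrite divfK ?gt_eqF//; exact: t_bounds. Qed.

(** Tree weights must sum to 1, so the target is divided by [Sm]; its density is unchanged by
    [coef_densityZ]. *)
Let Sm := \sum_(i < N) target_Theta m L t i.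

Let Sm_bounds : N%:R * lo0 <= Sm <= N%:R * hi0.
Proof.
have h i : (i < N)%N -> lo0 <= target_Theta m L t i <= hi0.
  move=> iN; have := target_Theta_bounds mL w0_gt0 w0_le1 omega_w0 U_large t_kap iN.
  by rewrite divfK// gt_eqF.
rewrite -[N in N%:R]card_ord !mulr_natl -!sumr_const.
by apply/andP; split; apply: ler_sum => i _; have /andP[] := h i (ltn_ord i).
Qed.

Let Sm_gt0 : 0 < Sm.
Proof. by have /andP[h _] := Sm_bounds; apply: lt_le_trans h; rewrite mulr_gt0. Qed.

Let t1 k := Sm^-1 * t k.
Let lo := lo0 / Sm.

Let lo_gt0 : 0 < lo. Proof. by rewrite divr_gt0. Qed.

Let lo_ge : (N%:R * kap)^-1 <= lo.
Proof.
have /andP[_ h] := Sm_bounds.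
have Nk : N%:R * kap \is Num.pos by rewrite posrE; exact: mulr_gt0 N0 kap_gt0.
have Sl : Sm / lo0 \is Num.pos by rewrite posrE; exact: divr_gt0 Sm_gt0 lo0_gt0.
rewrite /lo -[leRHS]invrK invf_div (lef_pV2 Nk Sl).
by rewrite ler_pdivrMr// -mulrA divfK// gt_eqF.
Qed.

Let t1_bounds k : (k < N + m)%N -> lo <= t1 k <= kap * lo.
Proof.
move=> /t_kap/andP[h1 h2].
have s0 : 0 <= Sm^-1 by rewrite invr_ge0 ltW.
rewrite /t1 /lo mulrA ![_ / Sm]mulrC.
by rewrite !ler_wpM2l.
Qed.

Let t1_sum : \sum_(i < N) target_Theta m L t1 i = 1.
Proof.
under eq_bigr do rewrite /t1 target_ThetaZ.
by rewrite -mulr_sumr mulVf// gt_eqF.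
Qed.

Let t_ge0 k : (k < N + m)%N -> 0 <= t k.
Proof. by move=> /t_bounds/andP[h _]; exact: le_trans (ltW lo0_gt0) h. Qed.

Let t_ge k : (k < N + m)%N -> lo0 <= t k.
Proof. by move=> /t_bounds/andP[]. Qed.

Let Z_gt0 : 0 < coef_mass m L n t.
Proof. exact: (coef_mass_pos q_gt0 mn lo0_gt0 t_ge). Qed.

Let A1 : set ((size (nodes L)).-tuple RM) := target_box (target_Theta m L t1) lo eta.
Let A2 (y : (size (nodes L)).-tuple RM) := @near_box R m L t1 eta y.
Let pm := split_mass_bound lo eta amin r ^+ N * (del * lo * w0) ^+ m.

Let pm_ge : pm0 <= pm. Proof. exact: pm0_le. Qed.
Let pm_gt0 : 0 < pm. Proof. exact: lt_le_trans pm_ge. Qed.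

Let a_gt0 l : (0 < l <= L)%N -> 0 < a l.
Proof. by move=> /a_bounds/andP[h _]; exact: lt_le_trans h. Qed.

Local Notation E := (DPA_expectation m L n a U).
Local Notation supp := (@DPA_support R m L n).
Local Notation nb := (DPA_neighbourhood n A1 A2).

Let A1_unit y : A1 y -> unit_box y.
Proof.
exact: (target_box_unit mL w0_gt0 w0_le1 omega_w0 U_large lo_gt0 t1_bounds t1_sum eta_half).
Qed.

Let A2_box y : A1 y -> forall v, A2 y v -> boundary_box y v.
Proof.
move=> yA v vA.
exact: (near_box_boundary mL w0_gt0 w0_le1 omega_w0 U_large lo_gt0 t1_bounds t1_sum eta_gt0
  xi_lt1 del_half del_gt0 eta_half del_kap yA vA).
Qed.

Let theta_mass_gt0 (y : (size (nodes L)).-tuple RM) (v : m.-tuple RM) :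
  unit_box y -> boundary_box y v -> 0 < coef_mass m L n (theta y v).
Proof.
move=> yU vB.
have th := theta_bounds mL w0_gt0 w0_le1 omega_w0 U_large yU vB.
have [k kP tk] := theta_ge_pow2 mL w0_gt0 w0_le1 omega_w0 U_large v yU.
apply: (coef_mass_gt0 q_gt0 mn _ kP).
  by move=> k' /th/andP[].
by apply: lt_le_trans tk; rewrite invr_gt0.
Qed.

Let DPA_coef (y : (size (nodes L)).-tuple RM) (v : m.-tuple RM) :
  unit_box y -> boundary_box y v ->
  DPA_density n y v = coef_density m L n (theta y v).
Proof.
move=> yU vB; have th := theta_bounds mL w0_gt0 w0_le1 omega_w0 U_large yU vB.
by apply/funext => x; apply: DPA_densityE => // k /th/andP[].
Qed.

Let supp_ge0 f : supp f -> forall x, I01 x -> 0 <= f x.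
Proof.
move=> [y [v [yU vB ->]]] x _; rewrite DPA_coef//; apply: coef_density_ge0 => //.
  by move=> k kP; have /andP[] := theta_bounds mL w0_gt0 w0_le1 omega_w0 U_large yU vB kP.
exact: theta_mass_gt0.
Qed.

Let nb_ge f : nb f -> forall x, I01 x ->
  coef_density m L n t x <= (1 + n%:R^-1) * f x.
Proof.
move=> [y [v [yA vA ->]]] x Ix; have yU := A1_unit yA; have vB := A2_box yA vA.
rewrite DPA_coef//.
have Sm0 : 0 < Sm^-1 by rewrite invr_gt0.
rewrite -(coef_densityZ m L n t x Sm0) -/(t1 _).
have Z1 : 0 < coef_mass m L n t1 by rewrite /t1 coef_massZ mulr_gt0.
have t1_ge0 k : (k < N + m)%N -> 0 <= t1 k.
  by move=> /t1_bounds/andP[h _]; exact: le_trans (ltW lo_gt0) h.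
have xi01 : 0 <= xi < 1 by rewrite ltW ?xi_gt0//= xi_lt1.
have near := theta_near mL w0_gt0 w0_le1 omega_w0 U_large lo_gt0 t1_bounds t1_sum eta_gt0
   del_half del_gt0 eta_half del_xi del_kap yA vA.
apply: le_trans (coef_density_near x q_gt0 xi01 t1_ge0 Z1 (theta_mass_gt0 yU vB) near) _.
apply: ler_wpM2r.
  apply: coef_density_ge0 => //; last exact: theta_mass_gt0.
  by move=> k kP; have /andP[] := theta_bounds mL w0_gt0 w0_le1 omega_w0 U_large yU vB kP.
have xi1 := xi_lt1; have xi0 := xi_gt0.
rewrite ler_pdivrMr; last by rewrite subr_gt0.
have -> : n%:R^-1 = 4 * xi by rewrite /xi invfM mulrA divff ?mul1r// pnatr_eq0.
have h := xi_le; have := mulr_ge0 (ltW xi0) (_ : 0 <= 4^-1 - xi); rewrite subr_ge0 => /(_ h).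
lra.
Qed.

Let aff := expR (n%:R^-1 - rr ^+ 2 / 16).
Let grid : seq (R -> R) :=
  [seq coef_density m L n (grid_coef R w) | w <- enum {: (N + m).-tuple 'I_K.+1}].
(** The affinity condition is imposed by filtering the grid; [affinity_far] shows that every grid
    density dominating a far [f] passes the filter. *)
Let cover := [seq g <- grid |
  `[< (\int[mu]_(x in I01) (Num.sqrt (f0 x * g x))%:E <= aff%:E)%E >]].

Let size_cover : (size cover <= K.+1 ^ (N + m))%N.
Proof.
rewrite size_filter (leq_trans (count_size _ _))// /grid size_map -cardE.
by rewrite card_tuple card_ord.
Qed.

Let grid_coef_ge0 (w : (N + m).-tuple 'I_K.+1) k : (k < N + m)%N -> 0 <= grid_coef R w k.
Proof. by move=> _; apply: le_trans ler01 (grid_coef_ge1 R w k). Qed.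

Let supp_le f : supp f -> B f ->
  exists2 g, g \in cover & forall x, I01 x -> f x <= (1 + n%:R^-1) * g x.
Proof.
move=> sf Bf; have [y [v [yU vB fE]]] := sf; rewrite DPA_coef// in fE.
have th := theta_bounds mL w0_gt0 w0_le1 omega_w0 U_large yU vB.
have [w Hw] := coef_density_cover q_gt0 mn n_gt0 th
  (theta_ge_pow2 mL w0_gt0 w0_le1 omega_w0 U_large v yU) K_large.
exists (coef_density m L n (grid_coef R w)); last by move=> x _; rewrite fE.
have th0 k : (k < N + m)%N -> 0 <= theta y v k by move=> /th/andP[].
have Zth := theta_mass_gt0 yU vB.
have Zw : 0 < coef_mass m L n (grid_coef R w) by exact: grid_coef_mass_gt0.
rewrite mem_filter; apply/andP; split; last by apply: map_f; rewrite mem_enum.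
apply/asboolP.
have fw x : I01 x -> f x <= (1 + n%:R^-1) * coef_density m L n (grid_coef R w) x.
  by move=> _; rewrite fE.
apply: (@le_trans _ _ (1 + n%:R^-1 - rr ^+ 2 / 16)%:E); last first.
  by rewrite lee_fin /aff -addrA expR_ge1Dx.
apply: (@affinity_far R f0 f) (B_far Bf) => //.
- exact: measurable_density.
- by rewrite fE; exact: measurable_coef_density.
- exact: measurable_coef_density.
- exact: density_ge0.
- by move=> x Ix; exact: supp_ge0.
- by move=> x _; apply: coef_density_ge0 => // k; exact: grid_coef_ge0.
- exact: density_int1.
- by rewrite fE; apply: coef_density_int1.
- by apply: coef_density_int1 => // k; exact: grid_coef_ge0.
Qed.

Let p1 := split_mass_bound lo eta amin r ^+ N.
Let p2 := (del * lo * w0) ^+ m.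

Let E_ge_nb (Phi : (R -> R) -> \bar R) (c : R) :
  (forall f, supp f -> 0 <= Phi f)%E -> 0 <= c ->
  (forall f, nb f -> c%:E <= Phi f)%E -> ((pm * c)%:E <= E Phi)%E.
Proof.
have p1_le := splits_law_target_box mL w0_gt0 w0_le1 omega_w0 U_large lo_gt0 t1_bounds t1_sum
  eta_gt0 eta_half amin_gt0 r_ge1 a_bounds.
have p2_le y (yA : A1 y) := boundary_law_near_box mL w0_gt0 w0_le1 omega_w0 U_large lo_gt0
  t1_bounds t1_sum eta_gt0 xi_lt1 del_half del_gt0 eta_half del_kap yA.
have p2_ge0 : 0 <= p2.
  exact: exprn_ge0 (mulr_ge0 (mulr_ge0 (ltW del_gt0) (ltW lo_gt0)) (ltW w0_gt0)).
apply: (@DPA_expectation_ge R m L n a U w0 mL w0_gt0 w0_le1 omega_w0 U_large a_gt0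
  A1 A2 p1 p2 _ _ A1_unit A2_box p2_ge0 p1_le p2_le).
- by apply: measurable_box => i; exact: measurable_itv.
- by move=> y; apply: measurable_box => i; exact: measurable_itv.
Qed.

Lemma posterior_expectation_ge0 :
  (0 <= \int[prod_prob (fun _ : 'I_n => density_prob f0)]_x posterior E x B)%E.
Proof.
apply: (integral_posterior_ge0 B f0 (supp := supp)).
  exact: (DPA_expectation_le mL w0_gt0 w0_le1 omega_w0 U_large a_gt0).
exact: supp_ge0.
Qed.

Lemma posterior_expectation_le :
  (\int[prod_prob (fun _ : 'I_n => density_prob f0)]_x posterior E x B <=
   (Num.sqrt Kn * (expR 1 / Num.sqrt pm0) *
      ((K.+1%:R ^+ (N + m)) * expR (n%:R^-1 - rr ^+ 2 / 16) ^+ n) +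
    Kn^-1 * (1 + 2 * e ^+ 2 / lo0) ^+ n)%:E)%E.
Proof.
have g0_gt0 x : I01 x -> 0 < coef_density m L n t x.
  move=> _; rewrite divr_gt0// (lt_le_trans lo0_gt0)//.
  rewrite -[leLHS](_ : spline_fun m L n (periodic m L (fun=> lo0)) x = lo0).
    exact: spline_fun_le.
  by rewrite /spline_fun [X in spline _ _ X](_ : _ = fun=> lo0)// spline_cst.
have mg0 : measurable_fun I01 (coef_density m L n t) by exact: measurable_coef_density.
have nb_supp f : nb f -> supp f by exact: DPA_neighbourhood_support.
have coverP g : g \in cover -> exists w : (N + m).-tuple 'I_K.+1, g = coef_density m L n (grid_coef R w).
  by rewrite mem_filter => /andP[_ /mapP[w _ ->]]; exists w.
have mcover g : g \in cover -> measurable_fun I01 g.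
  by move=> /coverP[w ->]; exact: measurable_coef_density.
have cover_ge0 g : g \in cover -> forall x, I01 x -> 0 <= g x.
  move=> /coverP[w ->] x _; apply: coef_density_ge0 => //.
  exact: grid_coef_mass_gt0.
have cover_far g : g \in cover -> (\int[mu]_(x in I01) (Num.sqrt (f0 x * g x))%:E <= aff%:E)%E.
  by rewrite mem_filter => /andP[/asboolP].
have chi := chi_square_bound q_gt0 mn lo0_gt0 t_ge e_bounds t_near.
apply: le_trans (integral_posterior_le
  (DPA_expectation_le mL w0_gt0 w0_le1 omega_w0 U_large a_gt0)
  (DPA_expectation_le_cst mL w0_gt0 w0_le1 omega_w0 U_large a_gt0)
  E_ge_nb pm_gt0 f0_gt0 g0_gt0 mg0 nb_ge supp_ge0 nb_supp supp_le mcover cover_ge0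
  cover_far chi Kn_gt0) _.
rewrite lee_fin lerD2r.
have aff0 : 0 <= aff ^+ n by rewrite exprn_ge0// expR_ge0.
apply: ler_pM.
- by rewrite mulr_ge0 ?sqrtr_ge0// divr_ge0 ?expR_ge0 ?sqrtr_ge0.
- by rewrite mulr_ge0.
- rewrite ler_wpM2l ?sqrtr_ge0// ler_wpM2l ?expR_ge0//.
  by rewrite lef_pV2 ?posrE ?sqrtr_gt0// ler_wsqrtr.
- by rewrite ler_wpM2r// -natrX ler_nat.
Qed.

End fixed_sample_size.

(** * Asymptotics *)

Section rates.
Context (R : realType).

Lemma powR_exp (x s : R) : 0 < x -> x `^ s = expR (s * ln x).
Proof. by move=> x0; rewrite /powR gt_eqF. Qed.

(** The exponent collects [lo / 2 >= x^-2] raised to [2 r], then [eta >= x^-3] and [lo >= x^-2], and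
    a normalizer [4 / amin + 1] at most [x^(beta + 1)]. *)
Lemma split_mass_power (x N L kap w0 delta beta r lo : R) :
    1 <= x -> 1 <= L -> L <= N -> N <= 2 * x -> 1 <= kap -> 0 < w0 -> w0 <= 1 ->
    0 < delta -> 0 < beta -> 1 <= r -> 32 * kap / w0 <= x -> 4 / delta + 1 <= x ->
    (N * kap)^-1 <= lo ->
  let eta := (4 * x)^-1 * w0 / (4 * kap * L) in
  x `^ (- (4 * r + beta + 6)) <= split_mass_bound lo eta (delta * x `^ (- beta)) r /\
  x `^ (- (4 * r + beta + 6)) <= 2 * L * eta * lo * w0.
Proof.
move=> x1 L1 LN Nx k1 w0_gt0 w01 d0 b0 r1 xw xd Nlo eta.
have x0 : 0 < x by lra.
have xn0 : x != 0 by rewrite gt_eqF.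
have k0 : 0 < kap by lra.
have N0 : 0 < N by lra.
have xkw : 32 * kap <= x * w0 by rewrite -ler_pdivrMr.
have xw' : x * w0 <= x by rewrite ler_piMr// ltW.
have powx k : x `^ (- k%:R) = x ^- k by rewrite powRN powR_mulrn// ltW.
have lo_ge : 2 * x ^- 2 <= lo.
  apply: le_trans Nlo; rewrite -[2 * _]invrK invfM invrK lef_pV2 ?posrE; last 2 first.
  - by rewrite mulr_gt0// exprn_gt0.
  - by rewrite mulr_gt0.
  have : N * kap <= 2 * x * kap by rewrite ler_wpM2r// ltW.
  have : x * (32 * kap) <= x * x by rewrite ler_wpM2l ?(ltW x0)//; lra.
  have := mulr_ge0 (ltW x0) (ltW k0); rewrite expr2; lra.
have lo0 : 0 < lo by apply: lt_le_trans lo_ge; rewrite mulr_gt0// invr_gt0 exprn_gt0.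
have eta_ge : x ^- 3 <= eta.
  have -> : eta = (16 * x * kap * L / w0)^-1.
    by rewrite /eta; field; rewrite ?gt_eqF//=; lra.
  have L0 : 0 < L by lra.
  rewrite lef_pV2 ?posrE ?exprn_gt0//; last first.
    by rewrite divr_gt0// !mulr_gt0.
  rewrite ler_pdivrMr//.
  have h1 : 16 * x * kap * L <= 16 * x * kap * (2 * x).
    by rewrite ler_wpM2l; [|rewrite !mulr_ge0 ?ltW|lra].
  have h2 : x * x * (32 * kap) <= x * x * (x * w0).
    by rewrite ler_wpM2l// mulr_ge0 ?ltW.
  rewrite !exprS expr0; lra.
have eta0 : 0 < eta by apply: lt_le_trans eta_ge; rewrite invr_gt0 exprn_gt0.
have x3 : 0 < x ^- 3 by rewrite invr_gt0 exprn_gt0.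
have x2 : 0 < x ^- 2 by rewrite invr_gt0 exprn_gt0.
split.
  have -> : x `^ (- (4 * r + beta + 6)) = (x ^- 2) `^ (2 * r) * (x ^- 3 * x ^- 2) / (x * x `^ beta).
    rewrite -(powx 2%N) -(powx 3%N) -powRrM -{5}(powRr1 (ltW x0)) -!powRD ?xn0 ?implybT//.
    by rewrite -powRN -powRD ?xn0 ?implybT//; congr (x `^ _); lra.
  rewrite /split_mass_bound; apply: ler_pM.
  - by rewrite mulr_ge0 ?powR_ge0// mulr_ge0 ?ltW.
  - by rewrite invr_ge0 mulr_ge0 ?powR_ge0// ltW.
  - apply: ler_pM; rewrite ?powR_ge0 ?mulr_ge0 ?(ltW x3) ?(ltW x2)//.
      rewrite ge0_ler_powR ?nnegrE ?divr_ge0 ?(ltW lo0) ?(ltW x2)//; lra.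
    by apply: ler_pM; rewrite ?(ltW x3) ?(ltW x2)//; lra.
  - have xb0 : 0 < x `^ beta by rewrite powR_gt0.
    have xb1 : 1 <= x `^ beta by rewrite -(powRr0 x) ler_powR// ltW.
    rewrite lef_pV2 ?posrE; last 2 first.
    - by rewrite mulr_gt0.
    - by rewrite addr_gt0// divr_gt0// mulr_gt0// powR_gt0.
    rewrite powRN invfM invrK mulrA.
    have : (4 / delta + 1) * x `^ beta <= x * x `^ beta by rewrite ler_wpM2r// ltW.
    lra.
apply: (@le_trans _ _ (x ^- 3 * x ^- 2 * x ^- 1)).
  rewrite -(powx 1%N) -(powx 2%N) -(powx 3%N) -!powRD ?xn0 ?implybT//.
  by rewrite ler_powR//; lra.
have w0x : x ^- 1 <= w0.
  rewrite expr1 -[w0]invrK lef_pV2 ?posrE ?invr_gt0//.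
  by rewrite -[_^-1]mul1r ler_pdivrMr//; lra.
apply: ler_pM => //; rewrite ?mulr_ge0 ?(ltW x3) ?(ltW x2) ?invr_ge0 ?exprn_ge0 ?(ltW x0)//.
apply: ler_pM; rewrite ?(ltW x3) ?(ltW x2)//.
  apply: (le_trans eta_ge); rewrite ler_peMl ?(ltW eta0)//; lra.
lra.
Qed.

Lemma prior_mass_exp (n N m : nat) (L kap w0 delta beta r lo : R) :
    (0 < n)%N -> 1 <= L -> L <= N%:R -> N%:R <= 2 * n%:R :> R -> 1 <= kap -> 0 < w0 -> w0 <= 1 ->
    0 < delta -> 0 < beta -> 1 <= r -> 32 * kap / w0 <= n%:R -> 4 / delta + 1 <= n%:R ->
    (N%:R * kap)^-1 <= lo ->
  expR (- ((4 * r + beta + 6) * ln n%:R * (N + m)%:R)) <=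
  split_mass_bound lo ((4 * n%:R)^-1 * w0 / (4 * kap * L)) (delta * n%:R `^ (- beta)) r ^+ N *
    (2 * L * ((4 * n%:R)^-1 * w0 / (4 * kap * L)) * lo * w0) ^+ m.
Proof.
move=> n0 L1 LN Nn k1 w0_gt0 w01 d0 b0 r1 xw xd Nlo.
have n1 : 1 <= n%:R :> R by rewrite ler1n.
have [h1 h2] := split_mass_power n1 L1 LN Nn k1 w0_gt0 w01 d0 b0 r1 xw xd Nlo.
have n0' : 0 < n%:R :> R by rewrite ltr0n.
rewrite -mulNr expRM_natr exprD -mulNr -(powR_exp _ n0').
have pos := powR_ge0 (n%:R : R) (- (4 * r + beta + 6)).
apply: ler_pM; rewrite ?exprn_ge0//; apply: lerXn2r => //; rewrite nnegrE.
  exact: le_trans h1.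
exact: le_trans h2.
Qed.

(** Being closest, [k] is no farther from [x] than the floor of [x], so rounding changes [2^x] by a
    factor at most 2. *)
Lemma resolution_scale (alpha : R) n k : 0 < alpha -> (0 < n)%N ->
    0 < ln n%:R :> R -> closest_resolution alpha n k ->
  let w := (n%:R / ln n%:R) `^ (2 * alpha + 1)^-1 in
  [/\ 0 < w, w `^ (2 * alpha + 1) = n%:R / ln n%:R, w / 2 <= (2 ^ k)%N%:R & (2 ^ k)%N%:R <= 2 * w].
Proof.
move=> a0 n0 l0 [x xE xk] w.
have nl0 : 0 < n%:R / ln n%:R :> R by rewrite divr_gt0// ltr0n.
have p0 : 2 * alpha + 1 != 0 by rewrite gt_eqF//; lra.
have w0 : 0 < w by rewrite powR_gt0.
have {}xk : `|x - k%:R| <= 1.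
  apply: le_trans (xk (Num.floor x)) _.
  rewrite ger0_norm ?subr_ge0 ?floor_le//.
  by have := floorD1_gt x; rewrite intrD => ?; lra.
have n2 : 2 != 0 :> R by [].
have kE : (2 ^ k)%N%:R = 2 `^ k%:R :> R by rewrite powR_mulrn// natrX.
split=> //.
- by rewrite -powRrM mulVf// powRr1// ltW.
- rewrite kE /w -xE -[X in _ / X]powRr1// -powRN -powRD ?n2 ?implybT//.
  by rewrite ler_powR ?ler1n//; move: xk; rewrite ler_norml; lra.
- rewrite kE /w -xE -[X in X * _]powRr1// -powRD ?n2 ?implybT//.
  by rewrite ler_powR ?ler1n//; move: xk; rewrite ler_norml; lra.
Qed.

Lemma scale_large (alpha W : R) : 0 < alpha ->
  \forall n \near \oo, 1 <= ln n%:R :> R /\ W <= (n%:R / ln n%:R) `^ (2 * alpha + 1)^-1.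
Proof.
move=> a0; have p0 : 0 < 2 * alpha + 1 by lra.
set c := Num.max W 0 `^ (2 * alpha + 1).
have c0 : 0 <= c by exact: powR_ge0.
near=> n.
have n1 : expR 1 <= n%:R :> R by near: n; exact: nbhs_infty_ger.
have n0 : 0 < n%:R :> R by apply: lt_le_trans n1; exact: expR_gt0.
have nc : (2 * c) ^+ 2 <= n%:R by near: n; exact: nbhs_infty_ger.
have l1 : 1 <= ln n%:R :> R by rewrite -[leLHS]expRK ler_ln ?posrE ?expR_gt0.
split=> //.
have l0 : 0 < ln n%:R :> R by lra.
have cn : c <= n%:R / ln n%:R.
  rewrite ler_pdivlMr//; set s := Num.sqrt (n%:R : R).
  have s0 : 0 < s by rewrite sqrtr_gt0.
  have sE : n%:R = s ^+ 2 :> R by rewrite sqr_sqrtr// ltW.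
  (* The inequality [ln s < s] at [s = sqrt n]. *)
  have ls : ln n%:R <= 2 * s.
    by have := ln_sublinear s0; rewrite sE lnXn// mulr2n; lra.
  have cs : 2 * c <= s.
    by rewrite -(ler_pXn2r (n := 2)) ?nnegrE ?mulr_ge0 ?(ltW s0)// -sE.
  apply: (le_trans (ler_wpM2l c0 ls)); rewrite sE expr2 mulrA ler_wpM2r ?(ltW s0)//.
  by rewrite mulrC.
apply: (@le_trans _ _ (Num.max W 0)); first by rewrite le_max lexx.
have -> : Num.max W 0 = c `^ (2 * alpha + 1)^-1.
  by rewrite /c -powRrM divff ?gt_eqF// powRr1// le_max lexx orbT.
by rewrite ge0_ler_powR ?nnegrE ?invr_ge0 ?(ltW p0)// divr_ge0 ?ltW.
Unshelve. all: by end_near. Qed.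

End rates.

Section final_estimates.
Context (R : realType).

Lemma omega_away m : exists2 w0 : R, 0 < w0 <= 1 &
  forall j, (0 < j <= m)%N -> w0 <= omega R m j <= 1 - w0.
Proof.
suff H k : (k <= m)%N -> exists2 w0 : R, 0 < w0 <= 1 &
    forall j, (0 < j <= k)%N -> w0 <= omega R m j <= 1 - w0 by exact: H.
elim: k => [_|k IH km]; first by exists 1 => [|[]//]; rewrite ltr01 lexx.
have [w /andP[w0 w1] wP] := IH (ltnW km).
have o0 : 0 < omega R m k.+1 by exact: omega_gt0.
have o1 : omega R m k.+1 < 1 by exact: omega_lt1.
move: o0 o1; set o := omega R m k.+1 => o0 o1.
pose u := Num.min w (Num.min o (1 - o)).
have u1 : u <= w by rewrite ge_min lexx.
have u2 : u <= o by rewrite !ge_min lexx orbT.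
have u3 : u <= 1 - o by rewrite !ge_min lexx !orbT.
exists u.
  by rewrite !lt_min w0 o0 subr_gt0 o1/=; exact: le_trans u1 w1.
move=> j /andP[j0]; rewrite leq_eqVlt => /orP[/eqP->|jk].
  by rewrite -/o u2/=; lra.
by have /andP[h1 h2] := wP j (introT andP (conj j0 jk)); apply/andP; split; lra.
Qed.

Lemma sqrt_expR (y : R) : Num.sqrt (expR y) = expR (y / 2).
Proof.
have -> : expR y = expR (y / 2) ^+ 2 by rewrite -expRM_natl; congr expR; field.
by rewrite sqrtr_sqr ger0_norm// expR_ge0.
Qed.

(** Here [v] is of order [n * eps^2]. The cutoff [exp ((C1 + 1) v)] leaves [exp (- v)] in the
    chi-square term; in the other term the exponent is at most [2 + ((C1 + 1) / 2 + D / 2 + C2) v -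
    n rr^2 / 16], which dictates the size of the constant in the rate. *)
Lemma exponential_tradeoff n (v C1 C2 D rr c P : R) : (0 < n)%N -> 0 <= v ->
    16 * ((C1 + 1) / 2 + D / 2 + C2 + 1) * v <= n%:R * rr ^+ 2 ->
    0 <= P <= expR (C2 * v) -> 0 <= c -> n%:R * c <= C1 * v ->
  Num.sqrt (expR ((C1 + 1) * v)) * (expR 1 / Num.sqrt (expR (- (D * v)))) *
    (P * expR (n%:R^-1 - rr ^+ 2 / 16) ^+ n) + (expR ((C1 + 1) * v))^-1 * (1 + c) ^+ n
  <= (expR 2 + 1) * expR (- v).
Proof.
move=> n0 v0 Mv /andP[P0 PC] c0 cC.
have nn0 : n%:R != 0 :> R by rewrite pnatr_eq0 -lt0n.
rewrite [leRHS]mulrDl mul1r lerD//.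
  rewrite !sqrt_expR -expRM_natl.
  rewrite -(expRN (- (D * v) / 2)) -(expRD 1) -(expRD ((C1 + 1) * v / 2)).
  apply: (@le_trans _ _ (expR ((C1 + 1) * v / 2 + (1 - (- (D * v) / 2))) *
    (expR (C2 * v) * expR (n%:R * (n%:R^-1 - rr ^+ 2 / 16))))).
    by rewrite ler_wpM2l ?expR_ge0// ler_wpM2r// expR_ge0.
  rewrite -!expRD ler_expR mulrBr divff//.
  by move: Mv; set u := _ * rr ^+ 2; rewrite mulrA -/u; lra.
apply: (@le_trans _ _ ((expR ((C1 + 1) * v))^-1 * expR c ^+ n)).
  rewrite ler_wpM2l ?invr_ge0 ?expR_ge0//.
  by rewrite lerXn2r ?nnegrE ?addr_ge0 ?expR_ge0// expR_ge1Dx.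
by rewrite -expRM_natl -expRN -expRD ler_expR; lra.
Qed.

Lemma le_powR_root (s A x : R) : 0 < s -> 0 <= A -> A `^ s^-1 <= x -> A <= x `^ s.
Proof.
move=> s0 A0 Ax; have -> : A = (A `^ s^-1) `^ s by rewrite -powRrM mulVf ?gt_eqF// powRr1.
by rewrite ge0_ler_powR ?nnegrE ?powR_ge0// ?(ltW s0)// (le_trans _ Ax)// powR_ge0.
Qed.

(** As [(2 alpha + 2) * min (alpha, 1) >= 2 alpha], the fine-grid error is of order [N^(-2 alpha)];
    the spare factor [N^(-alpha)] absorbs the uncontrolled constant [C]. *)
Lemma grid_error_small (alpha C N x : R) : 0 < alpha -> 1 <= N -> 0 <= C ->
    (N / 2) `^ (2 * alpha + 1) <= x -> C * 2 `^ (2 * alpha + 1) <= N `^ alpha ->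
  C * (x * N)^-1 `^ (Num.min alpha 1) <= N `^ (- alpha).
Proof.
move=> a0 N1 C0 Nx CN; set p := 2 * alpha + 1; set g := Num.min alpha 1.
have N0 : 0 < N by lra.
have Nn0 : N != 0 by rewrite gt_eqF.
have p0 : 0 < p by rewrite /p; lra.
have g0 : 0 < g by rewrite lt_min a0 ltr01.
have g1 : g <= 1 by rewrite ge_min lexx orbT.
have gp : 2 * alpha <= (p + 1) * g.
  rewrite /p /g minEle; case: ifPn => [_|/negP]; first by have := mulr_gt0 a0 a0; lra.
  by lra.
have t0 : 0 < 2 `^ p :> R by exact: powR_gt0.
have t1 : 1 <= 2 `^ p :> R by rewrite -[leLHS](powRr0 2); apply: ler_powR; rewrite ?ler1n// ltW.
have xN : (2 `^ p)^-1 * N `^ (p + 1) <= x * N.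
  have -> : N `^ (p + 1) = N `^ p * N by rewrite (@powRD _ N p 1) ?Nn0 ?implybT// powRr1 ?(ltW N0).
  rewrite mulrA ler_wpM2r ?(ltW N0)//.
  apply: le_trans Nx; rewrite powRM ?(ltW N0) ?invr_ge0// mulrC.
  by rewrite -(powR_inv1 (ler0n R 2)) -powRrM mulN1r powRN.
have y0 : 0 < N `^ (p + 1) by exact: powR_gt0.
have xN' : (x * N)^-1 <= 2 `^ p * N `^ (- (p + 1)).
  have z0 : 0 < (2 `^ p)^-1 * N `^ (p + 1) by rewrite mulr_gt0// invr_gt0.
  have -> : 2 `^ p * N `^ (- (p + 1)) = ((2 `^ p)^-1 * N `^ (p + 1))^-1.
    by rewrite (powRN N) invfM invrK.
  by rewrite lef_pV2 ?posrE//; exact: lt_le_trans xN.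
have xN0 : 0 <= (x * N)^-1.
  by rewrite invr_ge0; apply: le_trans xN; rewrite mulr_ge0 ?invr_ge0 ?ltW.
apply: (@le_trans _ _ (C * (2 `^ p * N `^ (- (2 * alpha))))).
  rewrite ler_wpM2l//; apply: (@le_trans _ _ ((2 `^ p * N `^ (- (p + 1))) `^ g)).
    by rewrite ge0_ler_powR ?nnegrE ?(ltW g0)// mulr_ge0 ?powR_ge0.
  rewrite powRM ?powR_ge0// ler_pM ?powR_ge0//.
    by rewrite -[leRHS](powRr1 (ltW t0)) ler_powR.
  by rewrite -powRrM ler_powR// mulNr lerN2.
rewrite mulrA (le_trans (ler_wpM2r (powR_ge0 _ _) CN))//.
by rewrite -powRD ?Nn0 ?implybT// ler_powR//; lra.
Qed.

(** With [eps = w^(-alpha)] and [x = n], [l = log n], this is the balance [n * eps^2 = w * log n]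
    behind the choice of resolution. *)
Lemma rate_square (alpha w x l : R) : 0 < w -> 0 < l ->
  w `^ (2 * alpha + 1) = x / l -> x * (w `^ (- alpha)) ^+ 2 = w * l.
Proof.
move=> w0 l0 E; have wn : w != 0 by rewrite gt_eqF.
have -> : x = l * w `^ (2 * alpha + 1) by rewrite E mulrC divfK// gt_eqF.
rewrite -powR_mulrn ?powR_ge0// -powRrM -mulrA -powRD ?wn ?implybT//.
by rewrite mulrC; congr (_ * _); rewrite -[RHS](powRr1 (ltW w0)); congr (_ `^ _); lra.
Qed.

Lemma rateE (alpha w x l : R) : 0 < alpha -> 0 < w -> 0 < l -> 0 < x ->
  w `^ (2 * alpha + 1) = x / l -> (l / x) `^ (alpha / (2 * alpha + 1)) = w `^ (- alpha).
Proof.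
move=> a0 w0 l0 x0 E; have p0 : 2 * alpha + 1 != 0 by rewrite gt_eqF//; lra.
rewrite -invf_div -E -powRN -powRrM; congr (_ `^ _).
by rewrite mulNr mulrC divfK.
Qed.

End final_estimates.

Lemma wrapped_index_bounds (k N m : nat) : (k < N + m)%N ->
  - m%:Z <= (if (k < N)%N then k%:Z else k%:Z - (N + m)%N%:Z) < N%:Z.
Proof. by case: (ltnP k N) => kN kNm; lia. Qed.

(** * Constants, thresholds and contraction for large samples *)

Section contraction.
Context (R : realType).

(** The [+ 1] pays for the fine-grid error, which is below [N^(-alpha)] for large [n]. *)
Definition bias_const (alpha K : R) : R := approx_const alpha * K + 1.

(** From [2 * e^2 / lo0] with [lo0 = rho / 2]; the factor [2^alpha] comes from [N >= w / 2]. *)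
Definition chi_square_const (alpha rho K : R) : R :=
  4 / rho * (bias_const alpha K * 2 `^ alpha) ^+ 2.

Definition prior_mass_const (beta r : R) : R := 4 * (4 * r + beta + 6).

(** At most [4 * w] coefficients, each with at most [n^(m + 7)] grid values. *)
Definition entropy_const (alpha : R) : R := 4 * (sfloor alpha + 7)%:R.

Definition contraction_const (alpha rho K beta r : R) : R :=
  Num.sqrt (16 * ((chi_square_const alpha rho K + 1) / 2 + prior_mass_const beta r / 2 +
    entropy_const alpha + 1)).

Lemma contraction_const_sqr (alpha rho K beta r : R) : 0 < rho -> 0 < beta -> 1 <= r ->
  contraction_const alpha rho K beta r ^+ 2 =
    16 * ((chi_square_const alpha rho K + 1) / 2 + prior_mass_const beta r / 2 +
      entropy_const alpha + 1) /\
  0 < contraction_const alpha rho K beta r.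
Proof.
move=> rho0 b0 r1.
have h1 : 0 <= chi_square_const alpha rho K.
  by rewrite mulr_ge0 ?sqr_ge0// divr_ge0// ltW.
have h2 : 0 <= prior_mass_const beta r by rewrite /prior_mass_const; lra.
have h3 : 0 <= entropy_const alpha by rewrite mulr_ge0.
split; first by rewrite sqr_sqrtr//; lra.
by rewrite sqrtr_gt0; lra.
Qed.

Variables (alpha rho K beta r delta : R) (f0 : density R) (w0 C Bd radius : R) (P0 : {poly R}).
Let m := sfloor alpha.
Let p := 2 * alpha + 1.
Let g := Num.min alpha 1.
(** Chosen so that [2^m * (2 * tau) = rho / 4] in the bound of [spline_coef_near]. *)
Let tau := rho / (8 * 2 ^+ m).
Let hi0 := Bd + rho.
Let lo0 := rho / 2.
Let kap := hi0 / lo0.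
Let A := bias_const alpha K.
(** As soon as [m / N <= s], the oscillation term [2^m * C * (m / N)^g] is at most [rho / 8]; the
    [+ 1] guards against [C = 0]. *)
Let s := (rho / 8 / (2 ^+ m * C + 1)) `^ g^-1.
(** Twice the sum of all thresholds, so that [w >= W] puts each of them below [w / 2], hence below
    both [N] and [n]. *)
Let W := 2 * (4 + (m.+1%:R + (m%:R / s + ((near_pts alpha + m)%:R / radius +
  ((C * 2 `^ p) `^ alpha^-1 + (A `^ alpha^-1 + (32 * kap / w0 + (4 / delta + 1)))))))).

Hypothesis alpha_gt0 : 0 < alpha.
Hypothesis rho_gt0 : 0 < rho.
Hypothesis beta_gt0 : 0 < beta.
Hypothesis r_ge1 : 1 <= r.
Hypothesis delta_gt0 : 0 < delta.
Hypothesis f0H : holder_class alpha f0.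
Hypothesis f0K : holder_norm alpha f0 = K%:E.
Hypothesis f0_ge : forall x, I01 x -> rho <= f0 x.
Hypothesis f0_le : forall x, I01 x -> f0 x <= Bd.
Hypothesis w0_gt0 : 0 < w0.
Hypothesis w0_le1 : w0 <= 1.
Hypothesis omega_w0 : forall j, (0 < j <= m)%N -> w0 <= omega R m j <= 1 - w0.
Hypothesis C_ge0 : 0 <= C.
Hypothesis modulus : forall x y, I01 x -> I01 y -> `|f0 x - f0 y| <= C * `|x - y| `^ g.
Hypothesis P0_size : (size P0 <= m.+1)%N.
Hypothesis P0_near : forall y, I01 y -> `|f0 y - P0.[y]| <= K * `|y - 0| `^ alpha.
Hypothesis radius_gt0 : 0 < radius.
Hypothesis P0_cont : forall y, - radius <= y <= 0 -> `|P0.[y] - f0 0| <= tau.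

Let p_gt0 : 0 < p. Proof. by have h := alpha_gt0; rewrite /p; lra. Qed.
Let g_gt0 : 0 < g. Proof. by rewrite lt_min alpha_gt0 ltr01. Qed.
Let I0 : I01 (0 : R). Proof. by rewrite /I01/= in_itv/= lexx ltr01. Qed.
Let Bd_ge : rho <= Bd. Proof. exact: le_trans (f0_ge I0) (f0_le I0). Qed.
Let lo0_gt0 : 0 < lo0. Proof. by rewrite divr_gt0. Qed.
Let kap_ge1 : 1 <= kap.
Proof. by rewrite ler_pdivlMr//; have h1 := Bd_ge; have h2 := rho_gt0; rewrite /lo0 /hi0; lra. Qed.
Let tau_gt0 : 0 < tau. Proof. by rewrite divr_gt0// mulr_gt0// exprn_gt0. Qed.
Let A_ge1 : 1 <= A.
Proof.
by rewrite lerDr mulr_ge0// ?approx_const_ge0//; exact: (holder_norm_ge0 alpha_gt0 f0K).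
Qed.
Let arg_gt0 : 0 < rho / 8 / (2 ^+ m * C + 1).
Proof.
by apply: divr_gt0; [exact: divr_gt0|rewrite ltr_wpDl// mulr_ge0// ltW].
Qed.
Let s_gt0 : 0 < s. Proof. by rewrite powR_gt0. Qed.

Let thresholds w : W <= w -> [/\ 4 <= w / 2, m.+1%:R <= w / 2, m%:R / s <= w / 2,
    (near_pts alpha + m)%:R / radius <= w / 2 & (C * 2 `^ p) `^ alpha^-1 <= w / 2] /\
  [/\ A `^ alpha^-1 <= w / 2, 32 * kap / w0 <= w / 2 & 4 / delta + 1 <= w / 2].
Proof.
rewrite /W.
have h2 : 0 <= m.+1%:R :> R by [].
have h3 : 0 <= m%:R / s by rewrite divr_ge0// ltW.
have h4 : 0 <= (near_pts alpha + m)%:R / radius by rewrite divr_ge0// ltW.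
have h5 := powR_ge0 (C * 2 `^ p) alpha^-1.
have h6 := powR_ge0 A alpha^-1.
have h7 : 0 <= 32 * kap / w0.
  exact: divr_ge0 (mulr_ge0 (ler0n _ 32) (le_trans ler01 kap_ge1)) (ltW w0_gt0).
have h8 : 0 <= 4 / delta by rewrite divr_ge0// ltW.
move: h2 h3 h4 h5 h6 h7 h8.
set c2 := m.+1%:R; set c3 := m%:R / s; set c4 := _ / radius.
set c5 := (C * _) `^ _; set c6 := A `^ _; set c7 := _ / w0; set c8 := 4 / delta.
by move=> *; split; split; lra.
Qed.

Section one_sample_size.
Variables (n L : nat) (w U : R) (a : nat -> R) (B : set (R -> R)).
Local Notation N := (2 ^ L)%N.
Hypothesis ln_ge1 : 1 <= ln n%:R :> R.
Hypothesis wE : w `^ p = n%:R / ln n%:R.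
Hypothesis w_ge : W <= w.
Hypothesis N_ge : w / 2 <= N%:R.
Hypothesis N_le : N%:R <= 2 * w.
Hypothesis U_large : 1 <= w0 * U.
Hypothesis a_bounds : forall l, (0 < l <= L)%N -> delta * n%:R `^ (- beta) <= a l <= r.
Hypothesis B_far : forall f, B f ->
  ((contraction_const alpha rho K beta r * w `^ (- alpha))%:E < L1_dist f0 f)%E \/
  ((contraction_const alpha rho K beta r * w `^ (- alpha))%:E < hellinger_dist f0 f)%E.

Let n_gt0 : (0 < n)%N.
Proof.
rewrite lt0n; apply/eqP => n0; have := ln_ge1.
by rewrite n0 ln0// ler10.
Qed.
Let l_gt0 : 0 < ln n%:R :> R. Proof. exact: lt_le_trans ln_ge1. Qed.
Let n1 : 1 <= n%:R :> R. Proof. by rewrite ler1n. Qed.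
Let w_ge8 : 8 <= w.
Proof. by have [[h _ _ _ _] _] := thresholds w_ge; lra. Qed.
Let w_gt0 : 0 < w. Proof. by have h := w_ge8; lra. Qed.
Let pw_le : w `^ p <= n%:R.
Proof. by rewrite wE ler_pdivrMr// ler_peMr. Qed.
Let w_le : w <= n%:R.
Proof.
apply: le_trans pw_le; rewrite -[leLHS](powRr1 (ltW w_gt0)).
apply: ler_powR; first by have h := w_ge8; lra.
by have h := alpha_gt0; rewrite /p; lra.
Qed.
Let le_N c : c <= w / 2 -> c <= N%:R. Proof. by move=> h; exact: le_trans h N_ge. Qed.
Let le_n c : c <= w / 2 -> c <= n%:R.
Proof. by move=> h; have h1 := w_le; have h2 := w_gt0; lra. Qed.
Let mN : (m < N)%N.
Proof. by have [[_ h _ _ _] _] := thresholds w_ge; rewrite -(ler_nat R); exact: le_N. Qed.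
Let mn : (m < n)%N.
Proof. by have [[_ h _ _ _] _] := thresholds w_ge; rewrite -(ler_nat R); exact: le_n. Qed.
Let N4 : 4 <= N%:R :> R.
Proof. by have [[h _ _ _ _] _] := thresholds w_ge; exact: le_N. Qed.
Let n4 : 4 <= n%:R :> R.
Proof. by have [[h _ _ _ _] _] := thresholds w_ge; exact: le_n. Qed.
Let N_gt0 : 0 < N%:R :> R. Proof. by rewrite ltr0n expn_gt0. Qed.
Let L_gt0 : (0 < L)%N.
Proof.
rewrite lt0n; apply/eqP => L0; have := N4.
by rewrite L0 expn0 lern1.
Qed.
Let Nn : N%:R <= 2 * n%:R :> R.
Proof. by have h1 := N_le; have h2 := w_le; lra. Qed.

Let t := wrapped_coef f0 alpha L n P0.

Let t_bounds k : (k < N + m)%N -> lo0 <= t k <= hi0.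
Proof.
move=> kP.
set i : int := if (k < N)%N then k%:Z else k%:Z - (N + m)%N%:Z.
have iP : - m%:Z <= i < N%:Z by exact: wrapped_index_bounds.
have [[_ _ h3 h4 _] _] := thresholds w_ge.
have P0t y : - ((near_pts alpha + m)%:R / N%:R) <= y <= 0 -> `|P0.[y] - f0 0| <= tau.
  move=> /andP[y1 y2]; apply: P0_cont; rewrite y2 andbT (le_trans _ y1)// lerN2.
  by rewrite ler_pdivrMr// mulrC -ler_pdivrMr//; exact: le_N.
have P0t' y : 1 *- (near_pts alpha + m) / N%:R <= y <= 0 -> `|P0.[y] - f0 0| <= tau.
  by move=> h; apply: P0t; rewrite -mulNr.
have [c1 [y Iy c2]] := spline_coef_near alpha_gt0 f0K n_gt0 mN P0_size C_ge0 (ltW g_gt0)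
  (ltW tau_gt0) modulus P0t' iP.
rewrite -/m in c1.
(* The three errors [rho / 8], [rho / 4] and [tau <= rho / 8] add up to at most [rho / 2], which
   leaves the lower bound [lo0 = rho / 2]. *)
have {c1} : `|t k - grid_fun f0 L n P0 (i * n%:Z)| <= rho / 8 + rho / 4.
  apply: le_trans c1 _; rewrite mulrDr lerD//; last first.
    by rewrite /tau le_eqVlt; apply/orP; left; apply/eqP; field; rewrite gt_eqF.
  have mNs : m%:R / N%:R <= s.
    by rewrite ler_pdivrMr// mulrC -ler_pdivrMr//; exact: le_N.
  have mNg : (m%:R / N%:R) `^ g <= rho / 8 / (2 ^+ m * C + 1).
    have -> : rho / 8 / (2 ^+ m * C + 1) = s `^ g.
      by rewrite /s -powRrM mulVf ?gt_eqF// powRr1// ltW.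
    by rewrite ge0_ler_powR ?nnegrE ?(ltW g_gt0) ?(ltW s_gt0) ?divr_ge0 ?(ltW N_gt0).
  have D0 : 0 <= 2 ^+ m * C by rewrite mulr_ge0// ltW.
  rewrite mulrA; apply: le_trans (ler_wpM2l D0 mNg) _.
  have D1 : 0 < 2 ^+ m * C + 1 by lra.
  rewrite mulrCA ler_piMr//; first by rewrite divr_ge0// ltW.
  by rewrite ler_pdivrMr//; lra.
have tau8 : tau <= rho / 8.
  rewrite /tau ler_pM2l// lef_pV2 ?posrE ?mulr_gt0//.
  by rewrite ler_peMr// exprn_ege1// ler1n.
move: c2; rewrite !ler_norml => /andP[a1 a2] /andP[b1 b2].
have h1 := f0_ge Iy; have h2 := f0_le Iy; have h5 := rho_gt0.
by apply/andP; split; rewrite /lo0 /hi0; lra.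
Qed.

Let e := A * N%:R `^ (- alpha).

Let e_le : e <= A * 2 `^ alpha * w `^ (- alpha).
Proof.
rewrite /e -mulrA ler_wpM2l ?(le_trans ler01)//.
have w2 : 0 < w / 2 by rewrite divr_gt0.
apply: (@le_trans _ _ ((w / 2) `^ (- alpha))).
  rewrite !powRN lef_pV2 ?posrE ?powR_gt0//.
  by rewrite ge0_ler_powR ?nnegrE ?(ltW alpha_gt0) ?(ltW w2) ?(ltW N_gt0).
rewrite powRM ?invr_ge0 ?(ltW w_gt0)// mulrC -(powR_inv1 (ler0n R 2)) -powRrM.
by rewrite mulN1r opprK.
Qed.

Let e_bounds : 0 <= e <= 1.
Proof.
have [_ [h _ _]] := thresholds w_ge.
have A0 : 0 <= A := le_trans ler01 A_ge1.
rewrite mulr_ge0 ?powR_ge0//= /e powRN ler_pdivrMr ?powR_gt0// mul1r.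
by apply: le_powR_root => //; exact: le_N.
Qed.

Let t_near x : I01 x -> `|spline_fun m L n (periodic m L t) x - f0 x| <= e.
Proof.
move=> Ix.
apply: le_trans (spline_wrapped_near alpha_gt0 f0H f0K n_gt0 mN P0_size P0_near Ix C_ge0
  (ltW g_gt0) modulus) _.
have -> : e = approx_const alpha * K * N%:R `^ (- alpha) + N%:R `^ (- alpha).
  by rewrite /e /A /bias_const mulrDl mul1r.
rewrite lerD2l natrM.
have [[_ _ _ _ h] _] := thresholds w_ge.
apply: grid_error_small => //.
- by have h1 := N4; lra.
- apply: le_trans pw_le; rewrite ge0_ler_powR ?nnegrE ?(ltW p_gt0) ?(ltW w_gt0)//.
  by rewrite ler_pdivrMr// mulrC.
- by apply: le_powR_root => //; [rewrite mulr_ge0 ?powR_ge0|exact: le_N].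
Qed.

Let NmE : (N + m)%:R <= 4 * w.
Proof.
have : (N + m)%:R <= (N + N)%:R :> R by rewrite ler_nat leq_add2l ltnW.
by rewrite natrD; have h := N_le; lra.
Qed.

Let pm0 := expR (- (prior_mass_const beta r * (w * ln n%:R))).

Let pm0_le lo : (N%:R * (hi0 / lo0))^-1 <= lo ->
  pm0 <= split_mass_bound lo ((4 * n%:R)^-1 * w0 / (4 * (hi0 / lo0) * L%:R))
     (delta * n%:R `^ (- beta)) r ^+ N *
   (2 * L%:R * ((4 * n%:R)^-1 * w0 / (4 * (hi0 / lo0) * L%:R)) * lo * w0) ^+ m.
Proof.
have [_ [_ h7 h8]] := thresholds w_ge.
move=> Nlo; apply: le_trans (prior_mass_exp m n_gt0 _ _ Nn kap_ge1 w0_gt0 w0_le1 delta_gt0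
  beta_gt0 r_ge1 (le_n h7) (le_n h8) Nlo).
- rewrite /pm0 ler_expR lerN2 /prior_mass_const.
  have q0 : 0 <= (4 * r + beta + 6) * ln n%:R.
    by rewrite mulr_ge0 ?(ltW l_gt0)//; have h1 := r_ge1; have h2 := beta_gt0; lra.
  by apply: le_trans (ler_wpM2l q0 NmE) _; lra.
- by rewrite ler1n.
- by rewrite ler_nat ltnW// ltn_expl.
Qed.

(** The factors are at most [n], [n^(m+1)], [n^3] (as [N <= 2 n] and [n >= 4]) and [n], whence the
    exponent [m + 6]. *)
Let K_large : w0^-1 * (n%:R ^+ m.+1 * N%:R ^+ 2 * n%:R) <= (n ^ (m + 6))%N%:R :> R.
Proof.
have [_ [_ h7 _]] := thresholds w_ge.
have n0 : 0 <= n%:R :> R by [].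
have w0n : w0^-1 <= n%:R.
  apply: le_trans (le_n h7); rewrite ler_peMl ?invr_ge0 ?(ltW w0_gt0)//.
  by have h := kap_ge1; lra.
have N2 : N%:R ^+ 2 <= n%:R ^+ 3 :> R.
  apply: (@le_trans _ _ ((2 * n%:R) ^+ 2)); first by rewrite lerXn2r ?nnegrE ?mulr_ge0.
  rewrite exprMn [n%:R ^+ 3]exprS ler_wpM2r ?exprn_ge0//.
  by have h := n4; lra.
have -> : (n ^ (m + 6))%N%:R = n%:R * (n%:R ^+ m.+1 * n%:R ^+ 3 * n%:R) :> R.
  by rewrite natrX -exprD -exprSr -exprS; congr (_ ^+ _); rewrite addSn !addnS !addn0.
apply: ler_pM; rewrite ?invr_ge0 ?(ltW w0_gt0) ?mulr_ge0 ?exprn_ge0//.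
by rewrite ler_wpM2r// ler_wpM2l// exprn_ge0.
Qed.

Let entropy_le : (n ^ (m + 6)).+1%:R ^+ (N + m) <= expR (entropy_const alpha * (w * ln n%:R)) :> R.
Proof.
have n0 : 0 < n%:R :> R by rewrite ltr0n.
apply: (@le_trans _ _ ((n%:R ^+ (m + 7)) ^+ (N + m))).
  apply: lerXn2r; rewrite ?nnegrE ?exprn_ge0 ?(ltW n0)// (addnS m 6) exprS -natrX -natrM ler_nat.
  have n2 : (2 <= n)%N by rewrite -(ler_nat R); have h := n4; lra.
  apply: leq_trans (leq_mul n2 (leqnn _)); rewrite mul2n -addnn -addn1 leq_add2l.
  by rewrite expn_gt0 n_gt0.
rewrite -exprM -{1}(@lnK _ (n%:R : R)) ?posrE// -expRM_natr ler_expR natrM mulrA.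
have q0 : 0 <= ln n%:R * (m + 7)%:R :> R by rewrite mulr_ge0// ltW.
by apply: le_trans (ler_wpM2l q0 NmE) _; rewrite /entropy_const -/m; lra.
Qed.

Lemma posterior_contraction :
  (0 <= \int[prod_prob (fun _ : 'I_n => density_prob f0)]_x
       posterior (DPA_expectation m L n a U) x B <= ((expR 2 + 1) * expR (- w))%:E)%E.
Proof.
have [M2 M0] := contraction_const_sqr alpha K rho_gt0 beta_gt0 r_ge1.
have amin0 : 0 < delta * n%:R `^ (- beta) by rewrite mulr_gt0// powR_gt0// ltr0n.
have f0_gt0 x : I01 x -> 0 < f0 x by move=> /f0_ge; exact: lt_le_trans.
apply/andP; split.
  exact: (posterior_expectation_ge0 f0 B n_gt0 mn (ltnW mN) w0_gt0 w0_le1 omega_w0 U_large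
    amin0 a_bounds).
have rr0 : 0 < contraction_const alpha rho K beta r * w `^ (- alpha).
  by rewrite mulr_gt0// powR_gt0.
set C1 := chi_square_const alpha rho K.
apply: le_trans (posterior_expectation_le n_gt0 L_gt0 mn (ltnW mN) w0_gt0 w0_le1 omega_w0
  U_large f0_gt0 lo0_gt0 t_bounds e_bounds t_near amin0 r_ge1 a_bounds rr0 B_far
  (expR_gt0 _) pm0_le K_large (expR_gt0 ((C1 + 1) * (w * ln n%:R)))) _.
have v0 : 0 <= w * ln n%:R by rewrite mulr_ge0 ?(ltW w_gt0) ?(ltW l_gt0).
have sq := rate_square w_gt0 l_gt0 wE.
have /andP[e0 _] := e_bounds.
rewrite lee_fin; apply: le_trans (@exponential_tradeoff R n _ C1 (entropy_const alpha) _ _ _ _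
  n_gt0 v0 _ _ _ _) _.
- by rewrite [leRHS](_ : _ = contraction_const alpha rho K beta r ^+ 2 *
    (n%:R * (w `^ (- alpha)) ^+ 2)); [rewrite sq M2|ring].
- by rewrite exprn_ge0//= entropy_le.
- by rewrite divr_ge0 ?(ltW lo0_gt0)// mulr_ge0// sqr_ge0.
- rewrite -sq.
  have h : e ^+ 2 <= (A * 2 `^ alpha) ^+ 2 * (w `^ (- alpha)) ^+ 2.
    rewrite -exprMn lerXn2r ?nnegrE//.
    by rewrite mulr_ge0 ?powR_ge0// mulr_ge0 ?powR_ge0// (le_trans ler01).
  rewrite /C1 /chi_square_const -/A /lo0.
  have k0 : 0 <= n%:R * (4 / rho) by rewrite mulr_ge0// divr_ge0// ltW.
  have := ler_wpM2l k0 h.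
  rewrite invf_div; lra.
rewrite ler_wpM2l ?addr_ge0 ?expR_ge0// ler_expR lerN2 ler_peMr//.
exact: ltW w_gt0.
Qed.

End one_sample_size.

(** Hides the explicit threshold: [W] absorbs [C], [Bd], [radius] and [delta], none of which appears
    in [contraction_const]. *)
Lemma posterior_contraction_large : exists W : R, forall n L w U (a : nat -> R) B,
  1 <= ln n%:R :> R -> w `^ p = n%:R / ln n%:R -> W <= w ->
  w / 2 <= (2 ^ L)%N%:R -> (2 ^ L)%N%:R <= 2 * w -> 1 <= w0 * U ->
  (forall l, (0 < l <= L)%N -> delta * n%:R `^ (- beta) <= a l <= r) ->
  (forall f, B f ->
    ((contraction_const alpha rho K beta r * w `^ (- alpha))%:E < L1_dist f0 f)%E \/
    ((contraction_const alpha rho K beta r * w `^ (- alpha))%:E < hellinger_dist f0 f)%E) ->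
  (0 <= \int[prod_prob (fun _ : 'I_n => density_prob f0)]_x
       posterior (DPA_expectation m L n a U) x B <= ((expR 2 + 1) * expR (- w))%:E)%E.
Proof. by exists W => *; exact: posterior_contraction. Qed.

End contraction.

Unset Implicit Arguments.
Set Strict Implicit.
Set Printing Implicit Defensive.

Theorem theorem1 (R : realType) (alpha rho K beta Rb : R)
    (alpha_gt0 : 0 < alpha) (rho_gt0 : 0 < rho) (beta_gt0 : 0 < beta)
    (Rb_ge1 : 1 <= Rb) :
  exists M : R, 0 < M /\
  forall (f0 : density R) (L : nat -> nat) (U : nat -> R)
    (a : nat -> nat -> R) (delta : R) (d : (R -> R) -> (R -> R) -> \bar R),
    holder_class alpha f0 ->
    holder_norm alpha f0 = K%:E ->
    (forall x, I01 x -> rho <= f0 x) ->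
    (forall n, (2 <= n)%N -> closest_resolution alpha n (L n)) ->
    U n @[n --> \oo] --> +oo ->
    0 < delta ->
    (forall n l, (2 <= n)%N -> (0 < l <= L n)%N ->
      delta * n%:R `^ (- beta) <= a n l <= Rb) ->
    d = @L1_dist R \/ d = @hellinger_dist R ->
    (\int[prod_prob (fun _ : 'I_n => density_prob f0)]_x
       posterior (DPA_expectation (sfloor alpha) (L n) n (a n) (U n)) x
         [set f | (M * (ln n%:R / n%:R) `^ (alpha / (2 * alpha + 1)))%:E
                    < d f0 f]%E)%E
      @[n --> \oo] --> 0%E.
Proof.
have [_ M_gt0] := contraction_const_sqr alpha K rho_gt0 beta_gt0 Rb_ge1.
(* The witness is fixed before [f0] and [delta] are introduced. *)
exists (contraction_const alpha rho K beta Rb); split=> //.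
move=> f0 L U a delta d f0H f0K f0_ge LP Uoo delta_gt0 aP dP.
set M := contraction_const alpha rho K beta Rb in M_gt0 *.
have [w0 /andP[w0_gt0 w0_le1] omega_w0] := @omega_away R (sfloor alpha).
have [C C_ge0 modulus] := holder_class_modulus alpha_gt0 f0H f0K.
have [Bd f0_bounded] := holder_class_bounded alpha_gt0 f0H f0K.
have f0_le x : I01 x -> f0 x <= Bd.
  by move=> /f0_bounded; rewrite ler_norml => /andP[].
have I0 : I01 (0 : R) by rewrite /I01/= in_itv/= lexx ltr01.
have [P0 P0_size P0_near] := holder_class_poly alpha_gt0 f0H f0K I0.
(* The Hoelder bound at distance 0 vanishes because [alpha > 0]. Continuity of [P0] then keeps its
   values just left of 0 near [f0 0]. *)
have P00 : P0.[0] = f0 0.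
  have := P0_near _ I0; rewrite subrr normr0 powR0 ?gt_eqF// mulr0 normr_le0 subr_eq0.
  by move=> /eqP.
have tau_gt0 : 0 < rho / (8 * 2 ^+ sfloor alpha).
  by rewrite divr_gt0// mulr_gt0// exprn_gt0.
have [radius radius_gt0 P0_cont] : exists2 e, 0 < e &
    forall y, - e <= y <= 0 -> `|P0.[y] - f0 0| <= rho / (8 * 2 ^+ sfloor alpha).
  have /cvgrPdist_le/(_ _ tau_gt0) := @continuous_horner R P0 0.
  move=> /nbhs_ballP[e /= e0 eP]; exists (e / 2); first by rewrite divr_gt0.
  move=> y /andP[y1 y2]; rewrite -P00 distrC; apply: eP.
  by rewrite /ball/= sub0r normrN ler0_norm//; lra.
have [W WP] := posterior_contraction_large alpha_gt0 rho_gt0 beta_gt0 Rb_ge1 delta_gt0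
  f0H f0K f0_ge f0_le w0_gt0 w0_le1 omega_w0 C_ge0 modulus P0_size P0_near radius_gt0 P0_cont.
pose w n : R := (n%:R / ln n%:R) `^ (2 * alpha + 1)^-1.
apply: (@squeeze_cvge _ _ _ _ (fun=> 0%E) _ (fun n => ((expR 2 + 1) * expR (- w n))%:E)).
- near=> n.
  have [l1 Ww] : 1 <= ln n%:R :> R /\ W <= w n by near: n; exact: scale_large.
  have n2 : (2 <= n)%N by near: n; exists 2%N.
  have Un : w0^-1 <= U n by near: n; exact: (cvgryPge U).1.
  have n0 : (0 < n)%N by exact: ltnW.
  have l0 : 0 < ln n%:R :> R by exact: lt_le_trans l1.
  have [w_gt0 wE N_ge N_le] := resolution_scale alpha_gt0 n0 l0 (LP n n2).
  apply: (WP n (L n) (w n)) => //.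
  + by rewrite -ler_pdivrMl// mulr1.
  + by move=> l; exact: aP.
  + move=> f /=; rewrite (rateE alpha_gt0 w_gt0 l0 _ wE) ?ltr0n//.
    by case: dP => -> ?; [left|right].
- exact: cvg_cst.
- apply: cvg_EFin; first by near=> n.
  rewrite -[X in _ --> X](mulr0 (expR 2 + 1)); apply: cvgMr.
  apply: (cvg_comp w (fun x => expR (- x))); last exact: cvgr_expR.
  apply/cvgryPge => A; apply: filterS (scale_large A alpha_gt0) => n [].
  by [].
Unshelve. all: by end_near. Qed.
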